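(* Let $\gamma>0$, let $\varphi:\mathbb{Z}^d\to(0,\infty)$ be bounded, let $(N^\varphi_{x,t})_{t\ge 0}$, $x\in\mathbb{Z}^d$, be independent Poisson processes on a probability space with measure $\mathbb{P}$, the process at $x$ having rate $\varphi(x)$, and write $N^\varphi_t=(N^\varphi_{x,t})_{x\in\mathbb{Z}^d}$. For an initial configuration $\eta_0\in\Omega^{(\gamma)}$ let $$\eta_t=\mathcal{S}^{(\gamma)}(\eta_0+N^\varphi_t),\qquad t\ge 0,$$ which is well-defined for all $\eta_0\in\Omega^{(\gamma)}$ and $t\ge0$ with $\mathbb{P}$-probability $1$. Then: (i) The process $\{\eta_t\}_{t\ge 0}$ is Markovian. (ii) With $\mathbb{P}$-probability $1$, for any $\eta_0\in\Omega^{(\gamma)}$ (and $t\ge 0$) we have $$\eta_t=\lim_{V}\prod_{x\in V}\left(a^{(\gamma)}_x\right)^{N^\varphi_{x,t}}(\eta_0),$$ where the limit is over finite sets $V\uparrow\mathbb{Z}^d$. (iii) If $\eta_0$ is distributed according to $m^{(\gamma)}$ (independently of the Poisson processes), then $\{\eta_t\}_{t\ge0}$ is stationary.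
   Context: Fix the dimension $d\ge1$; $x\sim y$ in $\mathbb{Z}^d$ means Euclidean distance $|x-y|=1$. For real $\gamma\ge0$ the toppling matrix is $\Delta^{(\gamma)}_{xx}=2d+\gamma$, $\Delta^{(\gamma)}_{xy}=-1$ if $x\sim y$, and $0$ otherwise. Let $\mathcal{X}=[0,\infty)^{\mathbb{Z}^d}$ and $\Omega^{(\gamma)}=[0,2d+\gamma)^{\mathbb{Z}^d}$, with the product topology; configurations in $\Omega^{(\gamma)}$ are called $\gamma$-stable, and a site $x$ is $\gamma$-unstable in $\eta$ if $\eta_x\ge2d+\gamma$. A $\gamma$-toppling of $x$ replaces $\eta$ by $(\eta_y-\Delta^{(\gamma)}_{xy})_{y\in\mathbb{Z}^d}$; it is legal if $x$ is $\gamma$-unstable before toppling. A (finite or infinite) sequence of legal $\gamma$-topplings of $\eta\in\mathcal{X}$ is $\gamma$-exhaustive if every site that is $\gamma$-unstable after some finite number of the topplings is toppled at some later step. The number $(N^{(\gamma)}(\eta))_x\in\{0,1,\dots\}\cup\{\infty\}$ of topplings at $x$ in a $\gamma$-exhaustive sequence does not depend on the sequence. $\eta$ is $\gamma$-stabilizable if $(N^{(\gamma)}(\eta))_x<\infty$ for all $x\in\mathbb{Z}^d$, and then its $\gamma$-stabilization is $\mathcal{S}^{(\gamma)}(\eta)=\eta-\Delta^{(\gamma)}N^{(\gamma)}(\eta)\in\Omega^{(\gamma)}$. For $\gamma>0$ the addition operators $a^{(\gamma)}_x\eta=\mathcal{S}^{(\gamma)}(\eta+\delta_x)$, $x\in\mathbb{Z}^d$,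 are defined on all of $\Omega^{(\gamma)}$ and commute; here $\delta_x$ is $1$ at $x$ and $0$ elsewhere. For finite $\Lambda\subseteq\mathbb{Z}^d$, $\eta\in[0,2d+\gamma)^\Lambda$ is allowed if there is no nonempty $W\subseteq\Lambda$ with $\eta_y<|\{z\in W:z\sim y\}|$ for every $y\in W$; $m^{(\gamma)}_\Lambda$ is the normalized Lebesgue measure on the set of allowed configurations, and for $\gamma>0$, $m^{(\gamma)}$ is the weak limit (which exists) of $m^{(\gamma)}_\Lambda$ as $\Lambda\uparrow\mathbb{Z}^d$, a probability measure on $\Omega^{(\gamma)}$ (configurations in $\Lambda$ being extended by $0$). *)

(* Defs.v *)
From HB Require Import structures.
From mathcomp Require Import all_boot all_order all_algebra.
From mathcomp Require Import finmap.
From mathcomp Require Import all_classical all_reals all_analysis.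

Set Implicit Arguments.
Unset Strict Implicit.
Unset Printing Implicit Defensive.

Import Order.TTheory GRing.Theory Num.Theory.
Import numFieldNormedType.Exports.

Local Open Scope classical_set_scope.
Local Open Scope ring_scope.

Definition site (d : nat) : Type := 'rV[int]_d.
HB.instance Definition _ d := Choice.on (site d).

(* Squared Euclidean distance 1, i.e. Euclidean distance 1. *)
Definition adj d (x y : site d) : bool :=
  \sum_(i < d) (x ord0 i - y ord0 i) ^+ 2 == 1.

(* The order of finite sets of sites by inclusion, as a filter: convergence
   along it is convergence over finite sets increasing to the whole lattice. *)
Definition finite_sets_up (I : choiceType) : set_system {fset I} :=
  filter_from setT (fun A : {fset I} => [set B : {fset I} | fsubset A B]).

(* [config R d] carries the product topology and the product sigma-algebra,
   generated by the coordinate maps; as the lattice is countable, the latter is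
   the Borel sigma-algebra of the former. *)
Definition config (R : realType) (d : nat) : Type := {ptws site d -> R}.

Section config_structures.
Variables (R : realType) (d : nat).

HB.instance Definition _ := Topological.copy (config R d) {ptws site d -> R}.
HB.instance Definition _ :=
  isPointed.Build (config R d) (fun _ : site d => 0 : R).

Definition cylinders : set (set (config R d)) :=
  \bigcup_(x in [set: site d])
    preimage_set_system setT (fun eta : config R d => eta x) measurable.

HB.instance Definition _ := @isMeasurable.Build (sigma_display cylinders)
  (config R d) <<s cylinders >> (@sigma_algebra0 _ setT cylinders)
  (@sigma_algebraC (config R d) cylinders)
  (@sigma_algebra_bigcup _ setT cylinders).

End config_structures.

Section sandpile.
Variables (R : realType) (d : nat) (gamma : R).

Definition height_bound : R := (2 * d)%:R + gamma.

Definition stable_configs : set (config R d) :=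
  [set eta | forall x, 0 <= eta x < height_bound].

Definition unstable (eta : config R d) (x : site d) : Prop :=
  height_bound <= eta x.

Definition toppling (x y : site d) : R :=
  if x == y then height_bound else if adj x y then -1 else 0.

Definition topple (x : site d) (eta : config R d) : config R d :=
  fun y => eta y - toppling x y.

(* A finite or infinite sequence of sites is a map [s : nat -> option (site d)];
   a finite sequence of length n is [None] from index n on. *)
Fixpoint after (eta : config R d) (s : nat -> option (site d)) (k : nat) :
    config R d :=
  if k is k'.+1 then
    if s k' is Some x then topple x (after eta s k') else after eta s k'
  else eta.

Definition legal (eta : config R d) (s : nat -> option (site d)) : Prop :=
  (forall k, s k = None -> s k.+1 = None) /\
  (forall k x, s k = Some x -> unstable (after eta s k) x).

Definition exhaustive (eta : config R d) (s : nat -> option (site d)) : Prop :=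
  legal eta s /\
  (forall k x, unstable (after eta s k) x ->
     exists j, (k <= j)%N /\ s j = Some x).

(* An exhaustive sequence always exists, and by the abelian property all of them
   have the same toppling numbers, so the choice is immaterial. *)
Definition odometer (eta : config R d) (x : site d) : \bar R :=
  counting [set k | xget (fun=> None) [set s | exhaustive eta s] k = Some x].

Definition stabilizable (eta : config R d) : Prop :=
  forall x, (odometer eta x < +oo)%E.

Definition stabilization (eta : config R d) : config R d :=
  fun x => eta x -
    \sum_(y \in [set: site d]) toppling x y * fine (odometer eta y).

Definition addition_op (x : site d) (eta : config R d) : config R d :=
  stabilization (fun y => eta y + (y == x)%:R).

Definition add_particles (eta : config R d) (n : site d -> nat) : config R d :=
  fun x => eta x + (n x)%:R.

(* The product (composition) of the [addition_op x ^ n x] over x in V. These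
   operators commute on stable configurations when gamma > 0, so the order in
   which V is enumerated does not matter. *)
Definition addition_ops (V : {fset site d}) (n : site d -> nat) :
    config R d -> config R d :=
  \big[(fun f g => f \o g)/id]_(x <- enum_fset V) iter (n x) (addition_op x).

End sandpile.

Section lebesgue_step.
Context (R : realType) (n : nat).
Variable mu :
  {sigma_finite_measure set (n.-tuple (measurableTypeR R)) -> \bar R}.

Definition tuple_cons (z : measurableTypeR R * n.-tuple (measurableTypeR R)) :
    n.+1.-tuple (measurableTypeR R) :=
  [the n.+1.-tuple (measurableTypeR R) of z.1 :: z.2].

Lemma measurable_tuple_cons : measurable_fun
  [set: measurableTypeR R * n.-tuple (measurableTypeR R)] tuple_cons.
Proof. exact: measurable_cons. Qed.

Let leb : {sigma_finite_measure set (measurableTypeR R) -> \bar R} :=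
  @lebesgue_measure R.

Definition lebesgue_step : set (n.+1.-tuple (measurableTypeR R)) -> \bar R :=
  pushforward (leb \x mu)%E tuple_cons.

Let step0 : lebesgue_step set0 = 0%E.
Proof. by rewrite /lebesgue_step /pushforward preimage_set0 measure0. Qed.

Let step_ge0 A : (0 <= lebesgue_step A)%E.
Proof. by rewrite /lebesgue_step /pushforward measure_ge0. Qed.

Let step_sigma_additive : semi_sigma_additive lebesgue_step.
Proof.
have mc := measurable_tuple_cons.
move=> F mF tF mUF; rewrite /lebesgue_step /pushforward preimage_bigcup.
apply: measure_semi_sigma_additive.
- by move=> k; rewrite -[X in measurable X]setTI; exact: mc.
- apply/trivIsetP => /= i j _ _ ij; rewrite -preimage_setI.
  by move/trivIsetP : tF => /(_ _ _ _ _ ij) ->//; rewrite preimage_set0.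
- by rewrite -preimage_bigcup -[X in measurable X]setTI; exact: mc.
Qed.

HB.instance Definition _ := isMeasure.Build _ _ _ lebesgue_step
  step0 step_ge0 step_sigma_additive.

Let step_sigma_finite : sigma_finite setT lebesgue_step.
Proof.
have /sigma_finiteP[F [TF ndF Foo]] := sigma_finiteT leb.
have /sigma_finiteP[G [TG ndG Goo]] := sigma_finiteT mu.
pose uncons (t : n.+1.-tuple (measurableTypeR R)) :
    measurableTypeR R * n.-tuple (measurableTypeR R) :=
  (thead t, [tuple of behead t]).
have consK : cancel tuple_cons uncons.
  by case=> a t; congr pair; apply/val_inj.
have munc : measurable_fun setT uncons.
  apply: measurable_fun_pair; [exact: measurable_tnth|exact: measurable_behead].
have mFG k : measurable (F k `*` G k).
  by apply: measurableX; [exact: (Foo k).1|exact: (Goo k).1].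
exists (fun k => uncons @^-1` (F k `*` G k)).
  apply/seteqP; split=> // t _.
  have [i _ Fi] : (\bigcup_i F i) (uncons t).1 by rewrite -TF.
  have [j _ Gj] : (\bigcup_i G i) (uncons t).2 by rewrite -TG.
  exists (maxn i j) => //; split.
  - by apply: subsetPset (ndF _ _ (leq_maxl i j)) _ Fi.
  - by apply: subsetPset (ndG _ _ (leq_maxr i j)) _ Gj.
move=> k; split.
  by rewrite -[X in measurable X]setTI; exact: munc.
rewrite /lebesgue_step /pushforward -comp_preimage (_ : uncons \o _ = id).
  have [[mF Fk] [mG Gk]] := (Foo k, Goo k).
  by rewrite preimage_id product_measure1E// lte_mul_pinfty// ge0_fin_numE.
by apply/funext => z; exact: consK.
Qed.

HB.instance Definition _ := Measure_isSigmaFinite.Build _ _ _ lebesgue_step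
  step_sigma_finite.

End lebesgue_step.

(* Lebesgue measure on R^n, as an iterated product of [lebesgue_measure]. *)
Fixpoint lebesgue_tuple (R : realType) (n : nat) :
    {sigma_finite_measure set (n.-tuple (measurableTypeR R)) -> \bar R} :=
  if n is n'.+1 then lebesgue_step (lebesgue_tuple R n')
  else dirac [tuple] :
    {sigma_finite_measure set (0.-tuple (measurableTypeR R)) -> \bar R}.

Section allowed.
Variables (R : realType) (d : nat) (gamma : R) (L : {fset site d}).

(* R^L is represented by tuples indexed by the enumeration of L. *)
Definition extend0 (t : (#|` L|).-tuple (measurableTypeR R)) : config R d :=
  fun x => if x \in L then nth 0 t (index x (enum_fset L)) else 0.

Definition allowed : set ((#|` L|).-tuple (measurableTypeR R)) :=
  [set t | (forall i, 0 <= tnth t i < height_bound d gamma) /\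
    ~ exists W : {fset site d},
        [/\ W != fset0, fsubset W L &
            forall y, y \in W ->
              extend0 t y < (#|` [fset z in W | adj z y]%fset|)%:R]].

(* The integral of [f] against m_L, the normalized Lebesgue measure on the
   allowed configurations in L, pushed forward by [extend0]. *)
Definition mean_allowed (f : config R d -> R) : R :=
  (\int[lebesgue_tuple R #|` L|]_(t in allowed) f (extend0 t)) /
  fine (lebesgue_tuple R #|` L| allowed).

End allowed.

(* [m] is the weak limit, on the space of gamma-stable configurations with the
   product topology, of the measures m_L as L increases to the whole lattice. *)
Definition is_sandpile_measure (R : realType) (d : nat) (gamma : R)
    (m : probability (config R d) R) : Prop :=
  m (@stable_configs R d gamma) = 1%E /\
  forall f : config R d -> R,
    {within @stable_configs R d gamma, continuous f} ->
    (exists M, forall eta, @stable_configs R d gamma eta -> `|f eta| <= M) ->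
    mean_allowed gamma L f @[L --> @finite_sets_up (site d)] -->
      (\int[m]_(eta in @stable_configs R d gamma) f eta).

Section probability_notions.
Context (dT : measure_display) (T : measurableType dT) (R : realType).
Variable P : probability T R.

Definition sigma_of (I : Type) dU (U : measurableType dU) (D : set I)
    (X : I -> T -> U) : set (set T) :=
  <<s \bigcup_(i in D) preimage_set_system setT (X i) measurable >>.

Definition mutually_independent (I : choiceType) (G : I -> set (set T)) :
    Prop :=
  forall (J : {fset I}) (E : I -> set T), (forall i, i \in J -> G i (E i)) ->
    P (\bigcap_(i in [set` J]) E i) = (\prod_(i <- enum_fset J) P (E i))%E.

Definition independent2 (F G : set (set T)) : Prop :=
  forall A B, F A -> G B -> P (A `&` B) = (P A * P B)%E.

Record poisson_process (rate : R) (N : R -> T -> nat) : Prop := {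
  poisson_measurable : forall t, 0 <= t -> measurable_fun setT (N t);
  poisson_paths : {ae P, forall w, [/\ N 0 w = 0%N,
    forall s t, 0 <= s -> s <= t -> (N s w <= N t w)%N &
    forall t, 0 <= t -> \forall s \near t^'+, N s w = N t w]};
  poisson_increments : forall s t k, 0 <= s -> s < t ->
    P [set w | N t w = (N s w + k)%N] = (poisson_pmf (rate * (t - s)) k)%:E;
  poisson_independent_increments : forall u : nat -> R, 0 <= u 0%N ->
    (forall i, u i <= u i.+1) ->
    mutually_independent (fun i => preimage_set_system setT
      (fun w => (N (u i.+1) w)%:R - (N (u i) w)%:R : R) measurable)
}.

(* [g] is a version of the conditional probability of [E] given [G]. *)
Definition is_cond_prob (G : set (set T)) (E : set T) (g : T -> R) : Prop :=
  [/\ forall B, measurable B -> G (g @^-1` B),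
      P.-integrable setT (EFin \o g) &
      forall F, G F -> (\int[P]_(w in F) (g w)%:E = P (E `&` F))%E].

(* Markov property: the conditional probabilities of {X t in A} given the past
   up to time s and given X s coincide, i.e. they have a common version. *)
Definition is_markov dU (U : measurableType dU) (X : R -> T -> U) : Prop :=
  (forall t, 0 <= t -> measurable_fun setT (X t)) /\
  forall s t, 0 <= s -> s <= t -> forall A, measurable A -> exists g : T -> R,
    is_cond_prob (sigma_of [set u | 0 <= u <= s] X) (X t @^-1` A) g /\
    is_cond_prob (preimage_set_system setT (X s) measurable) (X t @^-1` A) g.

Definition is_stationary dU (U : measurableType dU) (X : R -> T -> U) : Prop :=
  (forall t, 0 <= t -> measurable_fun setT (X t)) /\
  forall n (u : 'I_n -> R) s, (forall i, 0 <= u i) -> 0 <= s ->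
  forall B : set (n.-tuple U), measurable B ->
    P [set w | B [tuple X (u i + s) w | i < n]] =
    P [set w | B [tuple X (u i) w | i < n]].

End probability_notions.

Section process.
Context (dT : measure_display) (T : measurableType dT) (R : realType).
Variables (P : probability T R) (d : nat) (gamma : R).

Definition independent_poisson_processes (phi : site d -> R)
    (N : site d -> R -> T -> nat) : Prop :=
  (forall x, poisson_process P (phi x) (N x)) /\
  mutually_independent P (fun x => sigma_of [set t : R | 0 <= t] (N x)).

(* The initial configuration is gamma-stable, possibly random, and independent
   of the Poisson processes; constants are a particular case. *)
Definition initial_config (N : site d -> R -> T -> nat)
    (eta0 : {RV P >-> config R d}) : Prop :=
  (forall w, stable_configs gamma (eta0 w)) /\
  independent2 P (preimage_set_system setT eta0 measurable)
    (sigma_of [set xt : site d * R | 0 <= xt.2] (fun xt => N xt.1 xt.2)).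

Definition sandpile_process (N : site d -> R -> T -> nat)
    (eta0 : T -> config R d) (t : R) (w : T) : config R d :=
  stabilization gamma (add_particles (eta0 w) (fun x => N x t w)).

End process.

(* Main.v *)
(* The stabilization of eta + n is the stabilization of S(eta) + n, so eta_{s+u} is
   a fixed measurable function of eta_s and of the particles added after time s,
   which are independent of the past up to time s and stationary. This gives the
   Markov property, and stationarity once m is invariant under eta -> S(eta + n).

   Stabilizability: a nonnegative v with Delta v >= eta bounds the toppling numbers
   of eta. The Neumann series for v = Delta^{-1} (h + N_t), h = 2d + gamma, has a mean
   bounded uniformly in x, since phi is bounded and gamma > 0, hence it converges
   almost surely at every site.

   Invariance of m: in a finite volume L the addition operator preserves m_L, as it
   is injective on allowed configurations and piecewise a translation. Weighting
   the mass at y by rho^|x-y| with rho > 1 slightly above 1 shows that, under m_L, the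
   avalanche started at x reaches distance r with probability O(rho^-r), uniformly
   in L. Local events depend on finitely many comparisons of heights with constants,
   near which m_L has little mass, so that their m_L-probabilities converge to their
   m-probabilities although their indicators are not continuous. *)
From HB Require Import structures.
Require Import Defs.
From mathcomp Require Import all_boot all_order all_algebra.
From mathcomp Require Import finmap.
From mathcomp Require Import all_classical all_reals all_analysis.
From mathcomp Require Import measurable_realfun.
From mathcomp Require Import zify ring lra.

Set Implicit Arguments.
Unset Strict Implicit.
Unset Printing Implicit Defensive.

Import Order.TTheory GRing.Theory Num.Theory.
Import numFieldNormedType.Exports.

Local Open Scope classical_set_scope.
Local Open Scope ring_scope.

(** Toppling numbers are treated as suprema of counts over finite legal lists whose sites are
    confined to a set L. One notion then serves finite volumes and the whole lattice, is monotone in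
    L and in the heights, and is measurable because there are countably many lists. Exhaustive
    sequences appear only to identify it with the odometer. Weak convergence sees continuous
    functions only, while toppling is decided by sharp thresholds. An avalanche confined to a finite
    ball is decided by finitely many comparisons, and the exponential decay pays for the
    confinement. The limits are taken in a fixed order: the volume L at fixed radius r, then r, then
    the finite set of sites that receive particles. One null set has to serve all initial
    configurations and all times, so stabilizability is proved for the constant height h at integer
    times and extended by monotonicity. The Poisson hypotheses concern increments at a single site.
    Independence of past and future grows from there: values at finitely many times, arbitrary sets
    of values, all sites, the initial configuration, generated sigma-algebras. *)

HB.instance Definition _ d := Countable.on (site d).
HB.instance Definition _ d := GRing.Zmodule.on (site d).

(** * The lattice *)

Section lattice.
Variable d : nat.
Implicit Types x y z : site d.

Lemma adjC x y : adj x y = adj y x.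
Proof. by rewrite /adj; congr (_ == _); apply: eq_bigr => i _; ring. Qed.

Lemma adj_irr x : adj x x = false.
Proof.
rewrite /adj big1 // => i _; by rewrite subrr expr0n.
Qed.

Definition nbr x : {fset site d} :=
  [fset z in [fset ((x : 'rV[int]_d) + (-1) ^+ (nat_of_bool ib.2) *: delta_mx ord0 ib.1 : site d)%R
    | ib in {: 'I_d * bool}] | adj x z]%fset.

(** The filter in [nbr] gives one direction. For the other, integers whose squares sum to 1 are all
    0 except one, which is 1 or -1. *)
Lemma nbrE x z : (z \in nbr x) = adj x z.
Proof.
rewrite !inE /=; have [xz|] := boolP (adj x z); last by rewrite andbF.
rewrite andbT; apply/imfsetP => /=.
pose a i : int := x ord0 i - z ord0 i.
have age i : 0 <= a i ^+ 2 by exact: sqr_ge0.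
have s1 : \sum_i a i ^+ 2 = 1 by move/eqP: xz.
have [i ai] : exists i, a i != 0.
  apply/not_existsP => a0; move: s1; rewrite big1 // => i _.
  by have /negP := a0 i; rewrite negbK => /eqP ->; rewrite expr0n.
have ai1 : 1 <= a i ^+ 2.
  by rewrite -gtz0_ge1 lt_neqAle eq_sym sqrf_eq0 ai age.
have a0 j : j != i -> a j = 0.
  move=> ji; move: s1; rewrite (bigD1 i) //= (bigD1 j) //=.
  set s := \sum_(_ | _) _ => s1.
  have sge : 0 <= s by apply: sumr_ge0.
  have := age j; have : a j ^+ 2 <= 0 by lia.
  by move=> *; apply/eqP; rewrite -sqrf_eq0; apply/eqP; lia.
have {}s1 : a i ^+ 2 = 1.
  by move: s1; rewrite (bigD1 i) //= big1 ?addr0 // => j /a0 ->; rewrite expr0n.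
exists (i, a i == 1) => //=.
apply/rowP => j; rewrite !mxE eqxx /=.
have [->|ji] := eqVneq j i.
  move/eqP: s1; rewrite sqrf_eq1 /a => /orP[/eqP e|/eqP e].
    move: e; set u := x ord0 i; set v := z ord0 i => e.
    by change (v = u + (-1) ^+ (u - v == 1) * 1); rewrite e /=; lia.
  move: e; set u := x ord0 i; set v := z ord0 i => e.
  by change (v = u + (-1) ^+ (u - v == 1) * 1); rewrite e /=; lia.
have := a0 j ji; rewrite /a; set u := x ord0 j; set v := z ord0 j => e.
by change (v = u + (-1) ^+ (x ord0 i - z ord0 i == 1) * 0); rewrite mulr0; lia.
Qed.

Lemma card_nbr x : (#|` nbr x| <= 2 * d)%N.
Proof.
apply: leq_trans (fsubset_leq_card (fset_sub _ _)) _.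
apply: leq_trans (leq_imfset_card _ _ _) _.
apply: leq_trans (@uniq_leq_size _ _ (enum {: 'I_d * bool}) _ _) _.
- exact: enum_finmem_uniq.
- by move=> ? _; rewrite mem_enum.
- by rewrite -cardE card_prod card_ord card_bool mulnC.
Qed.

Definition ldist x y : nat := (\sum_(i < d) `|(x : 'rV[int]_d) ord0 i - (y : 'rV[int]_d) ord0 i|)%N.

Lemma ldistxx x : ldist x x = 0%N.
Proof. by rewrite /ldist big1 // => i _; rewrite subrr. Qed.

Lemma ldist_adj x y z : adj y z -> (ldist x z <= (ldist x y).+1)%N.
Proof.
move=> /eqP yz; rewrite -addn1.
have yz1 : (\sum_(i < d) `|y ord0 i - z ord0 i| <= 1)%N.
  rewrite -(ler_nat int) natr_sum -[X in _ <= X]yz.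
  apply: ler_sum => i _; rewrite natz.
  by set a := y ord0 i - z ord0 i; rewrite expr2; nia.
apply: leq_trans (leq_add (leqnn _) yz1).
by rewrite /ldist -big_split leq_sum //= => i _; lia.
Qed.

(** A cube that contains the l1 ball of radius r; only this inclusion is used. *)
Definition ldball x (r : nat) : {fset site d} :=
  [fset ((x : 'rV[int]_d) + \row_i (((f : {ffun 'I_d -> 'I_(2 * r).+1}) i : nat)%:Z - r%:Z) : site d)%R
    | f in {: {ffun 'I_d -> 'I_(2 * r).+1}}]%fset.

Lemma ldballP x r y : (ldist x y <= r)%N -> y \in ldball x r.
Proof.
move=> xy; apply/imfsetP => /=.
have b i : (`|((y : 'rV[int]_d) ord0 i - x ord0 i + r%:Z)%R| < (2 * r).+1)%N /\
    0 <= (y : 'rV[int]_d) ord0 i - x ord0 i + r%:Z.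
  have : (`|x ord0 i - y ord0 i| <= r)%N.
    by apply: leq_trans xy; rewrite /ldist (bigD1 i) //= leq_addr.
  set a := _ ord0 i; set c := _ ord0 i; lia.
exists [ffun i => Ordinal (b i).1] => //.
apply/rowP => i; rewrite !mxE ffunE /=; have := (b i).2.
change (y 0 i) with (y ord0 i); change (x 0 i) with (x ord0 i).
by move: (y ord0 i) (x ord0 i) => u v; lia.
Qed.

End lattice.

(** * Legal topplings and the abelian property *)

Section sandpile.
Variables (R : realType) (d : nat) (gamma : R).
Hypothesis gamma_gt0 : 0 < gamma.
Implicit Types (x y z : site d) (eta : config R d) (v : site d -> R).
Implicit Types (c : site d -> nat) (l : seq (site d)) (L : set (site d)).

Local Notation h := (height_bound d gamma).

Lemma h_ge x : (#|` nbr x|)%:R + gamma <= h.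
Proof. by rewrite /height_bound lerD2r ler_nat card_nbr. Qed.

Lemma h_gt0 : 0 < h.
Proof. by rewrite /height_bound ltr_wpDl. Qed.

(** The toppling matrix applied to v, a discrete Laplacian with mass. *)
Definition lap v x : R := h * v x - \sum_(z <- nbr x) v z.

Lemma lapD v v' x : lap (v \+ v') x = lap v x + lap v' x.
Proof. by rewrite /lap /= big_split /=; ring. Qed.

(** The off-diagonal entries of the toppling matrix are nonpositive. All comparisons of toppling
    numbers below rest on this. *)
Lemma lap_le v v' x : v x = v' x -> (forall z, v z <= v' z) ->
  lap v' x <= lap v x.
Proof. by move=> e vv'; rewrite /lap e lerD2l lerN2 ler_sum. Qed.

(* The heights once every site x has toppled [c x] times. *)
Definition ht eta c : config R d := fun x => eta x - lap (fun z => (c z)%:R) x.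

Lemma ht_ext eta c c' : c =1 c' -> ht eta c = ht eta c'.
Proof. by move=> cc; congr ht; apply/funext. Qed.

Lemma ht_local eta c c' x : c x = c' x -> {in nbr x, c =1 c'} ->
  ht eta c x = ht eta c' x.
Proof.
move=> cx cz; rewrite /ht /lap cx; do 2!congr (_ - _).
by apply: eq_big_seq => z /cz ->.
Qed.

Lemma ht_le eta eta' c c' x : eta x <= eta' x -> c x = c' x ->
  (forall z, (c z <= c' z)%N) -> ht eta c x <= ht eta' c' x.
Proof.
move=> le_eta cx cz; apply: lerB => //.
by apply: lap_le => [|z]; rewrite ?cx ?ler_nat.
Qed.

Lemma ht_add eta c c' : ht (ht eta c) c' = ht eta (fun z => (c z + c' z)%N).
Proof.
apply/funext => x; rewrite /ht.
have -> : (fun z => (c z + c' z)%:R) =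
  (fun z => (c z)%:R) \+ (fun z => (c' z)%:R) :> (site d -> R).
  by apply/funext => z /=; rewrite natrD.
by rewrite lapD; ring.
Qed.

Lemma ht_shift eta v c : ht (fun x => eta x + v x) c = fun x => ht eta c x + v x.
Proof. by apply/funext => x; rewrite /ht addrAC. Qed.

Lemma ht0 eta : ht eta (fun=> 0%N) = eta.
Proof.
by apply/funext => x; rewrite /ht /lap big1 // mulr0 !subr0.
Qed.

Definition cnt l x : nat := count_mem x l.
Arguments cnt : simpl never.

Lemma cnt_cons x l y : cnt (x :: l) y = ((x == y) + cnt l y)%N.
Proof. by []. Qed.

Lemma ht_cons eta x l : ht eta (cnt (x :: l)) = topple gamma x (ht eta (cnt l)).
Proof.
have -> : ht eta (cnt (x :: l)) = ht (ht eta (cnt l)) (fun z => (x == z) : nat).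
  by rewrite ht_add; apply: ht_ext => z; rewrite cnt_cons addnC.
apply/funext => y; rewrite /topple; set zeta := ht eta _.
rewrite /ht; congr (_ - _); rewrite /lap /toppling.
have [<-|xy] := eqVneq x y.
  rewrite mulr1 big1_seq ?subr0 // => z /andP[_].
  by rewrite nbrE; case: eqP => // <-; rewrite adj_irr.
rewrite mulr0 sub0r; have [xy1|xy1] := boolP (adj x y).
  have xy2 : x \in nbr y by rewrite nbrE adjC.
  rewrite (big_fsetD1 x) //= eqxx big1_seq ?addr0 // => z.
  by rewrite !inE => /andP[_ /andP[zx _]]; rewrite eq_sym (negbTE zx).
rewrite big1_seq ?oppr0 // => z /andP[_]; rewrite nbrE adjC.
by case: eqP => // <-; rewrite (negbTE xy1).
Qed.

(* The head of the list is the latest toppling; only sites of L topple. *)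
Fixpoint legal_list L eta l : Prop :=
  if l is x :: l' then [/\ L x, h <= ht eta (cnt l') x & legal_list L eta l'] else True.

Lemma legal_list_congr L L' eta eta' l : legal_list L eta l ->
  (forall x, x \in l -> L' x) -> (forall x, x \in l -> eta x <= eta' x) ->
  legal_list L' eta' l.
Proof.
elim: l => //= x l IH [Lx hx ll] L'l le_eta; split.
- by apply: L'l; rewrite mem_head.
- by apply: le_trans hx _; apply: ht_le => //; apply: le_eta; rewrite mem_head.
- apply: IH => // y yl; [apply: L'l|apply: le_eta]; by rewrite inE yl orbT.
Qed.

Lemma legal_list_mem L eta l x : legal_list L eta l -> x \in l -> L x.
Proof.
by elim: l => //= y l IH [Ly _ /IH{}IH]; rewrite inE => /orP[/eqP ->|/IH].
Qed.

(* Toppling first along l1, and then along l2 the sites that l1 has not yet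
   toppled often enough, remains legal. *)
Lemma legal_list_join L eta l1 l2 : legal_list L eta l1 -> legal_list L eta l2 ->
  exists2 l, legal_list L eta l & forall x, cnt l x = maxn (cnt l1 x) (cnt l2 x).
Proof.
move=> ll1; elim: l2 => [_|x l2 IH] /=.
  by exists l1 => // x; rewrite [cnt [::] x]/cnt /= maxn0.
move=> [Lx hx /IH [l ll lE]].
have [le12|lt12] := leqP (cnt (x :: l2) x) (cnt l1 x).
  exists l => // y; rewrite lE; have [->|xy] := eqVneq y x.
    by move: le12; rewrite cnt_cons eqxx; lia.
  by rewrite cnt_cons eq_sym (negbTE xy).
have lx : cnt l x = cnt l2 x.
  by rewrite lE; move: lt12; rewrite cnt_cons eqxx; lia.
exists (x :: l) => /=.
  split=> //; apply: le_trans hx _; apply: ht_le => // z.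
  by rewrite lE leq_maxr.
move=> y; have [->|xy] := eqVneq y x.
  by move: lt12 lx; rewrite !cnt_cons eqxx; lia.
by rewrite !cnt_cons eq_sym (negbTE xy) lE.
Qed.

(** Least action principle. At the first toppling that would exceed c, the count at x equals [c x]
    and the other counts are at most c, so the height at x is at most [ht eta c x] and x is
    stable. *)
Lemma legal_list_least L eta c l : legal_list L eta l -> (forall x, L x -> ht eta c x < h) ->
  forall x, (cnt l x <= c x)%N.
Proof.
move=> + st; elim: l => //= x l IH [Lx hx /IH {}IH] y.
have [<-|xy] := eqVneq x y; last first.
  by rewrite cnt_cons (negbTE xy); exact: IH.
rewrite cnt_cons eqxx add1n ltnNge; apply/negP => ge.
have e : cnt l x = c x by apply/eqP; rewrite eqn_leq IH.
have := st x Lx; rewrite ltNge => /negP; apply.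
by apply: le_trans hx _; apply: ht_le.
Qed.

(** Least action with a real supersolution. At a first excess [v x < cnt l x + 1], while the counts
    at the neighbours are at most v; then eta <= Delta v puts the height at x below h. *)
Lemma legal_list_real_bound L eta v l : legal_list L eta l -> (forall x, 0 <= v x) ->
  (forall x, L x -> eta x <= lap v x) -> forall x, (cnt l x)%:R <= v x.
Proof.
move=> + v0 ev; elim: l => //= x l IH [Lx hx /IH {}IH] y.
have [<-|xy] := eqVneq x y; last first.
  by rewrite cnt_cons (negbTE xy); exact: IH.
rewrite cnt_cons eqxx add1n leNgt; apply/negP => ge.
move: hx; rewrite leNgt => /negP; apply.
rewrite /ht ltrBlDr; apply: le_lt_trans (ev x Lx) _.
rewrite /lap addrA; apply: ltr_leB; last by apply: ler_sum.
rewrite -[X in X + _]mulr1 -mulrDr ltr_pM2l ?h_gt0 //.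
by move: ge; rewrite -natr1 addrC.
Qed.

Definition finite_topplings L eta := forall x, exists M, forall l, legal_list L eta l -> (cnt l x <= M)%N.

(* Equal to 0 where the number of topplings is not bounded. *)
Definition toppling_count L eta x : nat := xget 0%N
  [set n | (exists2 l, legal_list L eta l & cnt l x = n) /\
           forall l, legal_list L eta l -> (cnt l x <= n)%N].

Lemma toppling_countP L eta x M : (forall l, legal_list L eta l -> (cnt l x <= M)%N) ->
  (exists2 l, legal_list L eta l & cnt l x = toppling_count L eta x) /\
  forall l, legal_list L eta l -> (cnt l x <= toppling_count L eta x)%N.
Proof.
move=> bM; pose P n := `[< exists2 l, legal_list L eta l & cnt l x = n >].
have [|i /asboolP[l ll <-]|n /asboolP Pn maxn] := @ex_maxnP P M.
- by exists 0%N; apply/asboolP; exists [::].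
- exact: bM.
rewrite /toppling_count; case: xgetP => [y _ []//|/(_ n) []]; split=> // l ll.
by apply: maxn; apply/asboolP; exists l.
Qed.

Lemma toppling_count_eq L eta x n : (exists2 l, legal_list L eta l & cnt l x = n) ->
  (forall l, legal_list L eta l -> (cnt l x <= n)%N) -> toppling_count L eta x = n.
Proof.
move=> [l ll ln] ub; have [[l' ll' <-] ub'] := toppling_countP ub.
by apply/eqP; rewrite eqn_leq ub //= -ln (leq_trans (ub' _ ll)) //.
Qed.

Lemma toppling_count_unbounded L eta x :
  ~ (exists M, forall l, legal_list L eta l -> (cnt l x <= M)%N) -> toppling_count L eta x = 0%N.
Proof.
move=> ub; rewrite /toppling_count; case: xgetP => // y _ [_ yub].
by exfalso; apply: ub; exists y.
Qed.

Lemma toppling_count_ub L eta l : finite_topplings L eta -> legal_list L eta l ->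
  forall x, (cnt l x <= toppling_count L eta x)%N.
Proof. by move=> b ll x; have [M /toppling_countP [_]] := b x; apply. Qed.

(** The maxima at finitely many sites are reached by a single list, by [legal_list_join]. This
    reduces statements about infinite avalanches to finite lists. *)
Lemma toppling_count_attained L eta (F : seq (site d)) : finite_topplings L eta ->
  exists2 l, legal_list L eta l & forall x, x \in F -> cnt l x = toppling_count L eta x.
Proof.
move=> b; elim: F => [|x F [l ll lF]]; first by exists [::].
have [M /toppling_countP [[l' ll' l'x] _]] := b x.
have [l2 ll2 l2E] := legal_list_join ll ll'.
exists l2 => // y; rewrite inE => /orP[/eqP ->|yF].
  by apply/eqP; rewrite eqn_leq toppling_count_ub //= l2E l'x leq_maxr.
by apply/eqP; rewrite eqn_leq toppling_count_ub //= l2E (lF _ yF) leq_maxl.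
Qed.

Lemma ht_toppling_count_attained L eta (F : {fset site d}) : finite_topplings L eta ->
  exists2 l, legal_list L eta l & forall x, x \in F ->
    cnt l x = toppling_count L eta x /\ ht eta (toppling_count L eta) x = ht eta (cnt l) x.
Proof.
move=> b.
have [l ll lE] := toppling_count_attained (F ++ flatten [seq enum_fset (nbr x) | x <- enum_fset F]) b.
exists l => // x xF; split; first by rewrite lE // mem_cat xF.
apply: ht_local => [|z zx]; rewrite lE // mem_cat ?xF //.
by apply/orP; right; apply/flattenP; exists (enum_fset (nbr x)) => //; apply: map_f.
Qed.

(** Otherwise a list attaining the maxima around x could be prolonged by one more toppling of x. *)
Lemma toppling_count_stable L eta x : finite_topplings L eta -> L x -> ht eta (toppling_count L eta) x < h.
Proof.
move=> b Lx; have [l ll lE] := ht_toppling_count_attained [fset x]%fset b.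
have [lx ->] := lE x (fset11 x); rewrite ltNge; apply/negP => hx.
have : legal_list L eta (x :: l) by [].
move=> /(toppling_count_ub b) /(_ x); rewrite -lx cnt_cons eqxx; lia.
Qed.

Lemma finite_topplings_stable L eta c : (forall x, L x -> ht eta c x < h) -> finite_topplings L eta.
Proof. by move=> st x; exists (c x) => l /legal_list_least; apply. Qed.

Lemma toppling_count_least L eta c : (forall x, L x -> ht eta c x < h) ->
  forall x, (toppling_count L eta x <= c x)%N.
Proof.
move=> st x; have [M /toppling_countP [[l ll <-] _]] := finite_topplings_stable st x.
exact: legal_list_least ll st x.
Qed.

Lemma finite_topplings_real L eta v : (forall x, 0 <= v x) ->
  (forall x, L x -> eta x <= lap v x) -> finite_topplings L eta.
Proof.
move=> v0 ev x; exists (Num.truncn (v x)) => l ll.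
by rewrite truncn_ge_nat ?v0 // (legal_list_real_bound ll).
Qed.

Lemma toppling_count_real L eta v : (forall x, 0 <= v x) ->
  (forall x, L x -> eta x <= lap v x) -> forall x, (toppling_count L eta x)%:R <= v x.
Proof.
move=> v0 ev x; have [M /toppling_countP [[l ll <-] _]] := finite_topplings_real v0 ev x.
exact: legal_list_real_bound ll v0 ev x.
Qed.

Lemma toppling_count_supp L eta x : ~ L x -> toppling_count L eta x = 0%N.
Proof.
move=> Lx; apply: toppling_count_eq; first by exists [::].
by move=> l ll; rewrite leqn0; apply/eqP/count_memPn/negP => /(legal_list_mem ll).
Qed.

Lemma finite_topplings_congr L L' eta eta' : (forall x, L x -> L' x) ->
  (forall x, L x -> eta x <= eta' x) -> finite_topplings L' eta' -> finite_topplings L eta.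
Proof.
move=> LL' le b x; have [M bM] := b x; exists M => l ll; apply: bM.
by apply: (legal_list_congr ll) => y /(legal_list_mem ll); [exact: LL'|exact: le].
Qed.

Lemma toppling_count_le L L' eta eta' : (forall x, L x -> L' x) ->
  (forall x, L x -> eta x <= eta' x) -> finite_topplings L' eta' ->
  forall x, (toppling_count L eta x <= toppling_count L' eta' x)%N.
Proof.
move=> LL' le b x; have [M /toppling_countP [[l ll <-] _]] := finite_topplings_congr LL' le b x.
by apply: toppling_count_ub => //; apply: (legal_list_congr ll) => y /(legal_list_mem ll); [exact: LL'|exact: le].
Qed.

Lemma legal_list_ind_ht (Q : config R d -> Prop) L eta l : Q eta ->
  (forall zeta x, L x -> h <= zeta x -> Q zeta -> Q (topple gamma x zeta)) ->
  legal_list L eta l -> Q (ht eta (cnt l)).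
Proof.
move=> Qe Qt; elim: l => /= [_|x l IH [Lx hx /IH Ql]]; last first.
  by rewrite ht_cons; exact: Qt.
by rewrite (_ : ht _ _ = eta) // -[RHS]ht0; exact: ht_ext.
Qed.

Lemma topple_ge0 eta x : (forall y, 0 <= eta y) -> h <= eta x ->
  forall y, 0 <= topple gamma x eta y.
Proof.
move=> e0 hx y; rewrite /topple /toppling; have [<-|_] := eqVneq x y.
  by rewrite subr_ge0.
by case: ifP => _; rewrite ?subr0 // opprK addr_ge0.
Qed.

Definition stab L eta : config R d := ht eta (toppling_count L eta).

(** Localization: the outcome at x is not changed by removing particles or forbidding sites, as long
    as some legal list of the reduced problem still reaches the full toppling numbers at x and its
    neighbours. It serves for the limits over sets V and over radii r. *)
Lemma stab_attained L L' eta eta' x l : finite_topplings L eta -> (forall y, L' y -> L y) ->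
  (forall y, L' y -> eta' y <= eta y) -> eta' x = eta x -> legal_list L' eta' l ->
  (forall y, y \in x :: nbr x -> cnt l y = toppling_count L eta y) ->
  stab L' eta' x = stab L eta x.
Proof.
move=> b LL' le ex ll lE.
have b' : finite_topplings L' eta' := finite_topplings_congr LL' le b.
have e y : y \in x :: nbr x -> toppling_count L' eta' y = toppling_count L eta y.
  by move=> yx; apply/eqP; rewrite eqn_leq toppling_count_le // -(lE y yx) (toppling_count_ub b' ll).
rewrite /stab /ht ex; congr (_ - _); rewrite /lap e ?mem_head //; congr (_ - _).
by apply: eq_big_seq => z zx; rewrite e // inE zx orbT.
Qed.

Lemma stab_ge0 L eta : (forall y, 0 <= eta y) -> finite_topplings L eta ->
  forall x, 0 <= stab L eta x.
Proof.
move=> e0 b x; have [l ll lE] := ht_toppling_count_attained [fset x]%fset b.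
have [_] := lE x (fset11 x); rewrite /stab => ->.
apply: (legal_list_ind_ht (Q := fun e => forall y, 0 <= e y)) ll _ => //.
by move=> zeta y _ hy z0; apply: topple_ge0.
Qed.

Section abelian.
Variables (L : set (site d)) (eta : config R d) (n : site d -> R).
Hypotheses (n0 : forall x, 0 <= n x) (b : finite_topplings L (fun x => eta x + n x)).

Let le_eta x : L x -> eta x <= eta x + n x.
Proof. by rewrite lerDl. Qed.

Local Notation en := (fun x => eta x + n x).
Local Notation sn := (fun x => stab L eta x + n x).

Let gap x : nat := (toppling_count L en x - toppling_count L eta x)%N.

Let ht_gap : ht (fun x => stab L eta x + n x) gap = stab L (fun x => eta x + n x).
Proof.
rewrite -ht_shift ht_add; apply: ht_ext => z.
by rewrite /gap subnKC // (toppling_count_le (fun _ => id) le_eta).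
Qed.

Let st_gap x : L x -> ht (fun x => stab L eta x + n x) gap x < h.
Proof. by move=> Lx; rewrite ht_gap; exact: toppling_count_stable. Qed.

Lemma finite_topplings_stab : finite_topplings L (fun x => stab L eta x + n x).
Proof. exact: finite_topplings_stable st_gap. Qed.

(** Least action twice: the sum on the right stabilizes eta + n, and [gap], the topplings of eta + n
    left after those of eta, stabilizes the stabilization of eta with n added. *)
Lemma toppling_count_abelian x : toppling_count L (fun x => eta x + n x) x =
  (toppling_count L eta x + toppling_count L sn x)%N.
Proof.
apply/eqP; rewrite eqn_leq; apply/andP; split.
  apply: (toppling_count_least (c := fun x => (_ + _)%N)) => y Ly.
  by rewrite -ht_add ht_shift -/(stab L eta); apply: toppling_count_stable Ly; exact: finite_topplings_stab.
have := toppling_count_least st_gap x; rewrite /gap.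
by have := toppling_count_le (fun _ => id) le_eta b x; lia.
Qed.

Lemma stab_abelian : stab L (fun x => eta x + n x) =
  stab L (fun x => stab L eta x + n x).
Proof.
have -> : stab L sn = ht (ht en (toppling_count L eta)) (toppling_count L sn) by rewrite ht_shift.
rewrite ht_add; apply: ht_ext => x.
exact: toppling_count_abelian.
Qed.

End abelian.

End sandpile.
Arguments cnt : simpl never.

(** * Exhaustive sequences *)

Section frozen.
Variables (R : realType) (d : nat) (gamma : R).
Hypothesis gamma_gt0 : 0 < gamma.
Implicit Types (x y z : site d) (eta : config R d) (s : nat -> option (site d)).

Local Notation h := (height_bound d gamma).
Local Notation cnt := (@cnt d).
Local Notation ht := (@ht R d gamma).
Local Notation legal_list := (@legal_list R d gamma).
Local Notation toppling_count := (@toppling_count R d gamma).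

(** Reversed, as the head of a legal list is its latest toppling. *)
Definition prefix s k : seq (site d) := rev (pmap s (iota 0 k)).

Lemma prefixS s k : prefix s k.+1 =
  if s k is Some x then x :: prefix s k else prefix s k.
Proof.
rewrite /prefix -addn1 iotaD pmap_cat rev_cat add0n /=.
by case: (s k).
Qed.

Lemma after_prefix eta s k : after gamma eta s k = ht eta (cnt (prefix s k)).
Proof.
elim: k => [|k IH]; first by rewrite /prefix /= -[LHS](ht0 gamma); exact: ht_ext.
by rewrite /= prefixS; case: (s k) => [x|//]; rewrite ht_cons IH.
Qed.

Lemma legal_list_prefix eta s k : legal gamma eta s -> legal_list setT eta (prefix s k).
Proof.
move=> [_ ls]; elim: k => // k IH; rewrite prefixS.
by case E: (s k) => [x|//]; split=> //; rewrite -after_prefix; exact: ls.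
Qed.

Lemma cnt_prefix_homo s j k x : (j <= k)%N -> (cnt (prefix s j) x <= cnt (prefix s k) x)%N.
Proof.
move=> jk; rewrite -(subnK jk); elim: (k - j)%N => // n IH.
rewrite addSn prefixS; apply: leq_trans IH _.
by case: (s _) => // y; rewrite cnt_cons leq_addl.
Qed.

Lemma cnt_prefix s k x :
  cnt (prefix s k) x = size [seq i <- iota 0 k | s i == Some x].
Proof.
elim: k => // k IH; rewrite prefixS -addn1 iotaD filter_cat size_cat -IH /= add0n.
case: (s k) => [y|] /=; last by rewrite addn0.
rewrite cnt_cons addnC (_ : (Some y == Some x) = (y == x)) //.
by case: (y == x).
Qed.

(** If a prefix dominates the tail of the list but has not toppled x often enough, then x is
    unstable after this prefix, and exhaustiveness provides a later toppling of x. *)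
Lemma legal_list_le_exhaustive eta s l : exhaustive gamma eta s -> legal_list setT eta l ->
  exists k, forall x, (cnt l x <= cnt (prefix s k) x)%N.
Proof.
move=> [_ ex]; elim: l => [_|x l IH /= [_ hx /IH[k lk]]]; first by exists 0%N.
have [ge|lt] := leqP (cnt (x :: l) x) (cnt (prefix s k) x).
  exists k => y; have [<-//|xy] := eqVneq x y.
  by rewrite cnt_cons (negbTE xy) lk.
have [|j [kj sj]] := ex k x.
  rewrite /unstable after_prefix; apply: le_trans hx _; apply: ht_le => //.
  by apply/eqP; rewrite eqn_leq lk; move: lt; rewrite cnt_cons eqxx add1n.
exists j.+1 => y; rewrite prefixS sj !cnt_cons leq_add2l.
exact: leq_trans (lk y) (cnt_prefix_homo _ _ kj).
Qed.

Section existence.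
Variable eta : config R d.

(** A fair schedule: the unstable site with the least priority topples, and each toppling raises the
    priority value of its site, so nobody waits for ever. *)
Let prio l x : nat := (choice.pickle x + cnt l x)%N.

Let best l x := unstable gamma (ht eta (cnt l)) x /\
  forall y, unstable gamma (ht eta (cnt l)) y -> (prio l x <= prio l y)%N.

Let next l : option (site d) :=
  if pselect (exists x, best l x) is left e then Some (projT1 (cid e)) else None.

Let nextP l : (exists2 x, next l = Some x & best l x) \/
  (next l = None /\ forall x, ~ unstable gamma (ht eta (cnt l)) x).
Proof.
rewrite /next; case: pselect => [e|ne].
  by left; exists (projT1 (cid e)) => //; exact: projT2 (cid e).
right; split=> // x ux; apply: ne.
pose P n := `[< exists2 y, unstable gamma (ht eta (cnt l)) y & prio l y = n >].
have [|n /asboolP[y uy <-] ymin] := @ex_minnP P.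
  by exists (prio l x); apply/asboolP; exists x.
by exists y; split=> // z uz; apply: ymin; apply/asboolP; exists z.
Qed.

Let Fixpoint lists k : seq (site d) :=
  if k is k'.+1 then
    if next (lists k') is Some x then x :: lists k' else lists k'
  else [::].

Let s k := next (lists k).

Let listsE k : lists k = prefix s k.
Proof. by elim: k => // k IH; rewrite prefixS -IH /= /s; case: (next _). Qed.

Lemma exhaustive_exists : exists s, exhaustive gamma eta s.
Proof.
exists s; split; first split.
- by move=> k sk; rewrite /s /= -/(s k) sk.
- move=> k x sk; rewrite after_prefix -listsE.
  by case: (nextP (lists k)) => [[y]|[]]; rewrite -/(s k) sk // => -[<-] [].
move=> k x ux; apply: contrapT => nx.
have never j : (k <= j)%N -> s j != Some x.
  by move=> kj; apply/eqP => sj; apply: nx; exists j.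
have cx j : (k <= j)%N -> cnt (lists j) x = cnt (lists k) x /\
    unstable gamma (ht eta (cnt (lists j))) x.
  move=> kj; rewrite -(subnK kj); elim: (j - k)%N => [|n [IH1 IH2]].
    by rewrite listsE -after_prefix.
  rewrite addSn /=; have := never (n + k)%N (leq_addl _ _); rewrite /s.
  case: (next _) => [y|//] yx; have {}yx : y != x by apply: contra yx => /eqP ->.
  rewrite cnt_cons (negbTE yx) IH1; split=> //.
  apply: le_trans IH2 _; apply: ht_le => // [|z]; rewrite cnt_cons.
    by rewrite (negbTE yx).
  by rewrite leq_addl.
pose p := prio (lists k) x.
pose c j i := if @choice.unpickle (site d) i is Some y then cnt (lists j) y else 0%N.
(* While x waits with constant priority p, every toppled site has code plus count at most p. The sum
   f is the remaining budget of such topplings; it drops at each step, which cannot go on for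
   ever. *)
pose f j := (\sum_(i < p.+1) (p.+1 - (i + c j i)))%N.
have step j : (k <= j)%N -> (f j.+1 < f j)%N.
  move=> kj; have [cxj uxj] := cx _ kj.
  have [[y sy [uy /(_ x uxj)]]|[_ /(_ x)//]] := nextP (lists j).
  rewrite {2}/prio cxj -/(prio _ _) -/p => yp.
  have yp1 : (choice.pickle y < p.+1)%N by rewrite ltnS (leq_trans (leq_addr _ _) yp).
  rewrite /f (bigD1 (Ordinal yp1)) //= [X in (_ < X)%N](bigD1 (Ordinal yp1)) //=.
  have cS z : cnt (lists j.+1) z = ((y == z) + cnt (lists j) z)%N.
    by rewrite /= sy cnt_cons.
  rewrite -addSn; apply: leq_add.
    rewrite /c choice.pickleK cS eqxx; move: yp; rewrite /prio; lia.
  apply: leq_sum => i _; rewrite leq_sub2l // leq_add2l /c.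
  by case: choice.unpickle => // z; rewrite cS leq_addl.
have : forall n, (f (k + n)%N + n <= f k)%N.
  elim=> [|n IH]; first by rewrite !addn0.
  apply: leq_trans IH; rewrite addnS -addSn leq_add2r.
  by rewrite addnS; apply: step; rewrite leq_addr.
by move=> /(_ (f k).+1); lia.
Qed.

End existence.

(** Infinitely many steps at x give legal prefixes with arbitrarily large counts; if there are
    finitely many, their number bounds all legal lists. The second equation also covers an infinite
    odometer, since [fine] then returns 0, the default of [toppling_count]. *)
Lemma odometerE eta x :
  (odometer gamma eta x < +oo)%E =
    `[< exists M, forall l, legal_list setT eta l -> (cnt l x <= M)%N >] /\
  fine (odometer gamma eta x) = (toppling_count setT eta x)%:R.
Proof.
have ex := xgetPex (fun=> None) (exhaustive_exists eta).
rewrite /odometer; move: ex; set s := xget _ _ => /= ex.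
rewrite /counting; have [fA|iA] := asboolP (finite_set _); last first.
  have ub : ~ exists M, forall l, legal_list setT eta l -> (cnt l x <= M)%N.
    move=> [M bM]; have [B BA cB] := infinite_set_fset M.+1 iA.
    have [K BK] : exists K, forall i, i \in B -> (i < K)%N.
      exists (\max_(i <- B) i).+1 => i iB; rewrite ltnS.
      by rewrite (big_fsetD1 i) //= leq_maxl.
    have := bM _ (legal_list_prefix K ex.1); rewrite leqNgt cnt_prefix => /negP; apply.
    apply: leq_trans cB _; apply: uniq_leq_size (fset_uniq B) _ => i iB.
    by rewrite mem_filter mem_iota /= add0n BK // andbT; apply/eqP/BA.
  by rewrite ltxx toppling_count_unbounded //=; split=> //; apply/esym/asboolPn.
have [B AB] := finite_fsetP.1 fA; rewrite AB set_fsetK.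
have sB i : (i \in B) = (s i == Some x).
  by have := congr1 (fun A : set nat => A i) AB => /= e; apply/idP/eqP; rewrite e.
have ub k : (cnt (prefix s k) x <= #|` B|)%N.
  rewrite cnt_prefix; apply: uniq_leq_size.
    by rewrite filter_uniq // iota_uniq.
  by move=> i; rewrite mem_filter sB => /andP[].
have lub l : legal_list setT eta l -> (cnt l x <= #|` B|)%N.
  by move=> /(legal_list_le_exhaustive ex)[k lk]; apply: leq_trans (lk x) (ub k).
rewrite ltry; split; first by apply/esym/asboolP; exists #|` B|.
congr (_%:R); apply/esym/toppling_count_eq => //.
pose K := (\max_(i <- B) i).+1; exists (prefix s K); first exact: legal_list_prefix ex.1.
apply/eqP; rewrite eqn_leq ub /= cnt_prefix; apply: uniq_leq_size (fset_uniq B) _.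
move=> i iB; rewrite mem_filter -sB iB mem_iota /= add0n ltnS.
by rewrite (big_fsetD1 i) //= leq_maxl.
Qed.

Lemma stabilizableP eta : stabilizable gamma eta <-> finite_topplings gamma setT eta.
Proof.
split=> [st x|b x]; first by have := st x; rewrite (odometerE eta x).1 => /asboolP.
by rewrite (odometerE eta x).1; apply/asboolP; exact: b.
Qed.

(** The row of the toppling matrix at x is supported on x and its neighbours, so the sum over the
    lattice is finite. By the common default 0 the equation holds for all configurations. *)
Lemma stabilizationE eta : stabilization gamma eta = stab gamma setT eta.
Proof.
apply/funext => x; rewrite /stabilization /stab /ht; congr (_ - _).
rewrite (fsbigTE (x |` nbr x)%fset) => [|y]; last first.
  rewrite in_fset1U nbrE negb_or /toppling eq_sym => /andP[/negbTE -> /negbTE ->].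
  by rewrite mul0r.
have xx : x \notin nbr x by rewrite nbrE adj_irr.
rewrite big_fsetU1 //= /lap (odometerE eta x).2 {1}/toppling eqxx; congr (_ + _).
rewrite -sumrN; apply: eq_big_seq => y; rewrite nbrE => xy.
rewrite (odometerE eta y).2 /toppling xy; case: eqP xy => [->|_ _].
  by rewrite adj_irr.
by rewrite mulN1r.
Qed.

End frozen.

#[global] Instance finite_sets_up_proper (I : choiceType) : ProperFilter (@finite_sets_up I).
Proof.
apply: filter_from_proper; last by move=> A _; exists A; exact: fsubset_refl.
apply: filter_from_filter; first by exists fset0.
move=> A B _ _; exists (A `|` B)%fset => // C; rewrite /= fsubUset.
by case/andP.
Qed.

(** * Products of addition operators as a single stabilization *)

Section addition.
Variables (R : realType) (d : nat) (gamma : R).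
Hypothesis gamma_gt0 : 0 < gamma.
Implicit Types (x y z : site d) (eta : config R d).

Local Notation stab := (@stab R d gamma setT).
Local Notation finite_topplings := (@finite_topplings R d gamma setT).

Lemma stab_stable eta : stable_configs gamma eta -> stab eta = eta.
Proof.
move=> st; rewrite -[RHS](ht0 gamma); apply: ht_ext => x; apply/eqP.
rewrite -leqn0; apply: (toppling_count_least (c := fun=> 0%N)) => y _.
by rewrite ht0; case/andP: (st y).
Qed.

Lemma iter_addition eta x k : finite_topplings (fun y => eta y + (y == x)%:R *+ k) ->
  stable_configs gamma eta ->
  iter k (addition_op gamma x) eta = stab (fun y => eta y + (y == x)%:R *+ k).
Proof.
move=> + st; elim: k => [_|k IH b] /=.
  rewrite -[LHS](stab_stable st); congr stab.
  by apply/funext => y; rewrite mulr0n addr0.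
have e : (fun y => eta y + (y == x)%:R *+ k.+1) =
    (fun y => (eta y + (y == x)%:R *+ k) + (y == x)%:R).
  by apply/funext => y; rewrite mulrSr addrA.
have b' : finite_topplings (fun y => (eta y + (y == x)%:R *+ k) + (y == x)%:R) by rewrite -e.
rewrite e stab_abelian // IH; first exact: stabilizationE.
by apply: finite_topplings_congr b' => // y _; rewrite lerDl.
Qed.

Lemma stab_stable_configs eta : (forall x, 0 <= eta x) -> finite_topplings eta ->
  stable_configs gamma (stab eta).
Proof. by move=> e0 b x; rewrite stab_ge0 //= toppling_count_stable. Qed.

Section particles.
Variables (eta : config R d) (n : site d -> nat).
Hypotheses (st : stable_configs gamma eta) (b : finite_topplings (add_particles eta n)).

Let eta0 y : 0 <= eta y. Proof. by case/andP: (st y). Qed.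

Let part (s : seq (site d)) : config R d :=
  fun y => eta y + (if y \in s then n y else 0)%:R.

Let finite_topplings_part s : finite_topplings (part s).
Proof.
apply: finite_topplings_congr b => // y _; rewrite /part /add_particles lerD2l ler_nat.
by case: ifP.
Qed.

(** By the abelian property the intermediate stabilizations can be omitted. *)
Lemma addition_ops_seq (s : seq (site d)) : uniq s ->
  (\big[(fun f g => f \o g)/id]_(x <- s) iter (n x) (addition_op gamma x)) eta =
  stab (part s).
Proof.
elim: s => [_|x s IH /andP[xs us]]; rewrite ?big_nil ?big_cons /=.
  rewrite -[LHS](stab_stable st); congr stab.
  by apply/funext => y; rewrite /part addr0.
have e : part (x :: s) = (fun y => part s y + (y == x)%:R *+ n x).
  apply/funext => y; rewrite /part inE -addrA; congr (_ + _).
  have [->|yx] /= := eqVneq y x; last by rewrite mul0rn addr0.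
  by rewrite (negbTE xs) add0r.
have n0 y : 0 <= (y == x)%:R *+ n x :> R by rewrite mulrn_wge0.
have bs : finite_topplings (fun y => part s y + (y == x)%:R *+ n x) by rewrite -e.
have s0 y : 0 <= part s y by rewrite addr_ge0.
rewrite IH // iter_addition.
- by rewrite e -stab_abelian.
- exact: finite_topplings_stab.
- by apply: stab_stable_configs.
Qed.

(** Once V contains x and the sites of a finite list reaching the full toppling numbers around x,
    this list is legal with the particles of V alone, so the value at x no longer changes. *)
Lemma addition_ops_near x : \forall V \near @finite_sets_up (site d),
  addition_ops gamma V n eta x = stab (add_particles eta n) x.
Proof.
have [l ll lE] := toppling_count_attained gamma_gt0 (x :: nbr x) b.
exists [fset y in x :: l]%fset => //= V /fsubsetP lV.
have inV y : y \in x :: l -> y \in V by move=> yl; rewrite lV // in_fset.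
rewrite /addition_ops addition_ops_seq ?fset_uniq //.
apply: (stab_attained _ _ _ _ _ lE) => //.
- by move=> y _; rewrite lerD2l ler_nat; case: ifP.
- by rewrite /part inV ?mem_head.
- apply: (legal_list_congr ll) => // y yl.
  by rewrite /part inV // inE yl orbT.
Qed.

Lemma addition_ops_cvg :
  addition_ops gamma V n eta @[V --> @finite_sets_up (site d)] -->
  stab (add_particles eta n).
Proof.
suff : forall x, addition_ops gamma V n eta x @[V --> @finite_sets_up (site d)] -->
    (stab (add_particles eta n) x : R).
  move=> cv; have /= := (@pointwise_cvgP (discrete_topology (site d)) R
    (addition_ops gamma V n eta @[V --> @finite_sets_up (site d)])
    (stab (add_particles eta n)) _).2.
  apply; exact: cv.
by move=> x; apply: cvg_near_cst; exact: addition_ops_near.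
Qed.

End particles.

End addition.

(** * Measurability *)

Section measurability.
Context (R : realType) (d : nat).

Lemma measurable_coord (x : site d) :
  measurable_fun setT (fun eta : config R d => eta x : R).
Proof.
move=> _ B mB; rewrite setTI; apply: sub_sigma_algebra.
by exists x => //; exists B => //; rewrite setTI.
Qed.

Lemma measurable_config dT (T : measurableType dT) (f : T -> config R d) :
  (forall x, measurable_fun setT (fun w => f w x)) -> measurable_fun setT f.
Proof.
move=> mf; apply: (@measurability _ _ T (config R d) setT f (@cylinders R d) erefl).
move=> _ [_ [x _ [B mB <-]] <-]; rewrite setTI -comp_preimage setTI.
by rewrite -[X in measurable X]setTI; exact: mf.
Qed.

Lemma measurable_nat dT (T : measurableType dT) (f : T -> nat) :
  (forall k, measurable (f @^-1` [set k])) -> measurable_fun setT f.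
Proof.
move=> mf _ B _; rewrite setTI.
have -> : f @^-1` B = \bigcup_(k in B) f @^-1` [set k].
  by apply/seteqP; split=> [w Bw|w [k Bk /= ->]//]; exists (f w).
exact: bigcup_measurable.
Qed.

Lemma measurable_iter dT (T : measurableType dT) (f : T -> T) k :
  measurable_fun setT f -> measurable_fun setT (iter k f).
Proof.
move=> mf; elim: k => [|k IH]; first exact: measurable_id.
exact: (measurableT_comp mf IH).
Qed.

Lemma measurable_natr dT (T : measurableType dT) (f : T -> nat) :
  measurable_fun setT f -> measurable_fun setT (fun w => (f w)%:R : R).
Proof. by move=> mf; exact: (@measurableT_comp _ _ _ _ _ _ (fun n : nat => n%:R : R)). Qed.

Variable gamma : R.
Implicit Types (L : set (site d)) (l : seq (site d)).

Lemma measurable_ht c : measurable_fun setT (@ht R d gamma ^~ c).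
Proof.
apply: measurable_config => x; apply: measurable_funB => //.
exact: measurable_coord.
Qed.

Lemma measurable_legal_list L l : measurable [set eta : config R d | legal_list gamma L eta l].
Proof.
elim: l => [|x l IH] /=; first by rewrite (_ : mkset _ = setT) //; exact/seteqP.
rewrite (_ : mkset _ = [set eta | L x] `&`
  ((fun eta => ht gamma eta (cnt l) x) @^-1` `[height_bound d gamma, +oo[ `&`
   [set eta | legal_list gamma L eta l])); last first.
  apply/seteqP; split=> eta /=; rewrite in_itv /= andbT.
    by case.
  by move=> [? []].
apply: measurableI; last apply: measurableI => //.
  have [Lx|Lx] := pselect (L x).
    by rewrite (_ : mkset _ = setT) //; apply/seteqP; split.
  by rewrite (_ : mkset _ = set0) //; apply/seteqP; split.
rewrite -[X in measurable X]setTI.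
have : measurable_fun setT (fun eta : config R d => ht gamma eta (cnt l) x : R).
  exact: (measurableT_comp (measurable_coord x) (measurable_ht (cnt l))).
by apply.
Qed.

(** A bound on the counts at x is a countable intersection over lists. The fibre of 0 also contains
    the configurations with unbounded counts and is treated apart. *)
Lemma measurable_toppling_count L x : measurable_fun setT (fun eta : config R d => toppling_count gamma L eta x).
Proof.
pose E M := \bigcap_l [set eta : config R d | legal_list gamma L eta l -> (cnt l x <= M)%N].
have mE M : measurable (E M).
  rewrite -[E M]setCK setC_bigcap; apply: measurableC.
  apply: countable_bigcupT_measurable => // l.
  have [le|nle] := boolP (cnt l x <= M)%N.
    rewrite (_ : mkset _ = setT) ?setCT //.
    by apply/seteqP; split=> // eta _ /=.
  rewrite (_ : ~` _ = [set eta | legal_list gamma L eta l]); first exact: measurable_legal_list.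
  apply/seteqP; split=> eta /=.
    by move=> nl; apply: contrapT => ll; apply: nl => /ll.
  by move=> ll /(_ ll).
have EP eta M : E M eta <-> forall l, legal_list gamma L eta l -> (cnt l x <= M)%N.
  by split=> [H l|H l _]; exact: H.
have EM M M' eta : (M <= M')%N -> E M eta -> E M' eta.
  by move=> MM' /EP H; apply/EP => l /H /leq_trans; apply.
apply: measurable_nat => -[|k].
  rewrite (_ : _ @^-1` _ = E 0%N `|` \bigcap_M ~` E M); last first.
    apply/seteqP; split=> eta /=.
      move=> e0; have [[M EMx]|nE] := pselect (exists M, E M eta).
        by left; apply/EP; rewrite -e0; apply: (toppling_countP ((EP eta M).1 EMx)).2.
      by right=> M _ EMx; apply: nE; exists M.
    move=> [/EP E0|nE].
      by apply: toppling_count_eq E0; exists [::].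
    by apply: toppling_count_unbounded => -[M /EP EMx]; exact: (nE M).
  by apply: measurableU => //; apply: bigcapT_measurable => M; exact: measurableC.
rewrite (_ : _ @^-1` _ = E k.+1 `\` E k); first exact: measurableD.
apply/seteqP; split=> eta /=.
  move=> ek; have [[M /EP/toppling_countP[[l ll ln] ub]]|nE] := pselect (exists M, E M eta).
    split; first by apply/EP; rewrite -ek.
    by move=> /EP /(_ l ll); rewrite ln ek ltnn.
  by move: ek; rewrite toppling_count_unbounded // => -[M /EP EMx]; apply: nE; exists M.
move=> [/EP Ek1 nEk]; have [[l ll ln] ub] := toppling_countP Ek1.
apply/eqP; rewrite eqn_leq -{1}ln Ek1 //= ltnNge; apply/negP => le.
by apply: nEk; apply: EM le _; apply/EP.
Qed.

Lemma measurable_stab L : measurable_fun setT (@stab R d gamma L).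
Proof.
apply: measurable_config => x; apply: measurable_funB; first exact: measurable_coord.
have mo y : measurable_fun setT (fun eta : config R d => (toppling_count gamma L eta y)%:R : R).
  by apply: measurable_natr; exact: measurable_toppling_count.
apply: measurable_funB; first by apply: measurable_funM => //.
exact: measurable_sum.
Qed.

Lemma measurable_configD dT (T : measurableType dT) (f g : T -> config R d) :
  measurable_fun setT f -> measurable_fun setT g ->
  measurable_fun setT (fun w => (fun x => f w x + g w x) : config R d).
Proof.
move=> mf mg; apply: measurable_config => x; apply: measurable_funD.
  exact: (measurableT_comp (measurable_coord x) mf).
exact: (measurableT_comp (measurable_coord x) mg).
Qed.

Lemma measurable_stable_configs : measurable (@stable_configs R d gamma).
Proof.
rewrite (_ : stable_configs gamma =
  ~` \bigcup_x (fun eta : config R d => eta x : R) @^-1` (~` `[0, height_bound d gamma[)); last first.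
  apply/seteqP; split=> eta /=.
    by move=> st [x _ /=]; rewrite in_itv /= st.
  by move=> nst x; apply: contrapT => H; apply: nst; exists x => //=; rewrite in_itv.
apply: measurableC; apply: countable_bigcupT_measurable => // x.
rewrite -[X in measurable X]setTI.
by apply: (measurable_coord x) => //; exact: measurableC.
Qed.

End measurability.

(** * Invariance in finite volume *)

Section lebesgue_translation.
Variable R : realType.
Local Notation leb := (@lebesgue_measure R).

Lemma lebesgue_shift (a : R) (A : set (measurableTypeR R)) : measurable A ->
  leb ((fun x => x + a) @^-1` A) = leb A.
Proof.
move=> mA.
have ms : measurable_fun setT ((fun x => x + a) : measurableTypeR R -> measurableTypeR R).
  exact: measurable_funD.
change (pushforward leb ((fun x => x + a) : measurableTypeR R -> measurableTypeR R) A = leb A).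
apply/esym/lebesgue_measure_unique => //= _ [[b c] _ <-].
rewrite /pushforward (_ : _ @^-1` _ = `](b - a), (c - a)]%classic).
  rewrite !lebesgue_measure_itv /= !lte_fin ltrD2r; case: ifP => // _.
  by rewrite -!EFinB; congr (_%:E); ring.
by apply/seteqP; split=> x /=; rewrite !in_itv /= ltrBlDr lerBrDr.
Qed.

Definition tuple_shift n (u t : n.-tuple (measurableTypeR R)) :
    n.-tuple (measurableTypeR R) :=
  [tuple (tnth t i + tnth u i : R) | i < n].

Lemma measurable_tuple_shift n (u : n.-tuple (measurableTypeR R)) :
  measurable_fun setT (tuple_shift u).
Proof.
apply/measurable_fun_tnthP => i.
rewrite (_ : _ \o _ = (fun t => tnth t i + tnth u i : R)).
  by apply: measurable_funD => //; exact: measurable_tnth.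
by apply/funext => t /=; rewrite tnth_mktuple.
Qed.

Lemma lebesgue_tuple_shift n (u : n.-tuple (measurableTypeR R)) A : measurable A ->
  lebesgue_tuple R n (tuple_shift u @^-1` A) = lebesgue_tuple R n A.
Proof.
elim: n u A => [|n IH] u A mA.
  by congr (lebesgue_tuple R 0 _); apply/seteqP; split=> t /=;
    rewrite (tuple0 (tuple_shift _ _)) (tuple0 t).
pose mu := lebesgue_tuple R n.
pose g z := ((z.1 + thead u : R) : measurableTypeR R,
  tuple_shift [tuple of behead u] z.2) : measurableTypeR R * n.-tuple (measurableTypeR R).
have mg : measurable_fun setT g.
  apply: measurable_fun_pair; first exact: measurable_funD.
  exact: (measurableT_comp (measurable_tuple_shift _) measurable_snd).
have mc : measurable ((@tuple_cons R n) @^-1` A).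
  by rewrite -[X in measurable X]setTI; exact: measurable_tuple_cons.
have cE : (@tuple_cons R n) \o g = tuple_shift u \o (@tuple_cons R n).
  apply/funext => -[x t]; apply/eq_from_tnth => i; rewrite /= tnth_mktuple.
  case: (unliftP ord0 i) => [j|] ->; rewrite !(tnthS, tnth0) ?tnth_mktuple //.
  by rewrite [in RHS](tuple_eta u) tnthS.
have -> : lebesgue_tuple R n.+1 (tuple_shift u @^-1` A) =
    pushforward (@lebesgue_measure R \x mu)%E g ((@tuple_cons R n) @^-1` A).
  change (lebesgue_tuple R n.+1 (tuple_shift u @^-1` A)) with
    ((@lebesgue_measure R \x mu)%E ((tuple_shift u \o (@tuple_cons R n)) @^-1` A)).
  by rewrite -cE.
apply/esym/product_measure_unique => // B C mB mC.
change ((@lebesgue_measure R \x mu)%E (g @^-1` (B `*` C)) = (leb B * mu C)%E).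
have -> : g @^-1` (B `*` C) =
    ((fun x : measurableTypeR R => (x + thead u : R) : measurableTypeR R) @^-1` B) `*`
    (tuple_shift [tuple of behead u] @^-1` C) by [].
rewrite product_measure1E.
- by rewrite [X in (X * _)%E]lebesgue_shift // IH.
- by rewrite -[X in measurable X]setTI; apply: measurable_funD => //; exact: measurable_cst.
- by rewrite -[X in measurable X]setTI; exact: measurable_tuple_shift.
Qed.

Definition tuple_box n (a : R) : set (n.-tuple (measurableTypeR R)) :=
  [set t | forall i, 0 <= (tnth t i : R) < a].

Lemma measurable_tuple_box n (a : R) : measurable (@tuple_box n a).
Proof.
rewrite (_ : tuple_box a = \bigcap_(i in [set: 'I_n])
   (fun t : n.-tuple (measurableTypeR R) => tnth t i) @^-1` `[(0 : R), a[%classic).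
  apply: fin_bigcap_measurable => [|i _]; first exact: finite_finset.
  by rewrite -[X in measurable X]setTI; exact: measurable_tnth.
apply/seteqP; split=> [t tb i _|t tb i]; rewrite ?/(_ @^-1` _) /= ?in_itv //=.
exact: tb.
Qed.

Lemma lebesgue_tuple_box n (a : R) : (lebesgue_tuple R n (@tuple_box n a) < +oo)%E.
Proof.
elim: n => [|n IH].
  by rewrite /= diracE; case: (_ \in _); rewrite ltry.
change ((lebesgue_measure \x lebesgue_tuple R n)%E
  ((@tuple_cons R n) @^-1` (@tuple_box n.+1 a)) < +oo)%E.
have -> : (@tuple_cons R n) @^-1` (@tuple_box n.+1 a) =
    (`[(0 : R), a[%classic : set (measurableTypeR R)) `*` (@tuple_box n a).
  apply/seteqP; split=> -[x t]; rewrite /preimage /tuple_box /= in_itv /=.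
    move=> tb; split=> [|i]; first by have := tb ord0; rewrite tnth0.
    by have := tb (lift ord0 i); rewrite tnthS.
  by move=> [xb tb] i; case: (unliftP ord0 i) => [j|] ->; rewrite ?tnthS ?tnth0.
rewrite product_measure1E //; last exact: measurable_tuple_box.
have lI : (@lebesgue_measure R `[0%R, a[%classic < +oo)%E.
  by rewrite lebesgue_measure_itv /=; case: ifP => _; rewrite ?ltry.
by rewrite lte_mul_pinfty // ge0_fin_numE.
Qed.

End lebesgue_translation.

Section finite_volume.
Variables (R : realType) (d : nat) (gamma : R).
Hypothesis gamma_gt0 : 0 < gamma.
Implicit Types (x y z : site d) (eta : config R d).

Local Notation h := (height_bound d gamma).

(** Each row of the toppling matrix sums to at least gamma, so constants are supersolutions for
    bounded heights. *)
Lemma le_lap_cst (M : R) x : 0 <= M -> M <= lap gamma (fun=> M / gamma) x.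
Proof.
move=> M0; rewrite /lap big_const_seq iter_addr_0 count_predT -mulr_natl -mulrBl.
rewrite -{1}(divfK (lt0r_neq0 gamma_gt0) M) [leLHS]mulrC ler_wpM2r //.
  by rewrite divr_ge0 // ltW.
by rewrite lerBrDl h_ge.
Qed.

Section bounded.
Variables (L : set (site d)) (eta : config R d) (M : R).
Hypotheses (M0 : 0 <= M) (eM : forall x, L x -> eta x <= M).

Let v0 (x : site d) : 0 <= M / gamma. Proof. by rewrite divr_ge0 // ltW. Qed.

Let ev x : L x -> eta x <= lap gamma (fun=> M / gamma) x.
Proof. by move=> Lx; apply: le_trans (eM Lx) _; exact: le_lap_cst. Qed.

Lemma finite_topplings_bounded : finite_topplings gamma L eta.
Proof. exact: (finite_topplings_real gamma_gt0 v0 ev). Qed.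

Lemma toppling_count_bounded x : (toppling_count gamma L eta x)%:R <= M / gamma.
Proof. exact: (toppling_count_real gamma_gt0 v0 ev). Qed.

End bounded.

Implicit Types (L W : {fset site d}) (C : set (config R d)).

Definition deg W y : nat := #|` [fset z in W | adj z y]%fset|.

Lemma deg_le W y : (deg W y <= 2 * d)%N.
Proof.
apply: leq_trans (card_nbr y); apply: fsubset_leq_card; apply/fsubsetP => z.
by rewrite nbrE !inE /= adjC => /andP[].
Qed.

Definition forbidden eta W := W != fset0 /\ forall y, y \in W -> eta y < (deg W y)%:R.

Definition recurrent L eta := forall W, fsubset W L -> ~ forbidden eta W.

Lemma recurrent_le L eta eta' : (forall y, y \in L -> eta y <= eta' y) ->
  recurrent L eta -> recurrent L eta'.
Proof.
move=> le rec W WL [W0 fW]; apply: (rec W WL); split=> // y yW.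
by apply: le_lt_trans (fW y yW); apply: le; exact: (fsubsetP WL).
Qed.

(** A set W forbidden after the toppling yields one forbidden before it. If x is outside W, heights
    on W only rose. If x is in W, use W without x: what a neighbour y gains from x equals the drop
    of its degree. W = {x} is excluded because heights stay nonnegative. *)
Lemma recurrent_topple L eta x : (forall y, 0 <= eta y) -> h <= eta x ->
  recurrent L eta -> recurrent L (topple gamma x eta).
Proof.
move=> e0 hx rec W WL [W0 fW].
have [xW|xW] := boolP (x \in W); last first.
  apply: (rec W WL); split=> // y yW; apply: le_lt_trans (fW y yW).
  rewrite /topple /toppling; case: eqP => [xy|_]; first by rewrite xy yW in xW.
  by case: ifP => _; rewrite ?subr0 // opprK lerDl.
have [W1|W1] := eqVneq (W `\ x)%fset fset0.
  have := fW x xW; rewrite ltNge => /negP; apply.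
  rewrite (_ : deg W x = 0%N); first exact: topple_ge0.
  apply/eqP; rewrite cardfs_eq0; apply/eqP/fsetP => z; rewrite !inE /=.
  have := congr1 (fun A : {fset site d} => z \in A) W1; rewrite !inE.
  by case: eqP => [->|_] /=; [rewrite adj_irr andbF|move=> ->].
apply: (rec (W `\ x)%fset); first by apply: fsubset_trans WL; exact: fsubD1set.
split=> // y; rewrite !inE => /andP[yx yW]; move: (fW y yW).
rewrite /topple /toppling eq_sym (negbTE yx).
have -> : deg W y = ((x \in [fset z in W | adj z y]%fset) + deg (W `\ x)%fset y)%N.
  rewrite /deg (cardfsD1 x); congr (_ + _)%N; apply/esym; congr (#|` _|).
  by apply/fsetP => z; rewrite !inE /= andbA.
rewrite !inE /= xW /= natrD; case: (adj x y); last by rewrite subr0 add0r.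
by rewrite opprK [X in _ < X]addrC ltrD2r.
Qed.

Definition rec_configs L : set (config R d) :=
  [set eta | [/\ forall y, y \in L -> 0 <= eta y < h,
                 forall y, y \notin L -> eta y = 0 & recurrent L eta]].

Lemma rec_ge0 L eta y : rec_configs L eta -> 0 <= eta y.
Proof.
move=> [e1 e2 _]; have [yL|yL] := boolP (y \in L); last by rewrite e2.
by case/andP: (e1 y yL).
Qed.

Lemma rec_lt L eta y : rec_configs L eta -> eta y < h.
Proof.
move=> [e1 e2 _]; have [yL|yL] := boolP (y \in L); last by rewrite e2 // h_gt0.
by case/andP: (e1 y yL).
Qed.

Definition addp eta x : config R d := fun y => eta y + (y == x)%:R.

Lemma finite_topplings_addp (D : set (site d)) eta x : (forall y, eta y < h) ->
  finite_topplings gamma D (addp eta x).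
Proof.
move=> st; apply: (@finite_topplings_bounded _ _ (h + 1)).
  by rewrite addr_ge0 // ltW // h_gt0.
move=> y _; rewrite /addp lerD //; first exact: ltW.
by case: (y == x).
Qed.

(* Finite-volume addition operator: particles leaving L are lost. *)
Definition add_in L x eta : config R d :=
  fun y => if y \in L then stab gamma [set` L] (addp eta x) y else 0.

Lemma add_in_rec L x eta : rec_configs L eta -> rec_configs L (add_in L x eta).
Proof.
move=> re; have b : finite_topplings gamma [set` L] (addp eta x).
  by apply: finite_topplings_addp => y; exact: rec_lt re.
have e0 y : 0 <= addp eta x y by rewrite addr_ge0 // (rec_ge0 _ re).
split=> [y yL|y /negbTE yL|].
- by rewrite /add_in yL stab_ge0 //= toppling_count_stable.
- by rewrite /add_in yL.
have [l ll lE] := ht_toppling_count_attained gamma_gt0 L b.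
have : (forall y, 0 <= ht gamma (addp eta x) (cnt l) y) /\
    recurrent L (ht gamma (addp eta x) (cnt l)).
  apply: (legal_list_ind_ht (Q := fun zeta => (forall y, 0 <= zeta y) /\ recurrent L zeta) _ _ ll).
    split=> //.
    have [_ _] := re; apply: recurrent_le => y _.
    by rewrite /addp lerDl.
  by move=> zeta y yL hy [z0 zr]; split; [exact: topple_ge0|exact: recurrent_topple].
move=> [_]; apply: recurrent_le => y yL.
by rewrite /add_in yL /stab (lE y yL).2.
Qed.

(* The sites where c exceeds c' the most would form a forbidden set for eta. *)
Lemma recurrent_toppling_count_le L eta zeta (c c' : site d -> nat) :
  recurrent L eta -> (forall y, y \in L -> zeta y < h) ->
  (forall y, y \notin L -> c y = 0%N) ->
  (forall y, y \in L -> ht gamma zeta c y = ht gamma eta c' y) ->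
  forall y, (c y <= c' y)%N.
Proof.
move=> rec zh c0 e y; rewrite leqNgt; apply/negP => lty.
have yL : y \in L by apply: contraTT lty => /c0 ->.
have [|n /hasP[z zL /eqP <-]|M /hasP[z0 z0L /eqP z0M] Mmax] :=
    @ex_maxnP (fun n => has (fun z => c z - c' z == n)%N L) (\max_(z <- L) (c z - c' z))%N.
- by exists (c y - c' y)%N; apply/hasP; exists y.
- by rewrite (big_fsetD1 z) //= leq_maxl.
have cM z : z \in L -> (c z - c' z <= M)%N.
  by move=> zL; apply: Mmax; apply/hasP; exists z.
have M1 : (0 < M)%N by apply: leq_trans (cM y yL); rewrite subn_gt0.
pose W := [fset z in L | (c z - c' z == M)%N]%fset.
have WL : fsubset W L by apply/fsubsetP => z; rewrite !inE => /andP[].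
apply: (rec W WL); split.
  by apply/fset0Pn; exists z0; rewrite !inE /= z0L z0M eqxx.
move=> w; rewrite !inE /= => /andP[wL /eqP wM].
have ew := e w wL; move: (zh w wL).
rewrite (_ : zeta w = eta w + (lap gamma (fun z => (c z)%:R) w -
    lap gamma (fun z => (c' z)%:R) w)); last first.
  by move: ew; rewrite /ht => ew; rewrite addrCA -ew addrC subrK.
have lapB : lap gamma (fun z => (c z)%:R) w - lap gamma (fun z => (c' z)%:R) w =
    h * M%:R - \sum_(z <- nbr w) ((c z)%:R - (c' z)%:R).
  by rewrite /lap sumrB -wM natrB; [ring|lia].
(* At a neighbour outside W the excess is at most M - 1. As [zeta w < h], this will give [eta w] <
   deg W w - gamma (M - 1), so W is forbidden for eta. *)
have sumle : \sum_(z <- nbr w) ((c z)%:R - (c' z)%:R : R) <=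
    \sum_(z <- nbr w) ((z \in W)%:R + (M.-1)%:R).
  rewrite big_seq [leRHS]big_seq; apply: ler_sum => z _.
  rewrite lerBlDr -!natrD ler_nat !inE /=.
  have [zL|/c0 -> //] := boolP (z \in L).
  by have := cM z zL; case: eqP => /=; lia.
have sumE : \sum_(z <- nbr w) ((z \in W)%:R + (M.-1)%:R : R) =
    (deg W w)%:R + (#|` nbr w|)%:R * (M.-1)%:R.
  rewrite big_split /= big_const_seq iter_addr_0 count_predT mulr_natl.
  congr (_ + _); rewrite -natr_sum; congr (_%:R).
  transitivity (count (mem W) (nbr w)).
    by rewrite -sum1_count [RHS]big_mkcond; apply: eq_bigr => z _ /=; case: (z \in W).
  rewrite -size_filter; apply: perm_size; apply: uniq_perm.
  - by rewrite filter_uniq // fset_uniq.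
  - exact: fset_uniq.
  - move=> z; rewrite mem_filter nbrE /= adjC.
    by rewrite !inE.
rewrite lapB => hlt.
have nM : (#|` nbr w|)%:R * (M.-1)%:R <= (h - gamma) * (M.-1)%:R.
  by rewrite ler_wpM2r // lerBrDr h_ge.
have gM : 0 <= gamma * (M.-1)%:R by rewrite mulr_ge0 // ltW.
have MM : M%:R = (M.-1)%:R + 1 :> R by rewrite natr1 prednK.
move: hlt; rewrite MM => hlt.
rewrite sumE in sumle; nra.
Qed.

(** The two avalanches lead eta and zeta to the same heights on L. By [recurrent_toppling_count_le],
    used in both directions, their toppling numbers agree, and undoing them gives eta = zeta. *)
Lemma add_in_inj L x eta zeta : rec_configs L eta -> rec_configs L zeta ->
  add_in L x eta = add_in L x zeta -> eta = zeta.
Proof.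
move=> re rz e.
have b := finite_topplings_addp [set` L] x (fun y => rec_lt y re).
have bz := finite_topplings_addp [set` L] x (fun y => rec_lt y rz).
pose c := toppling_count gamma [set` L] (addp eta x); pose c' := toppling_count gamma [set` L] (addp zeta x).
have eL y : y \in L -> ht gamma eta c y = ht gamma zeta c' y.
  move=> yL; have := congr1 (fun f : config R d => f y) e.
  rewrite /add_in yL /stab -/c -/c' /addp.
  by rewrite !(ht_shift gamma _ (fun y => (y == x)%:R)) => /addIr.
have [[e1 e0 er] [z1 z0 zr]] := (re, rz).
have cc : c =1 c'.
  move=> y; apply/eqP; rewrite eqn_leq; apply/andP; split.
    apply: (recurrent_toppling_count_le zr _ _ eL) => z zL; first by case/andP: (e1 z zL).
    by rewrite /c toppling_count_supp // => /= zL'; rewrite zL' in zL.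
  apply: (recurrent_toppling_count_le er _ _ (fun y yL => esym (eL y yL))) => z zL.
    by case/andP: (z1 z zL).
  by rewrite /c' toppling_count_supp // => /= zL'; rewrite zL' in zL.
apply/funext => y; have [yL|yL] := boolP (y \in L); last by rewrite e0 // z0.
by have := eL y yL; rewrite (ht_ext _ _ cc) => /addIr.
Qed.

Lemma extend0_out L (t : (#|` L|).-tuple (measurableTypeR R)) y : y \notin L -> extend0 t y = 0 :> R.
Proof. by rewrite /extend0 => /negbTE ->. Qed.

Lemma extend0_tnth L (t : (#|` L|).-tuple (measurableTypeR R)) (i : 'I_(#|` L|)) :
  extend0 t (nth (0 : site d) (enum_fset L) i) = tnth t i.
Proof.
rewrite /extend0 mem_nth // index_uniq ?fset_uniq //.
by rewrite (tnth_nth 0).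
Qed.

Lemma measurable_extend0 L : measurable_fun setT (@extend0 R d L).
Proof.
apply: measurable_config => x; rewrite /extend0.
have [xL|_] := boolP (x \in L); last exact: measurable_cst.
have iL : (index x (enum_fset L) < #|` L|)%N by rewrite index_mem.
rewrite (_ : (fun w : _.-tuple _ => _) = (fun t => tnth t (Ordinal iL))).
  exact: measurable_tnth.
by apply/funext => t; rewrite (tnth_nth 0).
Qed.

Definition leb_config L : set (config R d) -> \bar R :=
  pushforward (lebesgue_tuple R (#|` L|)) (@extend0 R d L).

Section leb_config_measure.
Variable L : {fset site d}.

Let m0 : leb_config L set0 = 0%E.
Proof. by rewrite /leb_config /pushforward preimage_set0 measure0. Qed.

Let m_ge0 A : (0 <= leb_config L A)%E.
Proof. by rewrite /leb_config /pushforward measure_ge0. Qed.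

Let m_sigma_additive : semi_sigma_additive (leb_config L).
Proof.
have mf := @measurable_extend0 L.
exact: (@measure_semi_sigma_additive _ _ _ (pushforward (lebesgue_tuple R (#|` L|)) (@extend0 R d L))).
Qed.

HB.instance Definition _ := isMeasure.Build _ _ _ (leb_config L)
  m0 m_ge0 m_sigma_additive.

End leb_config_measure.

Lemma leb_config_shift L (tau : site d -> R) (A : set (config R d)) :
  (forall y, y \notin L -> tau y = 0) -> measurable A ->
  leb_config L [set eta : config R d | A (fun y => eta y + tau y)] = leb_config L A.
Proof.
move=> tau0 mA; rewrite /leb_config /pushforward.
pose u : (#|` L|).-tuple (measurableTypeR R) :=
  [tuple (tau (nth (0 : site d) (enum_fset L) i) : R) | i < #|` L|].
rewrite -[RHS](lebesgue_tuple_shift u); last first.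
  by rewrite -[X in measurable X]setTI; exact: measurable_extend0.
have e t : (fun y => extend0 t y + tau y) = extend0 (tuple_shift u t) :> config R d.
  apply/funext => y; have [yL|yL] := boolP (y \in L); last first.
    by rewrite !extend0_out // tau0 // addr0.
  have iL : (index y (enum_fset L) < #|` L|)%N by rewrite index_mem.
  rewrite -(nth_index 0 yL) -[index y _]/(val (Ordinal iL)).
  by rewrite !extend0_tnth !tnth_mktuple.
by congr (lebesgue_tuple R _ _); apply/seteqP; split=> t; rewrite /preimage /= e.
Qed.

Lemma countable_fset_site : countable [set: {fset site d}].
Proof.
apply/countable_injP; exists (fun W => choice.pickle (enum_fset W : seq (site d))).
move=> W W' _ _ /(pcan_inj choice.pickleK) e; apply/fsetP => y.
by rewrite -[y \in W]/(y \in enum_fset W) e.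
Qed.

Lemma measurable_recurrent L : measurable [set eta : config R d | recurrent L eta].
Proof.
rewrite (_ : mkset _ = ~` \bigcup_(W in [set W | fsubset W L /\ W != fset0])
    \bigcap_(y in [set` W]) (fun eta : config R d => eta y : R) @^-1` `]-oo, (deg W y)%:R[).
  apply: measurableC; rewrite bigcup_mkcond.
  apply: countable_bigcupT_measurable => [|W]; first exact: countable_fset_site.
  case: ifP => _ //.
  apply: fin_bigcap_measurable; first exact: finite_fset.
  by move=> y _; rewrite -[X in measurable X]setTI; exact: measurable_coord.
apply/seteqP; split=> eta /=.
  by move=> rec [W [WL W0] fW]; apply: (rec W WL); split=> // y yW; exact: fW.
move=> nf W WL [W0 fW]; by apply: nf; exists W.
Qed.

Lemma measurable_rec_configs L : measurable (rec_configs L).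
Proof.
rewrite (_ : rec_configs L =
  \bigcap_(y in [set` L]) (fun eta : config R d => eta y : R) @^-1` `[0, h[ `&`
  (~` \bigcup_(y in ~` [set` L]) (fun eta : config R d => eta y : R) @^-1` (~` [set 0])) `&`
  [set eta : config R d | recurrent L eta]).
  apply: measurableI; last exact: measurable_recurrent.
  apply: measurableI; last apply: measurableC.
    apply: fin_bigcap_measurable; first exact: finite_fset.
    by move=> y _; rewrite -[X in measurable X]setTI; exact: measurable_coord.
  rewrite bigcup_mkcond; apply: (@countable_bigcupT_measurable _ _ (site d)) => // y.
  case: ifP => // _; rewrite -[X in measurable X]setTI.
  by apply: measurable_coord => //; exact: measurableC.
apply/seteqP; split=> eta /=.
  move=> [e1 e0 er]; split=> //; split=> [y yL|]; first by rewrite /= in_itv /= e1.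
  by move=> [y /= /negP yL]; apply; exact: e0.
move=> [[e1 e0] er]; split=> // y yL.
by apply: contrapT => ne; apply: e0; exists y => //; exact/negP.
Qed.

Lemma allowed_rec L :
  @allowed R d gamma L = @extend0 R d L @^-1` rec_configs L.
Proof.
apply/seteqP; split=> t /=.
  move=> [tb nf]; split=> [y yL|y|]; last first.
  - move=> W WL [W0 fW]; apply: nf; exists W; split=> // y yW; exact: fW.
  - exact: extend0_out.
  have iL : (index y (enum_fset L) < #|` L|)%N by rewrite index_mem.
  by have := tb (Ordinal iL); rewrite -extend0_tnth /= nth_index.
move=> [e1 e0 er]; split=> [i|[W [W0 WL fW]]]; last exact: (er W WL).
by rewrite -extend0_tnth e1 // mem_nth.
Qed.

Lemma leb_rec_lty L : (leb_config L (rec_configs L) < +oo)%E.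
Proof.
apply: le_lt_trans (lebesgue_tuple_box (#|` L|) h).
rewrite /leb_config /pushforward; apply: le_measure; rewrite ?inE.
- rewrite -[X in measurable X]setTI; apply: measurable_extend0 => //.
  exact: measurable_rec_configs.
- exact: measurable_tuple_box.
by rewrite -allowed_rec => t [].
Qed.

Lemma measurable_add_in L x : measurable_fun setT (add_in L x).
Proof.
apply: measurable_config => y; rewrite /add_in; case: (y \in L) => //.
have ma : measurable_fun setT (addp^~ x : config R d -> config R d).
  apply: measurable_config => z; apply: measurable_funD => //.
  exact: measurable_coord.
exact: (measurableT_comp (measurable_coord y) (measurableT_comp (measurable_stab gamma _) ma)).
Qed.

Lemma measurable_shift (tau : site d -> R) :
  measurable_fun setT ((fun eta => fun y => eta y + tau y) : config R d -> config R d).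
Proof.
apply: measurable_config => y; apply: measurable_funD => //.
exact: measurable_coord.
Qed.

Section invariance.
Variables (L : {fset site d}) (x : site d).
Local Notation a := (add_in L x).
Local Notation u eta := (toppling_count gamma [set` L] (addp eta x)).

(** All toppling numbers in L packed into one number, which indexes a countable partition into
    pieces of constant toppling numbers; [c] decodes it. *)
Let code eta : nat := choice.pickle [seq u eta y | y <- enum_fset L].

Let c k y : nat := if choice.unpickle k is Some s then
  if y \in L then nth 0%N s (index y (enum_fset L)) else 0%N else 0%N.

Let c_code eta : c (code eta) =1 u eta.
Proof.
move=> y; rewrite /c choice.pickleK; have [yL|/negP yL] := boolP (y \in L).
  by rewrite (nth_map 0) ?index_mem // nth_index.
by rewrite toppling_count_supp.
Qed.

Let code_c eta : code eta = choice.pickle [seq c (code eta) y | y <- enum_fset L].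
Proof. by rewrite {1}/code; congr choice.pickle; apply: eq_map => y; rewrite c_code. Qed.

Let measurable_code : measurable_fun setT code.
Proof.
apply: measurable_nat => k.
(* Numbers that are not recovered from their own decoding have an empty fibre. *)
have [ck|ck] := eqVneq k (choice.pickle [seq c k y | y <- enum_fset L]); last first.
  rewrite (_ : _ @^-1` _ = set0) //; apply/seteqP; split=> eta //= e.
  by move/eqP: ck; apply; rewrite -e; exact: code_c.
rewrite (_ : _ @^-1` _ = \bigcap_(y in [set` L]) (fun eta => u eta y) @^-1` [set c k y]).
  apply: fin_bigcap_measurable; first exact: finite_fset.
  move=> y _; rewrite -[X in measurable X]setTI.
  exact: (measurableT_comp (measurable_toppling_count gamma _ y) (measurable_shift _)).
apply/seteqP; split=> eta; first by move=> /= e y _ /=; rewrite -e c_code.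
move=> ue /=; rewrite ck /code; congr choice.pickle; apply/eq_in_map => y yL.
exact: ue.
Qed.

Let tau k y : R := if y \in L then (y == x)%:R - lap gamma (fun z => (c k z)%:R) y else 0.

Let aE eta : rec_configs L eta -> a eta = (fun y => eta y + tau (code eta) y).
Proof.
move=> [_ e0 _]; apply/funext => y; rewrite /add_in /tau.
case: ifPn => [yL|/e0 ->]; last by rewrite addr0.
rewrite /stab /ht /addp addrA; congr (_ - lap _ _ _).
by apply/funext => z; rewrite c_code.
Qed.

Let E k := rec_configs L `&` code @^-1` [set k].

Let mE k : measurable (E k).
Proof.
apply: measurableI; first exact: measurable_rec_configs.
by rewrite -[X in measurable X]setTI; exact: measurable_code.
Qed.

(** The image of the piece [E k] under the addition operator, written as a translate so that its
    measurability is immediate. *)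
Let F k : set (config R d) := [set zeta | E k (fun y => zeta y + - tau k y)].

Let mF k : measurable (F k).
Proof. by rewrite -[X in measurable X]setTI; exact: measurable_shift. Qed.

Let FE k zeta : F k zeta -> exists2 eta, E k eta & a eta = zeta.
Proof.
move=> Fz; exists (fun y => zeta y + - tau k y) => //.
case: Fz => re /= ck; rewrite aE // ck; apply/funext => y; exact: subrK.
Qed.

(** Each piece is translated onto its image without change of measure. The images are disjoint by
    injectivity and consist of allowed configurations. *)
Let leb_le C : measurable C ->
  (leb_config L (rec_configs L `&` a @^-1` C) <= leb_config L (rec_configs L `&` C))%E.
Proof.
move=> mC.
have ma : measurable (a @^-1` C).
  by rewrite -[X in measurable X]setTI; exact: measurable_add_in.
have -> : rec_configs L `&` a @^-1` C = \bigcup_k (E k `&` a @^-1` C).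
  apply/seteqP; split=> [eta [re ae]|eta [k _ [[re _] ae]]] //.
  by exists (code eta).
rewrite measure_bigcup //; last 2 first.
- by move=> k _; exact: measurableI.
- by apply/trivIsetP => i j _ _ /eqP ij; apply/seteqP; split=> // eta [[[_ /= ei] _] [[_ /= ej] _]];
    apply: ij; rewrite -ei -ej.
have eF k : leb_config L (E k `&` a @^-1` C) = leb_config L (F k `&` C).
  rewrite -[RHS](@leb_config_shift L (tau k)); first last.
  - exact: measurableI.
  - by move=> y /negbTE yL; rewrite /tau yL.
  congr (leb_config L _); apply/seteqP; split=> eta /=.
    move=> [Ee Ce]; split.
      by rewrite /F /= (_ : (fun y => _) = eta) //; apply/funext => y; rewrite addrK.
    by case: Ee => re /= ke; rewrite -ke -aE.
  move=> [+ Ce]; rewrite /F /= (_ : (fun y => _) = eta); last by apply/funext => y; rewrite addrK.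
  by move=> Ee; split=> //; case: Ee => re /= ke; rewrite aE // ke.
rewrite (eq_eseriesr (fun k _ => eF k)) -measure_bigcup //; last 2 first.
- by move=> k _; exact: measurableI.
- apply/trivIsetP => i j _ _ /eqP ij; apply/seteqP; split=> // zeta [[/FE[eta [re /= ei] <-] _] [/FE[eta' [re' /= ej] e'] _]].
  by apply: ij; rewrite -ei -ej (add_in_inj re' re e').
apply: le_measure; rewrite ?inE.
- by apply: bigcupT_measurable => k; exact: measurableI.
- by apply: measurableI => //; exact: measurable_rec_configs.
move=> zeta [k _ [/FE[eta [re _] <-] Cz]]; split=> //.
exact: add_in_rec.
Qed.

(* [add_in L x] maps the allowed configurations into themselves, injectively, and
   is a translation where the toppling numbers take given values. *)
Lemma leb_add_in C : measurable C ->
  leb_config L (rec_configs L `&` a @^-1` C) = leb_config L (rec_configs L `&` C).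
Proof.
move=> mC; apply/eqP; rewrite eq_le leb_le //=.
have mR := @measurable_rec_configs L.
have ma : measurable (a @^-1` C).
  by rewrite -[X in measurable X]setTI; exact: measurable_add_in.
have split B : measurable B -> leb_config L (rec_configs L) =
    (leb_config L (rec_configs L `&` B) + leb_config L (rec_configs L `&` ~` B))%E.
  move=> mB; rewrite -measureU //; first by rewrite -setIUr setUv setIT.
  - exact: measurableI.
  - by apply: measurableI => //; exact: measurableC.
  - by rewrite setIACA setICr setI0.
have fin B : measurable B -> leb_config L (rec_configs L `&` B) \is a fin_num.
  move=> mB; rewrite ge0_fin_numE //; apply: le_lt_trans (leb_rec_lty L).
  by apply: le_measure; rewrite ?inE //; exact: measurableI.
(* The inequality [leb_le] holds for C and for its complement, and both sides have the same finite
   total, so both inequalities are equalities. *)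
have e : (leb_config L (rec_configs L `&` C) + leb_config L (rec_configs L `&` ~` C) =
  leb_config L (rec_configs L `&` a @^-1` C) + leb_config L (rec_configs L `&` a @^-1` (~` C)))%E.
  by rewrite -split // -split.
have mC' : measurable (~` C) by exact: measurableC.
have ma' : measurable (a @^-1` (~` C)) by rewrite preimage_setC; exact: measurableC.
have := leb_le mC'; move: e.
move: (fin _ mC) (fin _ mC') (fin _ ma) (fin _ ma').
case: (leb_config L (_ `&` C)) => // r1 _; case: (leb_config L _) => // r2 _.
case: (leb_config L _) => // r3 _; case: (leb_config L _) => // r4 _.
by rewrite -!EFinD !lee_fin => -[]; lra.
Qed.

End invariance.

Section thin.
Variables (L : {fset site d}) (y : site d) (k : nat) (c : R).
Hypotheses (yL : y \in L) (k0 : (0 < k)%N).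

Let eps : R := gamma / k%:R.

Let A : set (config R d) := rec_configs L `&` [set eta | c <= eta y < c + eps].

Let mA : measurable A.
Proof.
apply: measurableI; first exact: measurable_rec_configs.
rewrite (_ : mkset _ = (fun eta : config R d => eta y : R) @^-1` `[c, c + eps[).
  by rewrite -[X in measurable X]setTI; exact: measurable_coord.
by apply/seteqP; split=> eta /=; rewrite in_itv.
Qed.

Let tau (j : nat) z : R := if z == y then c - ((2 * d)%:R + j%:R * eps) else 0.

Let B j : set (config R d) := [set eta | A (fun z => eta z + tau j z)].

Let mB j : measurable (B j).
Proof. by rewrite -[X in measurable X]setTI; exact: measurable_shift. Qed.

Let eps0 : 0 < eps. Proof. by rewrite divr_gt0 // ltr0n. Qed.

Let By j eta : B j eta ->
  (2 * d)%:R + j%:R * eps <= eta y < (2 * d)%:R + j.+1%:R * eps.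
Proof. by move=> [_ /=]; rewrite /tau eqxx -natr1; lra. Qed.

Let B_rec j : (j < k)%N -> B j `<=` rec_configs L.
Proof.
move=> jk eta Bj; have /andP[lo hi] := By Bj; case: Bj => -[e1 e0 er] _.
have je : j.+1%:R * eps <= gamma.
  by rewrite /eps mulrCA ler_piMr ?(ltW gamma_gt0) // ler_pdivrMr ?ltr0n // mul1r ler_nat.
have j0 : 0 <= j%:R * eps by rewrite mulr_ge0 // ltW.
split=> [z zL|z zL|W WL [W0 fW]].
- have [->|zy] := eqVneq z y.
    apply/andP; split; first by apply: le_trans lo; rewrite addr_ge0.
    by apply: lt_le_trans hi _; rewrite lerD2l.
  by have := e1 z zL; rewrite /tau (negbTE zy) addr0.
- have := e0 z zL; rewrite /tau; case: eqP => [zy|_]; last by rewrite addr0.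
  by rewrite zy yL in zL.
- apply: (er W WL); split=> // z zW; have := fW z zW; rewrite /tau.
  case: eqP => [->|_]; last by rewrite addr0.
  rewrite ltNge => /negP []; apply: le_trans lo.
  by rewrite -[leLHS]addr0 lerD // ler_nat deg_le.
Qed.

(* The height at y can be moved to any of the k windows of length gamma / k above
   2d, as a site of height at least 2d belongs to no forbidden set. *)
Lemma thin : (k%:R%:E * leb_config L (rec_configs L `&` [set eta | (c <= eta y < c + gamma / k%:R)%R])
  <= leb_config L (rec_configs L))%E.
Proof.
rewrite -/eps -/A.
have eB j : leb_config L (B j) = leb_config L A.
  apply: leb_config_shift => // z zL; rewrite /tau; case: eqP => // zy.
  by rewrite zy yL in zL.
have -> : (k%:R%:E * leb_config L A = leb_config L (\bigcup_(j in `I_k) B j))%E.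
  rewrite measure_fin_bigcup //; last first.
    apply/trivIsetP => i j _ _ ij; apply/seteqP; split=> // eta [/By + /By].
    have [lt|lt] := ltnP i j => /andP[lo1 hi1] /andP[lo2 hi2].
      have : (i.+1%:R * eps <= j%:R * eps) by rewrite ler_wpM2r ?ler_nat // ltW.
      lra.
    have {}lt : (j < i)%N by rewrite ltn_neqAle eq_sym ij.
    have : (j.+1%:R * eps <= i%:R * eps) by rewrite ler_wpM2r ?ler_nat // ltW.
    lra.
  rewrite (eq_fsbigr (fun=> leb_config L A)); last by move=> j _; exact: eB.
  by rewrite -fsbig_ord sumr_const card_ord mule_natl.
apply: le_measure; rewrite ?inE.
- by apply: bigcup_measurable.
- exact: measurable_rec_configs.
by move=> eta [j jk /B_rec]; apply.
Qed.

End thin.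

End finite_volume.

(** * Infinite-volume limit *)

Section ramp.
Variable R : realType.

(* 0 for [t <= 0], 1 for [1 <= t], linear in between. *)
Definition ramp (t : R) : R := (`|t| - `|t - 1| + 1) / 2.

Lemma ramp_itv t : 0 <= ramp t <= 1.
Proof.
have := ler_normB t 1; have := ler_normD (t - 1) 1.
rewrite subrK normr1 /ramp; move: `|t| `|t - 1| => a b; lra.
Qed.

Lemma ramp0 t : t <= 0 -> ramp t = 0.
Proof.
by move=> t0; rewrite /ramp ler0_norm // ltr0_norm ?subr_lt0; [lra|lra].
Qed.

Lemma ramp1 t : 1 <= t -> ramp t = 1.
Proof.
by move=> t0; rewrite /ramp !ger0_norm ?subr_ge0 //; lra.
Qed.

Lemma continuous_ramp (T : topologicalType) (f : T -> R) :
  continuous f -> continuous (fun x => ramp (f x)).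
Proof.
move=> cf x; rewrite /ramp; apply: cvgM; last exact: cvg_cst.
apply: cvgD; last exact: cvg_cst.
apply: cvgB; first by apply: cvg_norm; exact: cf.
by apply: cvg_norm; apply: cvgB; [exact: cf|exact: cvg_cst].
Qed.

Lemma continuous_mul (T : topologicalType) (f g : T -> R) :
  continuous f -> continuous g -> continuous (fun x => f x * g x).
Proof. by move=> cf cg x; apply: cvgM; [exact: cf|exact: cg]. Qed.

Lemma continuousB1 (T : topologicalType) (f : T -> R) :
  continuous f -> continuous (fun x => 1 - f x).
Proof. by move=> cf x; apply: cvgB; [exact: cvg_cst|exact: cf]. Qed.

Lemma continuous_dist (T : topologicalType) (f : T -> R) (a b : R) :
  continuous f -> continuous (fun x => `|f x - a| / b - 1).
Proof.
move=> cf x; apply: cvgB; last exact: cvg_cst.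
apply: cvgM; last exact: cvg_cst.
by apply: cvg_norm; apply: cvgB; [exact: cf|exact: cvg_cst].
Qed.

(** Where w vanishes, the product is squeezed between 0 and w; elsewhere the indicator is locally
    constant on A. *)
Lemma within_continuous_cutoff (T : topologicalType) (A G : set T) (w : T -> R) :
  continuous w -> (forall x, 0 <= w x <= 1) ->
  (forall x, A x -> w x = 0 \/ \forall y \near x, A y -> (G x <-> G y)) ->
  {within A, continuous (fun x => \1_G x * w x)}.
Proof.
move=> cw w01 wG; apply/subspace_continuousP => x Ax.
rewrite /from_subspace; have cw' : w y @[y --> within A (nbhs x)] --> w x.
  by apply: cvg_within_filter; exact: cw.
have [w0|near_same] := wG x Ax.
  rewrite w0 mulr0; apply: (@squeeze_cvgr _ _ _ _ (fun=> 0) w).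
  - apply: nearW => y; have /andP[y0 y1] := w01 y.
    by rewrite indicE; case: (_ \in _); rewrite ?mul1r ?mul0r ?lexx ?y0.
  - exact: cvg_cst.
  - by rewrite -w0.
apply: cvg_trans (_ : \1_G x * w y @[y --> within A (nbhs x)] --> _); last first.
  by apply: cvgM => //; exact: cvg_cst.
apply: near_eq_cvg; rewrite near_withinE.
apply: filterS near_same => y same Ay; congr (_ * _).
rewrite !indicE; congr (nat_of_bool _)%:R; apply/idP/idP; rewrite !inE.
  by move/(same Ay).
by move/(same Ay).
Qed.

Lemma near_same_comparisons (T : topologicalType) (I : eqType) (X : I -> T -> R)
    (x : T) (l : seq (I * R)) : (forall i, continuous (X i)) ->
  (forall p, p \in l -> X p.1 x != p.2) ->
  \forall y \near x, forall p, p \in l -> (p.2 <= X p.1 x) = (p.2 <= X p.1 y).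
Proof.
move=> cX; elim: l => [|p l IH] nz; first by apply: nearW => ? ?; rewrite in_nil.
have ep : X p.1 x != p.2 by apply: nz; rewrite mem_head.
have np : \forall y \near x, (p.2 <= X p.1 x) = (p.2 <= X p.1 y).
  have [lt|gt|eq] := ltgtP p.2 (X p.1 x); last by rewrite eq eqxx in ep.
    have H : \forall y \near x, p.2 < X p.1 y := cX p.1 x _ (lt_nbhsr lt).
    by apply: filterS H => y /ltW ->.
  have H : \forall y \near x, X p.1 y < p.2 := cX p.1 x _ (lt_nbhsl gt).
  by apply: filterS H => y; rewrite ltNge => /negbTE ->.
have {}IH : \forall y \near x, forall p, p \in l -> (p.2 <= X p.1 x) = (p.2 <= X p.1 y).
  by apply: IH => q ql; apply: nz; rewrite inE ql orbT.
by apply: filterS2 np IH => y np IH q; rewrite inE => /orP[/eqP ->//|]; exact: IH.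
Qed.

Lemma sandwich_Rintegral dT (T : measurableType dT) (mu : {measure set T -> \bar R})
    (D A B : set T) (f : T -> R) : measurable D -> measurable A -> measurable B ->
  (mu D < +oo)%E -> measurable_fun D f ->
  (forall x, D x -> \1_A x <= f x <= \1_B x) ->
  fine (mu (D `&` A)) <= \int[mu]_(x in D) f x <= fine (mu (D `&` B)).
Proof.
move=> mD mA mB muD mf AfB.
have f0 x : D x -> 0 <= f x.
  by move=> Dx; have /andP[+ _] := AfB x Dx; apply: le_trans; rewrite indicE.
have fin C : measurable C -> mu (D `&` C) \is a fin_num.
  move=> mC; rewrite ge0_fin_numE //; apply: le_lt_trans muD.
  by apply: le_measure; rewrite ?inE //; exact: measurableI.
have le1 : (mu (D `&` A) <= \int[mu]_(x in D) (f x)%:E)%E.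
  rewrite setIC -integral_indic //; apply: ge0_le_integral => //.
  - exact/measurable_EFinP.
  - exact/measurable_EFinP.
  - by move=> x Dx; rewrite lee_fin; case/andP: (AfB x Dx).
have le2 : (\int[mu]_(x in D) (f x)%:E <= mu (D `&` B))%E.
  rewrite setIC -integral_indic //; apply: ge0_le_integral => //.
  - exact/measurable_EFinP.
  - exact/measurable_EFinP.
  - by move=> x Dx; rewrite lee_fin; case/andP: (AfB x Dx).
have fi : (\int[mu]_(x in D) (f x)%:E)%E \is a fin_num.
  rewrite ge0_fin_numE; last by apply: integral_ge0 => x Dx; rewrite lee_fin f0.
  by apply: le_lt_trans le2 _; rewrite -ge0_fin_numE // fin.
by rewrite /Rintegral !fine_le // fin.
Qed.

Lemma probability1_setI dT (T : measurableType dT) (m : probability T R) (S A : set T) :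
  measurable S -> m S = 1%E -> measurable A -> m (A `&` S) = m A.
Proof.
move=> mS mS1 mA; apply/eqP; rewrite eq_le le_measure ?inE //=; last exact: measurableI.
have mC : (m (~` S) <= 0)%E.
  by rewrite probability_setC // mS1 subee.
apply: (@le_trans _ _ (m ((A `&` S) `|` ~` S))).
  rewrite le_measure ?inE //.
    by apply: measurableU; [exact: measurableI|exact: measurableC].
  by move=> x Ax; have [Sx|Sx] := pselect (S x); [left|right].
apply: le_trans (measureU2 _ _ _) _; [exact: measurableI|exact: measurableC|].
by rewrite -[leRHS]adde0; apply: leeD.
Qed.

Lemma eventually_cvg_probability dT (T : measurableType dT) (m : probability T R)
    (S G : set T) (G_ : nat -> set T) : measurable S -> m S = 1%E -> measurable G ->
  (forall k, measurable (G_ k)) ->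
  (forall x, S x -> \forall k \near \oo, G_ k x <-> G x) ->
  m (G_ k) @[k --> \oo] --> m G.
Proof.
move=> mS mS1 mG mG_ ev.
have mI (A : set T) : measurable A -> m A = (\int[m]_(x in S) (\1_A x)%:E)%E.
  move=> mA; have e := probability1_setI mS mS1 mA.
  by rewrite integral_indic //; exact: esym e.
rewrite mI // (_ : (fun k => m (G_ k)) = fun k => (\int[m]_(x in S) (\1_(G_ k) x)%:E)%E); last first.
  by apply/funext => k; exact: mI.
have := @dominated_convergence _ _ _ m S mS (fun k x => (\1_(G_ k) x)%:E)
  (fun x => (\1_G x)%:E) (cst 1%E).
case.
- by move=> k; exact/measurable_EFinP.
- exact/measurable_EFinP.
- apply: aeW => x Sx; apply: cvg_near_cst; apply: filterS (ev x Sx) => k kG.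
  rewrite !indicE; congr ((nat_of_bool _)%:R%:E).
  by apply/idP/idP; rewrite !inE => /kG.
- exact: finite_measure_integrable_cst.
- apply: aeW => x k Sx; rewrite /= lee_fin indicE ger0_norm //.
  by case: (_ \in _).
- by [].
Qed.

End ramp.

Section grid.
Variables (R : realType) (d : nat) (gamma : R).
Hypothesis gamma_gt0 : 0 < gamma.
Implicit Types (x y z : site d) (eta : config R d) (L : {fset site d}).
Implicit Types (G : set (config R d)) (l : seq (site d * R)).

Local Notation h := (height_bound d gamma).

Lemma continuous_coord y : continuous (fun eta : config R d => eta y : R).
Proof. exact: (@proj_continuous (site d) (fun=> R) y). Qed.

(** A continuous cutoff: 0 if some coordinate is within e of its threshold, 1 if all are at distance
    at least 2 e. *)
Fixpoint away (e : R) l eta : R :=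
  if l is p :: l' then ramp (`|eta p.1 - p.2| / e - 1) * away e l' eta else 1.

Lemma away_itv e l eta : 0 <= away e l eta <= 1.
Proof.
elim: l => [|p l /andP[IH0 IH1]] /=; first by rewrite ler01 lexx.
have /andP[r0 r1] := ramp_itv (`|eta p.1 - p.2| / e - 1).
by rewrite mulr_ge0 //= mulr_ile1.
Qed.

Lemma continuous_away e l : continuous (away e l).
Proof.
elim: l => [|p l IH]; first exact: (@cst_continuous _ _ (1 : R)).
apply: (@continuous_mul R (config R d)) IH.
apply: (@continuous_ramp R (config R d)); apply: (@continuous_dist R (config R d)).
exact: continuous_coord.
Qed.

Lemma measurable_away e l : measurable_fun setT (away e l).
Proof.
elim: l => [|p l IH] /=; first exact: measurable_cst.
apply: measurable_funM => //.
have mr : measurable_fun setT (@ramp R).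
  apply: continuous_measurable_fun; apply: (@continuous_ramp R R id).
  by move=> ?; exact: cvg_id.
apply: (measurableT_comp mr); apply: measurable_funB => //.
apply: measurable_funM => //; apply: (measurableT_comp (@normr_measurable R setT)).
by apply: measurable_funB => //; exact: measurable_coord.
Qed.

Definition near_grid (e : R) l : set (config R d) :=
  [set eta | has (fun p => `|eta p.1 - p.2| < e) l].

Lemma measurable_near_grid e l : measurable (near_grid e l).
Proof.
elim: l => [|p l IH].
  by rewrite (_ : near_grid _ _ = set0) //; apply/seteqP; split.
rewrite (_ : near_grid _ _ =
  (fun eta : config R d => eta p.1 : R) @^-1` (ball p.2 e) `|` near_grid e l).
  apply: measurableU => //; rewrite -[X in measurable X]setTI.
  by apply: measurable_coord => //; exact: measurable_ball.
apply/seteqP; split=> eta; rewrite /near_grid /= /ball /= distrC.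
  by move=> /orP[->|->]; [left|right].
by move=> [->|->] //; rewrite orbT.
Qed.

Lemma away_far (e : R) l eta : 0 < e -> ~ near_grid (2 * e) l eta -> away e l eta = 1.
Proof.
move=> e0; elim: l => //= p l IH /negP; rewrite negb_or -leNgt => /andP[far /negP fl].
by rewrite IH // mulr1 ramp1 // lerBrDr ler_pdivlMr.
Qed.

Lemma away_near (e : R) l eta : 0 < e -> near_grid e l eta -> away e l eta = 0.
Proof.
move=> e0; elim: l => //= p l IH /orP[lt|/IH ->]; last by rewrite mulr0.
by rewrite ramp0 ?mul0r // subr_le0 ler_pdivrMr // mul1r ltW.
Qed.

(* G depends on eta only through the comparisons of eta y with c, (y, c) in l. *)
Definition grid_set l G := forall eta eta' : config R d,
  stable_configs gamma eta -> stable_configs gamma eta' ->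
  (forall p, p \in l -> (p.2 <= eta p.1) = (p.2 <= eta' p.1)) -> G eta -> G eta'.

Lemma continuous_grid (e : R) l G : 0 < e -> grid_set l G ->
  {within stable_configs gamma, continuous (fun eta => \1_G eta * away e l eta)}.
Proof.
move=> e0 gG; apply: (@within_continuous_cutoff R (config R d)).
- exact: continuous_away.
- exact: away_itv.
move=> eta st.
have [zero|nz] := pselect (exists2 p, p \in l & eta p.1 = p.2).
  left; apply: away_near => //; apply/hasP; have [p pl ep] := zero.
  by exists p => //; rewrite ep subrr normr0.
right.
have near_same : \forall zeta \near eta, forall p, p \in l -> (p.2 <= eta p.1) = (p.2 <= zeta p.1).
  apply: (@near_same_comparisons R (config R d) (site d) (fun y zeta => zeta y)).
    exact: continuous_coord.
  by move=> p pl; apply/eqP => ep; apply: nz; exists p.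
apply: filterS near_same => zeta same stz.
by split; apply: gG => // p /same.
Qed.

(* The law m_L of a set, as a real number. *)
Definition pL L G : R :=
  fine (leb_config L (rec_configs gamma L `&` G)) / fine (leb_config L (rec_configs gamma L)).

Let lebR L : {measure set (config R d) -> \bar R} := @leb_config R d L.

Lemma mean_allowed_pL L (A B : set (config R d)) (f : config R d -> R) : measurable A -> measurable B ->
  measurable_fun setT f -> (forall eta, \1_A eta <= f eta <= \1_B eta) ->
  pL L A <= mean_allowed gamma L f <= pL L B.
Proof.
move=> mA mB mf AfB.
have f0 eta : 0 <= f eta.
  by have /andP[+ _] := AfB eta; apply: le_trans; rewrite indicE.
have mR := @measurable_rec_configs R d gamma L.
have mext := @measurable_extend0 R d L.
have -> : mean_allowed gamma L f = (\int[lebR L]_(eta in rec_configs gamma L) f eta) /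
    fine (leb_config L (rec_configs gamma L)).
  rewrite /mean_allowed allowed_rec /leb_config; congr (_ / _); congr fine.
  rewrite -(@ge0_integral_pushforward _ _ _ _ _ _ mext _ (rec_configs gamma L) (fun eta => (f eta)%:E)) //.
  - by apply/measurable_EFinP; exact: measurable_funS mf.
  - by move=> eta _; rewrite lee_fin.
have /andP[le1 le2] := sandwich_Rintegral (mu := lebR L) mR mA mB (leb_rec_lty gamma L)
  (measurable_funS measurableT (@subsetT _ _) mf) (fun eta _ => AfB eta).
by rewrite /pL !ler_wpM2r // invr_ge0 fine_ge0.
Qed.

Lemma pL_fin L G : measurable G -> leb_config L (rec_configs gamma L `&` G) \is a fin_num.
Proof.
move=> mG; rewrite ge0_fin_numE //; apply: le_lt_trans (leb_rec_lty gamma L).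
apply: (@le_measure _ _ _ (lebR L)); rewrite ?inE //.
  by apply: measurableI => //; exact: measurable_rec_configs.
exact: measurable_rec_configs.
Qed.

Lemma pL_le L A B : measurable A -> measurable B -> A `<=` B -> pL L A <= pL L B.
Proof.
move=> mA mB AB; rewrite /pL ler_wpM2r // ?invr_ge0 ?fine_ge0 //.
rewrite fine_le ?pL_fin //; apply: (@le_measure _ _ _ (lebR L)); rewrite ?inE //.
- by apply: measurableI => //; exact: measurable_rec_configs.
- by apply: measurableI => //; exact: measurable_rec_configs.
- exact: setIS.
Qed.

Lemma pLU L A B : measurable A -> measurable B -> pL L (A `|` B) <= pL L A + pL L B.
Proof.
move=> mA mB; rewrite /pL -mulrDl ler_wpM2r // ?invr_ge0 ?fine_ge0 //.
rewrite -fineD ?pL_fin // fine_le ?fin_numD ?pL_fin //; first exact: measurableU.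
rewrite setIUr; apply: (@measureU2 _ _ _ (lebR L)).
- by apply: measurableI => //; exact: measurable_rec_configs.
- by apply: measurableI => //; exact: measurable_rec_configs.
Qed.

Lemma pL_le_union L A B F : measurable A -> measurable B -> measurable F ->
  (forall eta, rec_configs gamma L eta -> A eta -> B eta \/ F eta) ->
  pL L A <= pL L B + pL L F.
Proof.
move=> mA mB mF ABF; have mR := @measurable_rec_configs R d gamma L.
have -> : pL L A = pL L (rec_configs gamma L `&` A) by rewrite /pL setIA setIid.
apply: le_trans (pLU L mB mF); apply: pL_le; first exact: measurableI.
  exact: measurableU.
by move=> eta [re Ae]; exact: ABF.
Qed.

Lemma pL_thin L y c k : y \in L -> (0 < k)%N ->
  pL L [set eta | c <= eta y < c + gamma / k%:R] <= k%:R^-1.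
Proof.
move=> yL k0; have := thin gamma_gt0 c yL k0.
have mS : measurable [set eta : config R d | c <= eta y < c + gamma / k%:R].
  rewrite (_ : mkset _ = (fun eta : config R d => eta y : R) @^-1` `[c, c + gamma / k%:R[).
    by rewrite -[X in measurable X]setTI; exact: measurable_coord.
  by apply/seteqP; split=> eta /=; rewrite in_itv.
have := pL_fin L mS; rewrite /pL.
have := @pL_fin L setT measurableT; rewrite setIT.
have := measure_ge0 (lebR L) (rec_configs gamma L); rewrite /lebR /=.
case: (leb_config L (rec_configs gamma L)) => // b.
case: (leb_config L _) => // a; rewrite !lee_fin /= => b0 _ _ ka.
(* With a null normalization the quotient is 0, as the inverse of 0 is 0. *)
have [->|bn0] := eqVneq b 0; first by rewrite invr0 mulr0 invr_ge0.
rewrite ler_pdivrMr ?lt_def ?bn0 //.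
by rewrite -ler_pdivrMl ?invr_gt0 ?ltr0n // invrK.
Qed.

Lemma pL_near_grid L l k : (0 < k)%N -> (forall p, p \in l -> p.1 \in L) ->
  pL L (near_grid (gamma / k%:R) l) <= (size l)%:R * (2 * k%:R^-1).
Proof.
move=> k0; elim: l => [|p l IH] lL.
  rewrite (_ : near_grid _ _ = set0); last by apply/seteqP; split.
  by rewrite /pL setI0 /leb_config /pushforward preimage_set0 measure0 /= !mul0r.
set e := gamma / k%:R.
pose S c := [set eta : config R d | c <= eta p.1 < c + e].
have mS c : measurable (S c).
  rewrite (_ : S c = (fun eta : config R d => eta p.1 : R) @^-1` `[c, c + e[).
    by rewrite -[X in measurable X]setTI; exact: measurable_coord.
  by apply/seteqP; split=> eta; rewrite /S /= in_itv.
have mg := measurable_near_grid e l.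
(* An interval of radius e about the threshold is covered by two windows of length e, whence the
   factor 2. *)
apply: (@le_trans _ _ (pL L ((S (p.2 - e) `|` S p.2) `|` near_grid e l))).
  apply: pL_le; first exact: measurable_near_grid.
    by apply: measurableU => //; exact: measurableU.
  move=> eta; rewrite /near_grid /= => /orP[|?]; last by right.
  rewrite ltr_distl => /andP[lo hi]; left; rewrite /S /=.
  have [le|lt] := leP p.2 (eta p.1); [right|left]; lra.
apply: le_trans (pLU _ _ _) _ => //; first exact: measurableU.
rewrite /= -addn1 natrD mulrDl mul1r addrC lerD //.
  by apply: IH => q ql; apply: lL; rewrite inE ql orbT.
apply: le_trans (pLU _ _ _) _ => //.
have pp : p.1 \in L by apply: lL; rewrite mem_head.
have := pL_thin (p.2 - e) pp k0; have := pL_thin p.2 pp k0.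
rewrite -/e -!/(S _); lra.
Qed.

(** Chosen so that 2d rho = 2d + gamma / 2: the weights use up one half of the dissipation gamma and
    leave the other half. *)
Local Notation rho := (1 + gamma / (4 * d)%:R).

(** * Exponential decay of avalanches, uniformly in the volume *)

Section weights.
Hypothesis d_gt0 : (0 < d)%N.
Variables (L : {fset site d}) (x : site d).

Let rho1 : 1 <= rho. Proof. by rewrite lerDl divr_ge0 // ltW. Qed.

Let rho_d : (2 * d)%:R * rho = (2 * d)%:R + gamma / 2 :> R.
Proof.
have d0 : d%:R != 0 :> R by rewrite pnatr_eq0 -lt0n.
by rewrite !natrM; field.
Qed.

Definition weight y : R := rho ^+ ldist x y.

Let w0 y : 0 <= weight y.
Proof. by rewrite exprn_ge0 // (le_trans ler01). Qed.

Let weight_adj y z : adj y z -> weight z <= rho * weight y.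
Proof. by move=> /(ldist_adj x) yz; rewrite /weight -exprS ler_weXn2l. Qed.

Let sum_nbr_weight z : \sum_(y <- nbr z) weight y <= ((2 * d)%:R + gamma / 2) * weight z.
Proof.
apply: (@le_trans _ _ (\sum_(y <- nbr z) rho * weight z)).
  by rewrite big_seq [leRHS]big_seq; apply: ler_sum => y; rewrite nbrE => /weight_adj.
rewrite big_const_seq iter_addr_0 count_predT -[leLHS]mulr_natl mulrA ler_wpM2r //.
by rewrite -rho_d ler_wpM2r ?(le_trans ler01) // ler_nat card_nbr.
Qed.

(** By symmetry the Laplacian is moved from u to the weight w, which satisfies Delta w >= (gamma /
    2) w because w grows at most by the factor rho from a site to a neighbour. *)
Lemma sum_weight_lap (u : site d -> R) : (forall y, 0 <= u y) ->
  (forall y, y \notin L -> u y = 0) ->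
  gamma / 2 * (\sum_(y <- L) weight y * u y) <= \sum_(y <- L) weight y * lap gamma u y.
Proof.
move=> u0 uL.
have -> : \sum_(y <- L) weight y * lap gamma u y = h * (\sum_(y <- L) weight y * u y) -
    \sum_(y <- L) \sum_(z <- L) (adj y z)%:R * (weight y * u z).
  rewrite mulr_sumr -sumrB; apply: eq_big_seq => y yL.
  rewrite /lap mulrBr mulrCA; congr (_ - _); rewrite mulr_sumr.
  rewrite [RHS](bigID (fun z => z \in nbr y)) /= [X in _ = _ + X]big1 ?addr0; last first.
    by move=> z; rewrite nbrE => /negbTE ->; rewrite mul0r.
  rewrite [LHS](bigID (fun z => z \in L)) /= [X in _ + X]big1 ?addr0; last first.
    by move=> z /uL ->; rewrite mulr0.
  rewrite -[LHS]big_filter -[RHS]big_filter.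
  rewrite (perm_big [seq z <- enum_fset L | z \in nbr y]).
    rewrite big_seq [RHS]big_seq; apply: eq_bigr => z.
    by rewrite mem_filter nbrE => /andP[-> _]; rewrite mul1r.
  apply: uniq_perm; rewrite ?filter_uniq ?fset_uniq // => z.
  by rewrite !mem_filter andbC.
have : \sum_(y <- L) \sum_(z <- L) (adj y z)%:R * (weight y * u z) <=
    \sum_(z <- L) u z * \sum_(y <- nbr z) weight y.
  rewrite exchange_big /=; apply: ler_sum => z _; rewrite mulr_sumr.
  rewrite (bigID (fun y => y \in nbr z)) /= [X in _ + X]big1 ?addr0; last first.
    by move=> y; rewrite nbrE adjC => /negbTE ->; rewrite mul0r.
  rewrite [leRHS](bigID (fun y => y \in L)) /=.
  rewrite -[leLHS]addr0 lerD //; last by apply: sumr_ge0 => y _; rewrite mulr_ge0.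
  rewrite -big_filter -[leRHS]big_filter.
  rewrite (perm_big [seq y <- enum_fset (nbr z) | y \in L]); last first.
    apply: uniq_perm; rewrite ?filter_uniq ?fset_uniq // => y.
    by rewrite !mem_filter andbC.
  rewrite big_seq [leRHS]big_seq; apply: ler_sum => y.
  by rewrite mem_filter nbrE adjC => /andP[_ ->]; rewrite mul1r mulrC.
have : \sum_(z <- L) u z * \sum_(y <- nbr z) weight y <=
    ((2 * d)%:R + gamma / 2) * (\sum_(z <- L) weight z * u z).
  rewrite mulr_sumr; apply: ler_sum => z _.
  by rewrite mulrA [leLHS]mulrC ler_wpM2r.
have W0 : 0 <= \sum_(y <- L) weight y * u y.
  by apply: sumr_ge0 => y _; rewrite mulr_ge0.
rewrite {1}/height_bound; set W := \sum_(y <- L) _ * _ in W0 *; lra.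
Qed.

Hypothesis xL : x \in L.
Variable r : nat.
Definition far : set (config R d) := [set eta | exists y, [/\ y \in L, y \notin ldball x r &
  (0 < toppling_count gamma [set` L] (addp eta x) y)%N]].

Let energy eta : R := \sum_(y <- L) weight y * eta y.

Let energy_le eta : rec_configs gamma L eta ->
  energy (add_in gamma L x eta) + gamma / 2 * rho ^+ r * \1_far eta <= energy eta + 1.
Proof.
move=> re.
pose u y : R := (toppling_count gamma [set` L] (addp eta x) y)%:R.
have uL y : y \notin L -> u y = 0.
  by move=> yL; rewrite /u toppling_count_supp //= => yL'; rewrite yL' in yL.
have -> : energy (add_in gamma L x eta) = energy eta + 1 - \sum_(y <- L) weight y * lap gamma u y.
  have -> : 1 = \sum_(y <- L) weight y * (y == x)%:R.
    rewrite (big_fsetD1 x) //= eqxx mulr1 /weight ldistxx expr0.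
    rewrite big1_seq ?addr0 // => y /andP[_]; rewrite !inE => /andP[/negbTE -> _].
    by rewrite mulr0.
  rewrite -big_split -sumrB /=; apply: eq_big_seq => y yL.
  by rewrite /add_in yL /stab /ht /addp -mulrDr -mulrBr.
have u0 y : 0 <= u y by [].
have := sum_weight_lap u0 uL.
suff : rho ^+ r * \1_far eta <= \sum_(y <- L) weight y * u y.
  by move=> /(ler_wpM2l (ltW (divr_gt0 gamma_gt0 (ltr0n _ 2)))); rewrite mulrA; lra.
rewrite indicE; have [[y [yL yr uy]]|nf] := pselect (far eta); last first.
  by rewrite memNset // mulr0; apply: sumr_ge0 => y _; rewrite mulr_ge0.
rewrite mem_set //; last by exists y.
rewrite mulr1 (big_fsetD1 y) //= -[leLHS]addr0 lerD //; last first.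
  by apply: sumr_ge0 => z _; rewrite mulr_ge0.
rewrite -[leLHS]mulr1 ler_pM // ?exprn_ge0 ?(le_trans ler01) //; last by rewrite /u ler1n.
rewrite /weight ler_weXn2l // ltnW // ltnNge; apply/negP => /ldballP xy.
by rewrite xy in yr.
Qed.

Lemma measurable_far : measurable far.
Proof.
rewrite (_ : far = \bigcup_(y in [set` (L `\` ldball x r)%fset])
   ((fun eta => toppling_count gamma [set` L] (addp eta x) y) @^-1` [set k | 0 < k]%N)).
  apply: fin_bigcup_measurable; first exact: finite_fset.
  move=> y _; rewrite -[X in measurable X]setTI.
  exact: (measurableT_comp (measurable_toppling_count gamma _ y) (measurable_shift _)).
apply/seteqP; split=> eta.
  by move=> [y [yL yB uy]]; exists y => //; rewrite /= !inE yL yB.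
by move=> [y /=]; rewrite !inE => /andP[yB yL] uy; exists y.
Qed.

Let measurable_energy : measurable_fun setT energy.
Proof.
apply: measurable_sum => y; apply: measurable_funM => //; exact: measurable_coord.
Qed.

(* Every toppling lowers the weighted mass, by at least gamma / 2 times the weight
   of the site, and the added particle has weight 1; as the mean weighted mass is
   invariant, distant topplings are unlikely. *)
Lemma pL_far : pL L far <= 2 / gamma / rho ^+ r.
Proof.
have mR := @measurable_rec_configs R d gamma L.
have ma := @measurable_add_in R d gamma L x.
have mfar := measurable_far.
have e0 eta : rec_configs gamma L eta -> 0 <= energy eta.
  by move=> re; apply: sumr_ge0 => y _; rewrite mulr_ge0 // (rec_ge0 _ re).
pose I := (\int[lebR L]_(eta in rec_configs gamma L) (energy eta)%:E)%E.
have mE : measurable_fun setT (fun eta => (energy eta)%:E) by apply/measurable_EFinP.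
have ma_rec : measurable (add_in gamma L x @^-1` rec_configs gamma L).
  by rewrite -[X in measurable X]setTI; exact: ma.
have mEa : measurable_fun setT (fun eta => (energy (add_in gamma L x eta))%:E).
  exact: (measurableT_comp mE ma).
(* In terms of this restricted measure, [leb_add_in] says that M is its own image under the addition
   operator; the mean energy is therefore unchanged by an addition. *)
pose M : {measure set (config R d) -> \bar R} := mrestr (lebR L) mR.
have ML (f : config R d -> \bar R) : (\int[M]_(eta in rec_configs gamma L) f eta =
    \int[lebR L]_(eta in rec_configs gamma L) f eta)%E.
  apply: eq_measure_integral => A mA AR.
  by rewrite /M /= /mrestr; congr (leb_config L _); apply/setIidl.
have Ia : (\int[lebR L]_(eta in rec_configs gamma L) (energy (add_in gamma L x eta))%:E)%E = I.
  rewrite /I -!ML.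
  transitivity (\int[pushforward M (add_in gamma L x)]_(eta in rec_configs gamma L)
      (energy eta)%:E)%E; last first.
    apply: eq_measure_integral => A mA AR.
    have := leb_add_in gamma_gt0 L x mA.
    by rewrite setIC [X in _ = leb_config L X]setIC.
  rewrite ge0_integral_pushforward //; first last.
  - by move=> eta /[!inE] re; rewrite lee_fin e0.
  - exact: measurable_funS mE.
  rewrite [RHS](ge0_negligible_integral (N := ~` rec_configs gamma L)) //; last first.
  - by rewrite /M /= /mrestr setICl measure0.
  - by move=> eta re; rewrite lee_fin e0.
  - exact: measurable_funS mEa.
  - exact: measurableC.
  rewrite (_ : _ `\` _ = rec_configs gamma L) //; apply/seteqP; split=> eta.
    by move=> [_ /contrapT].
  by move=> re; split; [exact: add_in_rec|move=> /(_ re)].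
(* Finiteness of the mean energy, from heights below h on a set of finite measure, permits
   cancelling it from the balance. *)
have If : I \is a fin_num.
  rewrite ge0_fin_numE; last by apply: integral_ge0 => eta re; rewrite lee_fin e0.
  have EM eta : rec_configs gamma L eta -> energy eta <= energy (fun=> h).
    move=> re; apply: ler_sum => y _; rewrite ler_wpM2l // ltW //; exact: rec_lt re.
  apply: (@le_lt_trans _ _ (\int[lebR L]_(eta in rec_configs gamma L) (cst (energy (fun=> h))%:E eta))%E).
    apply: ge0_le_integral => //.
    + exact: measurable_funS mE.
  rewrite integral_cst //; apply: lte_mul_pinfty => //; last exact: leb_rec_lty.
  by rewrite lee_fin; apply: sumr_ge0 => y _; rewrite mulr_ge0 // ltW // h_gt0.
have r0 : 0 < rho ^+ r by rewrite exprn_gt0 // (lt_le_trans ltr01).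
have c0 : 0 <= gamma / 2 * rho ^+ r by rewrite mulr_ge0 ?divr_ge0 // ltW.
have : (I + (gamma / 2 * rho ^+ r)%:E * lebR L (rec_configs gamma L `&` far) <=
    I + lebR L (rec_configs gamma L))%E.
  have -> : lebR L (rec_configs gamma L `&` far) =
      (\int[lebR L]_(eta in rec_configs gamma L) (\1_far eta)%:E)%E.
    by rewrite integral_indic // setIC.
  rewrite -{1}Ia -ge0_integralZl //; first last.
  - exact/measurable_EFinP.
  rewrite -ge0_integralD //; first last.
  - by apply/measurable_EFinP; apply: measurable_funM.
  - by move=> eta _; rewrite lee_fin mulr_ge0 // indicE.
  - exact: measurable_funS mEa.
  - by move=> eta re; rewrite lee_fin e0 //; exact: add_in_rec.
  rewrite -[X in (_ <= _ + X)%E]mul1e -[X in (_ <= _ + X)%E](@integral_cst _ _ _ (lebR L) _ mR 1%E).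
  rewrite -ge0_integralD //; first last.
  - exact: measurable_funS mE.
  apply: ge0_le_integral => //.
  - move=> eta re; rewrite adde_ge0 // lee_fin ?e0 //; first exact: add_in_rec.
    by rewrite mulr_ge0 // indicE.
  - apply: emeasurable_funD; first exact: measurable_funS mEa.
    by apply/measurable_EFinP; apply: measurable_funM.
  - by apply: emeasurable_funD => //; exact: measurable_funS mE.
rewrite leeD2lE // => le.
have := pL_fin L measurable_far; have := pL_fin L measurableT; rewrite setIT.
have := measure_ge0 (lebR L) (rec_configs gamma L); move: le; rewrite /pL /lebR /=.
case: (leb_config L (rec_configs gamma L)) => // b.
case: (leb_config L _) => // a; rewrite -EFinM !lee_fin /= => ab b0 _ _.
have [->|bn0] := eqVneq b 0; first by rewrite invr0 mulr0 !divr_ge0 // ltW.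
have bp : 0 < b by rewrite lt_def bn0.
rewrite ler_pdivrMr // -ler_pdivrMl ?divr_gt0 // invf_div [X in X * a]mulrC invf_div.
exact: ab.
Qed.

End weights.

(** These sets form a pi-system that generates the sigma-algebra, and they use the same kind of
    comparison as [unstable], so that preimages under confined avalanches are again grid sets. *)
Definition orthant l : set (config R d) := [set eta | forall p, p \in l -> p.2 <= eta p.1].

Lemma measurable_orthant l : measurable (orthant l).
Proof.
rewrite (_ : orthant l =
    \bigcap_(p in [set` l]) (fun eta : config R d => eta p.1 : R) @^-1` `[p.2, +oo[).
  apply: fin_bigcap_measurable; first exact: finite_seq.
  by move=> p _; rewrite -[X in measurable X]setTI; exact: measurable_coord.
apply/seteqP; split=> eta H p pl; first by rewrite /= in_itv /= andbT; exact: H.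
by have := H p pl; rewrite /= in_itv /= andbT.
Qed.

Lemma measurable_configE : @measurable _ (config R d) = <<s [set orthant l | l in setT] >>.
Proof.
apply/seteqP; split; last first.
  apply: smallest_sub; first exact: (sigma_algebra_measurable (config R d)).
  by move=> _ [l _ <-]; exact: measurable_orthant.
apply: smallest_sub; first exact: smallest_sigma_algebra.
move=> _ [x _ [B mB <-]].
pose T := g_sigma_algebraType [set orthant l | l in setT].
have mx : measurable_fun setT ((fun eta => eta x) : T -> R).
  apply: (@measurability _ _ T R setT _ (@RGenCInfty.G R)).
    exact: RGenCInfty.measurableE.
  move=> _ [_ [c ->] <-]; apply: sub_sigma_algebra; exists [:: (x, c)] => //.
  apply/seteqP; split=> eta.
    move=> H; split=> //=; rewrite in_itv /= andbT.
    by apply: (H (x, c)); rewrite mem_head.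
  by move=> [_ /=]; rewrite in_itv /= andbT => H p; rewrite inE => /eqP ->.
exact: mx.
Qed.

Lemma grid_orthant l : grid_set l (orthant l).
Proof. by move=> eta eta' _ _ same C p pl; rewrite -same //; exact: C. Qed.

Section local_addition.
Variables (B : {fset site d}) (x : site d) (l : seq (site d * R)).

(** After one addition the heights are below h + 1, so no site topples more than M times, and the
    neighbours of a site send it at most 2d M particles. This keeps the list of thresholds
    finite. *)
Let M := Num.truncn ((h + 1) / gamma).
Let ys := enum_fset B ++ [seq p.1 | p <- l].
Let ts := h :: [seq p.2 | p <- l].

(* The finitely many comparisons that decide the avalanche inside B started by
   adding a particle at x, and the membership of the outcome in orthant l. *)
Let thresholds : seq (site d * R) :=
  [seq (yt.1, yt.2 - (yt.1 == x)%:R + (h * (ij.1)%:R - (ij.2)%:R)) |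
    yt <- [seq (y, t) | y <- ys, t <- ts],
    ij <- [seq (i, j) | i <- iota 0 M.+1, j <- iota 0 (2 * d * M).+1]].

Section same.
Variables eta eta' : config R d.
Hypotheses (st : stable_configs gamma eta) (st' : stable_configs gamma eta').
Hypothesis same : forall p, p \in thresholds -> (p.2 <= eta p.1) = (p.2 <= eta' p.1).

(** Comparing the height after the topplings with t amounts to comparing the initial height with t
    shifted by an amount depending only on the topplings of y and on the total over its
    neighbours. *)
Let same_ht (c : site d -> nat) y t : (forall z, (c z <= M)%N) ->
  y \in ys -> t \in ts ->
  (t <= ht gamma (addp eta x) c y) = (t <= ht gamma (addp eta' x) c y).
Proof.
move=> cM yy tt.
have e (zeta : config R d) : (t <= ht gamma (addp zeta x) c y) =
    (t - (y == x)%:R + (h * (c y)%:R - (\sum_(z <- nbr y) c z)%N%:R) <= zeta y).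
  by rewrite /ht /addp /lap natr_sum; apply/idP/idP; lra.
rewrite !e; have /= := same (p := (y, t - (y == x)%:R + (h * (c y)%:R - (\sum_(z <- nbr y) c z)%N%:R))).
apply; apply: (allpairs_f _ (x := (y, t)) (y := (c y, (\sum_(z <- nbr y) c z)%N))).
  exact: (allpairs_f pair).
apply: (allpairs_f pair); rewrite mem_iota /= add0n ltnS //.
apply: (@leq_trans (\sum_(z <- nbr y) M)%N); first exact: leq_sum.
by rewrite big_const_seq iter_addn_0 count_predT mulnC leq_mul2r card_nbr orbT.
Qed.

Let cntM (zeta : config R d) lst : stable_configs gamma zeta ->
  legal_list gamma [set` B] (addp zeta x) lst -> forall z, (cnt lst z <= M)%N.
Proof.
move=> zst ll z; have zh y : zeta y < h by case/andP: (zst y).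
apply: leq_trans (toppling_count_ub (finite_topplings_addp gamma_gt0 [set` B] x zh) ll z) _.
have hg : 0 <= (h + 1) / gamma by rewrite divr_ge0 ?addr_ge0 // ltW // h_gt0.
rewrite /M truncn_ge_nat //; apply: toppling_count_bounded => //.
  by rewrite addr_ge0 // ltW // h_gt0.
by move=> y _; rewrite /addp lerD //; [exact: ltW|case: (y == x)].
Qed.

Let legal_list_same lst : legal_list gamma [set` B] (addp eta x) lst <-> legal_list gamma [set` B] (addp eta' x) lst.
Proof.
elim: lst => //= y lst IH; split=> -[yB hy ll]; split=> //; try exact/IH.
  by rewrite -same_ht //; [exact: cntM ll|rewrite mem_cat yB|rewrite mem_head].
by rewrite same_ht //; [exact: cntM ll|rewrite mem_cat yB|rewrite mem_head].
Qed.

Lemma toppling_count_same : toppling_count gamma [set` B] (addp eta x) = toppling_count gamma [set` B] (addp eta' x).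
Proof.
apply/funext => y; rewrite /toppling_count; congr xget; apply/seteqP.
by split=> n [[lst ll <-] ub]; split=> [|lst' /legal_list_same /ub //]; exists lst => //; exact/legal_list_same.
Qed.

Lemma stab_same p : p \in l -> p.2 <= stab gamma [set` B] (addp eta x) p.1 ->
  p.2 <= stab gamma [set` B] (addp eta' x) p.1.
Proof.
move=> pl; rewrite /stab -toppling_count_same same_ht //.
- move=> z; have eh y : eta y < h by case/andP: (st y).
  by have [M' /toppling_countP[[lst ll <-] _]] := finite_topplings_addp gamma_gt0 [set` B] x eh z; exact: cntM ll z.
- by rewrite mem_cat map_f ?orbT.
- by rewrite inE map_f ?orbT.
Qed.

End same.

Lemma grid_local_addition :
  grid_set thresholds ((fun eta => stab gamma [set` B] (addp eta x)) @^-1` orthant l).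
Proof. by move=> eta eta' st st' same C p pl; apply: stab_same => //; exact: C. Qed.

End local_addition.

Lemma local_addition_far L B x l eta : fsubset B L -> (forall p, p \in l -> p.1 \in L) ->
  (forall y, eta y < h) ->
  (forall y, y \in L -> y \notin B -> toppling_count gamma [set` L] (addp eta x) y = 0%N) ->
  orthant l (stab gamma [set` B] (addp eta x)) <-> orthant l (add_in gamma L x eta).
Proof.
move=> /fsubsetP BL lL eh nofar.
have bL := finite_topplings_addp gamma_gt0 [set` L] x eh.
have e : toppling_count gamma [set` B] (addp eta x) = toppling_count gamma [set` L] (addp eta x).
  apply/funext => y; apply/eqP; rewrite eqn_leq.
  rewrite (toppling_count_le (L := [set` B]) (L' := [set` L]) BL (fun _ _ => lexx _) bL y) /=.
  have [M /toppling_countP[[lst ll <-] _]] := bL y.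
  apply: toppling_count_ub; first exact: finite_topplings_addp.
  apply: (legal_list_congr ll) => // z zl; apply: contrapT => /negP zB.
  have := toppling_count_ub bL ll z; rewrite nofar //; last exact: legal_list_mem ll zl.
  by rewrite leqn0 => /eqP/count_memPn /negP.
by split=> C p pl; have := C p pl; rewrite /add_in lL // /stab e.
Qed.

(** * Invariance of the weak limit under additions *)

Section weak_limit.
Variable m : probability (config R d) R.
Hypothesis m_lim : is_sandpile_measure gamma m.

Local Notation S := (@stable_configs R d gamma).

Let mS : measurable S := @measurable_stable_configs R d gamma.

Let Sfin : (m S < +oo)%E. Proof. by rewrite m_lim.1 ltry. Qed.

Let sandwich (A B : set (config R d)) (f : config R d -> R) :
  measurable A -> measurable B -> measurable_fun setT f ->
  (forall eta, \1_A eta <= f eta <= \1_B eta) ->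
  fine (m A) <= \int[m]_(eta in S) f eta <= fine (m B).
Proof.
move=> mA mB mf AfB; rewrite -(probability1_setI mS m_lim.1 mA) -(probability1_setI mS m_lim.1 mB).
rewrite ![_ `&` S]setIC; apply: sandwich_Rintegral => //.
by apply: measurable_funS mf.
Qed.

Let away_bounds (e : R) l eta : 0 < e ->
  \1_(near_grid e l) eta <= 1 - away e l eta <= \1_(near_grid (2 * e) l) eta.
Proof.
move=> e0; have /andP[a0 a1] := away_itv e l eta; rewrite !indicE; apply/andP; split.
  have [ne|ne] := pselect (near_grid e l eta).
    by rewrite mem_set // away_near // subr0.
  by rewrite memNset // subr_ge0.
have [ne|ne] := pselect (near_grid (2 * e) l eta).
  by rewrite mem_set // lerBlDr lerDl.
by rewrite memNset // away_far // subrr.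
Qed.

(** Half of gamma / k: the cutoff at scale e is controlled by neighbourhoods of radius 2 e, and
    [pL_near_grid] treats the radius gamma / k. *)
Let ek (k : nat) : R := gamma / (2 * k)%:R.

Let ek2 k : (0 < k)%N -> 2 * ek k = gamma / k%:R.
Proof.
move=> k0; have k1 : k%:R != 0 :> R by rewrite pnatr_eq0 -lt0n.
by rewrite /ek natrM; field.
Qed.

Let ek0 k : (0 < k)%N -> 0 < ek k.
Proof. by move=> k0; rewrite divr_gt0 // ltr0n muln_gt0. Qed.

Let contains l : \forall L \near @finite_sets_up (site d), forall p, p \in l -> p.1 \in L.
Proof.
exists [fset y in [seq p.1 | p <- l]]%fset => //= L /fsubsetP lL p pl.
by apply: lL; rewrite in_fset /=; apply: map_f.
Qed.

(** The finite-volume bound passes to m through the continuous function 1 - [away], which lies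
    between the indicators of two neighbourhoods. *)
Let m_near_grid l k : (0 < k)%N ->
  fine (m (near_grid (ek k) l)) <= (size l)%:R * (2 * k%:R^-1).
Proof.
move=> k0.
have mf : measurable_fun setT (fun eta => 1 - away (ek k) l eta).
  by apply: measurable_funB => //; exact: measurable_away.
have mn e : measurable (near_grid e l) by exact: measurable_near_grid.
have cv := m_lim.2 (fun eta => 1 - away (ek k) l eta).
apply: (@le_trans _ _ (\int[m]_(eta in S) (1 - away (ek k) l eta))).
  have /andP[] := sandwich (mn (ek k)) (mn (2 * ek k)) mf
    (fun eta => away_bounds l eta (ek0 k0)).
  by [].
apply: (cvgr_to_le (cv _ _)).
- apply: (@continuous_subspaceT (config R d) R).
  apply: (@continuousB1 R (config R d)); exact: continuous_away.
- exists 1 => eta _; have /andP[a0 a1] := away_itv (ek k) l eta.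
  by rewrite ger0_norm ?subr_ge0 // lerBlDr lerDl.
apply: filterS (contains l) => L lL.
have /andP[_ le2] := mean_allowed_pL L (mn (ek k)) (mn (2 * ek k)) mf
    (fun eta => away_bounds l eta (ek0 k0)).
apply: le_trans le2 _; rewrite ek2 //.
exact: pL_near_grid.
Qed.

(* Away from the thresholds the indicator of G is continuous; near them the mass is
   small by [thin]. *)
Lemma grid_cvg l (G : set (config R d)) : measurable G -> grid_set l G ->
  pL L G @[L --> @finite_sets_up (site d)] --> fine (m G).
Proof.
move=> mG gG; apply/cvgrPdist_le => eps eps0.
pose k := (Num.truncn ((size l)%:R * 4 / eps)).+1.
have k0 : (0 < k)%N by [].
have Ck : (size l)%:R * (2 * k%:R^-1) <= eps / 2.
  have : (size l)%:R * 4 / eps < k%:R by exact: truncnS_gt.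
  rewrite ltr_pdivrMr // => lt; rewrite mulrA ler_pdivrMr ?ltr0n //; nra.
have k2 : (0 < 2 * k)%N by rewrite muln_gt0.
(* At this scale the cutoff equals 1 off B, since 2 ek (2 k) = ek k. Hence f lies between the
   indicators of G minus B and of G, for m as for m_L. *)
pose f eta := \1_G eta * away (ek (2 * k)) l eta.
pose B := near_grid (ek k) l.
have mB : measurable B by exact: measurable_near_grid.
have mGB : measurable (G `\` B) by exact: measurableD.
have mf : measurable_fun setT f.
  by apply: measurable_funM => //; exact: measurable_away.
have fB eta : \1_(G `\` B) eta <= f eta <= \1_G eta.
  have /andP[a0 a1] := away_itv (ek (2 * k)) l eta.
  rewrite /f !indicE in_setD; case: (eta \in G) => /=; last by rewrite mul0r lexx.
  rewrite mul1r a1 andbT; have [inB|nB] := pselect (B eta).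
    by rewrite mem_set.
  by rewrite memNset //= away_far ?ek0 // ek2.
have cv : mean_allowed gamma L f @[L --> @finite_sets_up (site d)] -->
    (\int[m]_(eta in S) f eta).
  apply: m_lim.2; first by apply: continuous_grid => //; exact: ek0.
  exists 1 => eta _; have /andP[f0 f1] := fB eta.
  rewrite ger0_norm; last by apply: le_trans f0; rewrite indicE.
  by apply: le_trans f1 _; rewrite indicE; case: (_ \in _).
have eps4 : 0 < eps / 2 by rewrite divr_gt0.
move/cvgrPdist_le: cv => /(_ _ eps4) near_f.
have /andP[m1 m2] := sandwich mGB mG mf fB.
have m3 : fine (m G) <= fine (m (G `\` B)) + fine (m B).
  rewrite -fineD ?fin_num_measure // fine_le ?fin_numD ?fin_num_measure //.
  apply: le_trans (measureU2 _ _ _) => //; rewrite le_measure ?inE //.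
    exact: measurableU.
  by move=> eta Ge; have [Be|Be] := pselect (B eta); [right|left].
have mBk := m_near_grid l k0.
apply: filterS2 near_f (contains l) => L fL lL.
have /andP[p1 p2] := mean_allowed_pL L mGB mG mf fB.
have p3 : pL L G <= pL L (G `\` B) + pL L B.
  apply: le_trans (pLU L mGB mB); apply: pL_le => //; first exact: measurableU.
  by move=> eta Ge; have [Be|Be] := pselect (B eta); [right|left].
have p4 : pL L B <= eps / 2.
  apply: le_trans Ck; apply: le_trans (pL_near_grid k2 lL) _.
  rewrite ler_wpM2l // ler_wpM2l // lef_pV2 ?posrE ?ltr0n // ler_nat.
  by rewrite leq_pmull.
move: fL; rewrite !ler_distl => /andP[f1 f2]; apply/andP; split; rewrite /B in mBk *; lra.
Qed.

Lemma orthant_invariant (f : config R d -> config R d) : measurable_fun setT f ->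
  (forall l, m (f @^-1` orthant l) = m (orthant l)) ->
  forall A, measurable A -> m (f @^-1` A) = m A.
Proof.
move=> mf fm A mA; change (pushforward m f A = m A).
apply: (measure_unique [set orthant l | l in setT] (fun=> setT)) => //.
- exact: measurable_configE.
- move=> _ _ [l _ <-] [l' _ <-]; exists (l ++ l') => //.
  apply/seteqP; split=> eta.
    by move=> H; split=> p pl; apply: H; rewrite mem_cat pl ?orbT.
  by move=> [H H'] p; rewrite mem_cat => /orP[/H|/H'].
- by move=> _; exists [::] => //; apply/seteqP; split=> // eta _ p.
- by rewrite bigcup_const //; exists 0%N.
- by move=> _ [l _ <-]; exact: fm.
- by move=> _; rewrite /= /pushforward preimage_setT probability_setT ltry.
Qed.

Section addition.
Hypothesis d_gt0 : (0 < d)%N.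
Variable x : site d.

Let local r eta := stab gamma [set` ldball x r] (addp eta x).

Let measurable_local r : measurable_fun setT (local r).
Proof. exact: (measurableT_comp (measurable_stab gamma _) (measurable_shift _)). Qed.

Let measurable_pre r l : measurable (local r @^-1` orthant l).
Proof.
rewrite -[X in measurable X]setTI; apply: measurable_local => //.
exact: measurable_orthant.
Qed.

(** For fixed r and large L, [add_in L x] preserves m_L and gives the same outcome on l as [local r]
    off the event [far]. Both events are grid sets, so the bound of [pL_far] survives the limit in
    L. *)
Let local_orthant r l :
  `|fine (m (local r @^-1` orthant l)) - fine (m (orthant l))| <= 2 / gamma / rho ^+ r.
Proof.
have cv : pL L (local r @^-1` orthant l) - pL L (orthant l)
    @[L --> @finite_sets_up (site d)] -->
    fine (m (local r @^-1` orthant l)) - fine (m (orthant l)).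
  apply: cvgB; last exact: (grid_cvg (measurable_orthant l) (@grid_orthant l)).
  exact: (grid_cvg (measurable_pre r l) (@grid_local_addition (ldball x r) x l)).
apply: (@cvgr_to_le _ _ _ _ _ _ _ (cvg_norm cv)).
have near_ball : \forall L \near @finite_sets_up (site d), fsubset (ldball x r) L.
  by exists (ldball x r).
have near_x : \forall L \near @finite_sets_up (site d), x \in L.
  by exists [fset x]%fset => //= L /fsubsetP; apply; rewrite inE.
apply: filterS3 near_ball near_x (contains l) => L BL xL lL.
have mR := @measurable_rec_configs R d gamma L.
have mO := measurable_orthant l.
have pfar := pL_far d_gt0 xL r.
have mfar := measurable_far L x r.
have addE : pL L (add_in gamma L x @^-1` orthant l) = pL L (orthant l).
  by rewrite /pL leb_add_in.
have mpre : measurable (add_in gamma L x @^-1` orthant l).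
  by rewrite -[X in measurable X]setTI; exact: measurable_add_in.
have same eta : rec_configs gamma L eta -> ~ far L x r eta ->
    orthant l (local r eta) <-> orthant l (add_in gamma L x eta).
  move=> re nfar; apply: local_addition_far => // [y|y yL yB]; first exact: rec_lt re.
  apply/eqP; rewrite -leqn0 leqNgt; apply/negP => uy; apply: nfar.
  by exists y.
have le1 : pL L (local r @^-1` orthant l) <= pL L (add_in gamma L x @^-1` orthant l) + pL L (far L x r).
  apply: pL_le_union => // eta re; have [?|nf] := pselect (far L x r eta); first by right.
  by move=> /(same _ re nf); left.
have le2 : pL L (add_in gamma L x @^-1` orthant l) <= pL L (local r @^-1` orthant l) + pL L (far L x r).
  apply: pL_le_union => // eta re; have [?|nf] := pselect (far L x r eta); first by right.
  by move=> /(same _ re nf); left.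
rewrite -addE ler_norml; apply/andP; split; lra.
Qed.

Let whole eta := stab gamma setT (addp eta x).

Let measurable_whole : measurable_fun setT whole.
Proof. exact: (measurableT_comp (measurable_stab gamma _) (measurable_shift _)). Qed.

Let local_whole l eta : S eta ->
  \forall r \near \oo, (local r @^-1` orthant l) eta <-> (whole @^-1` orthant l) eta.
Proof.
move=> st; have eh y : eta y < h by case/andP: (st y).
have b := finite_topplings_addp gamma_gt0 setT x eh.
suff same y : \forall r \near \oo, local r eta y = whole eta y.
  have all_same : \forall r \near \oo, forall p, p \in l -> local r eta p.1 = whole eta p.1.
    elim: l => [|p l IH]; first by apply: nearW => ? ?; rewrite in_nil.
    apply: filterS2 IH (same p.1) => r IH rp q.
    by rewrite inE => /orP[/eqP ->|/IH].
  by apply: filterS all_same => r e; split=> C p pl; have := C p pl; rewrite /= e.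
have [lst ll lE] := toppling_count_attained gamma_gt0 (y :: nbr y) b.
exists (\max_(z <- lst) ldist x z)%N => // r /= le.
apply: (stab_attained _ _ _ _ _ lE) => //.
apply: (legal_list_congr ll) => // z zl; apply: ldballP.
by apply: leq_trans le; rewrite (big_rem z) //= leq_maxl.
Qed.

(** As r grows, the confined outcome becomes the full one on the sites of l, and the error in
    [local_orthant] tends to 0 because rho > 1. *)
Let whole_orthant l : m (whole @^-1` orthant l) = m (orthant l).
Proof.
have mO := measurable_orthant l.
have mw : measurable (whole @^-1` orthant l).
  by rewrite -[X in measurable X]setTI; exact: measurable_whole.
have cv := eventually_cvg_probability mS m_lim.1 mw (fun r => measurable_pre r l)
  (@local_whole l).
have cvf : fine (m (local r @^-1` orthant l)) @[r --> \oo] --> fine (m (whole @^-1` orthant l)).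
  by apply: fine_cvg; rewrite fineK ?fin_num_measure.
have cv0 : fine (m (local r @^-1` orthant l)) @[r --> \oo] --> fine (m (orthant l)).
  apply/cvgrPdist_le => e e0.
  have : (2 / gamma) * (rho^-1 ^+ r) @[r --> \oo] --> (2 / gamma) * 0.
    apply: cvgM; first exact: cvg_cst.
    apply: cvg_expr; rewrite ger0_norm; last by rewrite invr_ge0 addr_ge0 // divr_ge0 // ltW.
    rewrite invf_lt1 ?ltrDl ?divr_gt0 ?ltr0n ?muln_gt0 //.
    by rewrite addr_gt0 // divr_gt0 // ltr0n muln_gt0.
  rewrite mulr0 => /cvgrPdist_le /(_ e e0); apply: filterS => r.
  rewrite sub0r normrN => le; rewrite distrC; apply: le_trans (local_orthant r l) _.
  by apply: le_trans le; rewrite exprVn; exact: ler_norm.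
have e : fine (m (whole @^-1` orthant l)) = fine (m (orthant l)) := cvg_unique (@Rhausdorff R) cvf cv0.
by rewrite -[LHS]fineK ?fin_num_measure // e fineK // fin_num_measure.
Qed.

Lemma addition_invariant (A : set (config R d)) : measurable A ->
  m (addition_op gamma x @^-1` A) = m A.
Proof.
have -> : addition_op gamma x = whole.
  by apply/funext => eta; rewrite /addition_op stabilizationE.
exact: orthant_invariant.
Qed.

Lemma measurable_addition_op : measurable_fun setT (addition_op gamma x : config R d -> config R d).
Proof.
have -> : addition_op gamma x = whole.
  by apply/funext => eta; rewrite /addition_op stabilizationE.
exact: measurable_whole.
Qed.

End addition.

Hypothesis d_gt0 : (0 < d)%N.

Let measurable_ops V n : measurable_fun setT (addition_ops gamma V n : config R d -> config R d).
Proof.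
rewrite /addition_ops; elim: (enum_fset V) => [|x s IH]; rewrite ?big_nil ?big_cons //.
apply: (measurableT_comp _ IH) => //; apply: measurable_iter.
exact: measurable_addition_op.
Qed.

Let ops_invariant V n (A : set (config R d)) : measurable A ->
  m (addition_ops gamma V n @^-1` A) = m A.
Proof.
rewrite /addition_ops; elim: (enum_fset V) A => [|x s IH] A mA; rewrite ?big_nil ?big_cons //.
have mop := measurable_addition_op x.
rewrite comp_preimage IH; last first.
  by rewrite -[X in measurable X]setTI; exact: measurable_iter.
elim: (n x) A mA => // k IHk A mA.
have -> : iter k.+1 (addition_op gamma x) @^-1` A =
    iter k (addition_op gamma x) @^-1` (addition_op gamma x @^-1` A) by [].
rewrite IHk; first exact: addition_invariant.
by rewrite -[X in measurable X]setTI; exact: mop.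
Qed.

(** The height h dominates all stable configurations, so eta + n is stabilizable for every stable
    eta. The products of addition operators over growing cubes each preserve m and are eventually
    equal, at each site, to the full stabilization. *)
Lemma particles_invariant (n : site d -> nat) : finite_topplings gamma setT (fun y => h + (n y)%:R) ->
  forall A, measurable A -> m [set eta | A (stab gamma setT (add_particles eta n))] = m A.
Proof.
move=> b.
have mf : measurable_fun setT ((fun eta => stab gamma setT (add_particles eta n)) : config R d -> config R d).
  exact: (measurableT_comp (measurable_stab gamma _) (measurable_shift _)).
apply: (orthant_invariant mf) => l.
have mO := measurable_orthant l.
have mpre (f : config R d -> config R d) : measurable_fun setT f -> measurable (f @^-1` orthant l).
  by move=> mf'; rewrite -[X in measurable X]setTI; exact: mf'.
have ev eta : S eta -> \forall k \near \oo,
    (addition_ops gamma (ldball 0 k) n @^-1` orthant l) eta <->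
    ((fun eta => stab gamma setT (add_particles eta n)) @^-1` orthant l) eta.
  move=> st.
  have be : finite_topplings gamma setT (add_particles eta n).
    by apply: finite_topplings_congr b => // y _; rewrite lerD2r ltW //; case/andP: (st y).
  have same y : \forall k \near \oo,
      addition_ops gamma (ldball 0 k) n eta y = stab gamma setT (add_particles eta n) y.
    have [F _ FE] := addition_ops_near gamma_gt0 st be y.
    exists (\max_(z <- F) ldist 0%R z)%N => // k /= le; apply: FE => /=.
    apply/fsubsetP => z zF; apply: ldballP; apply: leq_trans le.
    by rewrite (big_rem z) //= leq_maxl.
  have all_same : \forall k \near \oo, forall p, p \in l ->
      addition_ops gamma (ldball 0 k) n eta p.1 = stab gamma setT (add_particles eta n) p.1.
    elim: l {mO mpre} => [|p l IH]; first by apply: nearW => ? ?; rewrite in_nil.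
    apply: filterS2 IH (same p.1) => k IH kp q.
    by rewrite inE => /orP[/eqP ->|/IH].
  by apply: filterS all_same => k e; split=> C p pl; have := C p pl; rewrite /= e.
have cv := eventually_cvg_probability mS m_lim.1 (mpre _ mf)
  (fun k => mpre _ (measurable_ops (ldball 0 k) n)) ev.
apply: cvg_unique cv _ => //.
rewrite (_ : (fun k => _) = fun=> m (orthant l)); first exact: cvg_cst.
by apply/funext => k; exact: ops_invariant.
Qed.

End weak_limit.

End grid.

(** * Almost sure stabilizability *)

Section potential.
Variables (R : realType) (d : nat) (gamma : R).
Hypothesis gamma_gt0 : 0 < gamma.
Implicit Types (x y z : site d) (eta : site d -> R).

Local Notation h := (height_bound d gamma).

(* Partial sums of the Neumann series for the Green function applied to eta. *)
Fixpoint neumann eta k x : R :=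
  if k is k'.+1 then (eta x + \sum_(z <- nbr x) neumann eta k' z) / h else 0.

Section nonneg.
Variable eta : site d -> R.
Hypothesis eta0 : forall x, 0 <= eta x.

Lemma neumann_ge0 k x : 0 <= neumann eta k x.
Proof.
elim: k x => //= k IH x; rewrite divr_ge0 ?(ltW (h_gt0 _ gamma_gt0)) // addr_ge0 //.
by apply: sumr_ge0.
Qed.

Lemma neumannS_le k x : neumann eta k x <= neumann eta k.+1 x.
Proof.
elim: k x => [|k IH] x; first exact: neumann_ge0.
rewrite /= ler_wpM2r ?invr_ge0 ?(ltW (h_gt0 _ gamma_gt0)) // lerD2l.
by apply: ler_sum => z _; exact: IH.
Qed.

Lemma neumann_potential : (forall x, exists b, forall k, neumann eta k x <= b) ->
  exists v, (forall x, 0 <= v x) /\ forall x, lap gamma v x = eta x.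
Proof.
move=> bv.
have cv x : cvgn (fun k => neumann eta k x).
  apply: nondecreasing_is_cvgn; first by apply/nondecreasing_seqP => k; exact: neumannS_le.
  by have [b bx] := bv x; exists b => _ [k _ <-]; exact: bx.
exists (fun x => limn (fun k => neumann eta k x)); split=> x.
  by apply: limr_ge => //; apply: nearW => k; exact: neumann_ge0.
have h0 : h != 0 by rewrite gt_eqF // h_gt0.
have cvS : neumann eta k.+1 x @[k --> \oo] --> limn (fun k => neumann eta k x).
  by rewrite (cvg_shiftS (fun k => neumann eta k x)); exact: cv.
have cv1 : (eta x + \sum_(z <- nbr x) neumann eta k z) / h @[k --> \oo] -->
    (eta x + \sum_(z <- nbr x) limn (fun k => neumann eta k z)) / h.
  apply: cvgM; last exact: cvg_cst.
  apply: cvgD; first exact: cvg_cst.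
  elim: (enum_fset (nbr x)) => [|z s IH].
    by rewrite big_nil (_ : (fun k => _) = fun=> 0); [exact: cvg_cst|apply/funext => k; rewrite big_nil].
  rewrite big_cons (_ : (fun k => _) = fun k => neumann eta k z + \sum_(j <- s) neumann eta k j).
    by apply: cvgD => //; exact: cv.
  by apply/funext => k; rewrite big_cons.
have e := cvg_unique (@Rhausdorff R) cvS cv1.
by rewrite /lap [X in h * X]e; field.
Qed.

End nonneg.

End potential.

Section poisson_mean.
Context (dT : measure_display) (T : measurableType dT) (R : realType).
Variable P : probability T R.

Lemma ae_measure_eq (A B : set T) : measurable A -> measurable B ->
  {ae P, forall w, A w <-> B w} -> P A = P B.
Proof.
move=> mA mB [Z [mZ Z0 AB]].
have ABZ w : ~ Z w -> A w <-> B w.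
  by move=> nZ; apply: contrapT => nAB; apply: nZ; exact: AB.
have le (A' B' : set T) : measurable A' -> measurable B' ->
    A' `<=` B' `|` Z -> (P A' <= P B')%E.
  move=> mA' mB' sub; rewrite -[leRHS]adde0 -Z0.
  apply: le_trans (measureU2 _ mB' mZ); rewrite le_measure ?inE //.
  exact: measurableU.
apply/eqP; rewrite eq_le !le // => w.
- by move=> Bw; have [?|/ABZ nZ] := pselect (Z w); [right|left; apply/nZ].
- by move=> Aw; have [?|/ABZ nZ] := pselect (Z w); [right|left; apply/nZ].
Qed.

Lemma measurable_eq_nat (X Y : T -> nat) : measurable_fun setT X ->
  measurable_fun setT Y -> measurable [set w | X w = Y w].
Proof.
move=> mX mY; rewrite (_ : mkset _ = (fun w => X w == Y w) @^-1` [set true]).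
  by rewrite -[X in measurable X]setTI; exact: (measurable_fun_eqn mX mY).
by apply/seteqP; split=> w /= /eqP.
Qed.

Lemma poisson_mean (X : T -> nat) (r : R) : 0 < r -> measurable_fun setT X ->
  (forall k, P [set w | X w = k] = (poisson_pmf r k)%:E) ->
  (\int[P]_w (X w)%:R%:E = r%:E)%E.
Proof.
move=> r0 mX XP.
have mXk k : measurable (X @^-1` [set k]).
  by rewrite -[X in measurable X]setTI; exact: mX.
have cover : \bigcup_k (X @^-1` [set k]) = setT.
  by apply/seteqP; split=> // w _; exists (X w).
rewrite -{1}cover ge0_integral_bigcup //; last 2 first.
- by rewrite cover; apply/measurable_EFinP; exact: measurable_natr.
- apply/trivIsetP => i j _ _ ij; apply/seteqP; split=> // w [/= -> ji].
  by rewrite ji eqxx in ij.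
have term k : (\int[P]_(w in X @^-1` [set k]) (X w)%:R%:E)%E = (k%:R * poisson_pmf r k)%:E.
  rewrite (eq_integral (cst k%:R%:E)) => [|w /[!inE] /= -> //].
  by rewrite integral_cst // EFinM -XP.
rewrite (eq_eseriesr (fun k _ => term k)).
rewrite (nneseries_recl _) //; last by move=> k; rewrite lee_fin mulr_ge0 // poisson_pmf_ge0.
rewrite mul0r add0e -(@nneseries_addn _ (fun k => (k%:R * poisson_pmf r k)%:E) 1%N); last first.
  by move=> k; rewrite lee_fin mulr_ge0 // poisson_pmf_ge0.
(* The factor k + 1 cancels against the factorial, so the mean is r times the total mass. *)
have termS k : (((k + 1)%N%:R * poisson_pmf r (k + 1))%:E = r%:E * (poisson_pmf r k)%:E)%E.
  rewrite addn1 -EFinM /poisson_pmf r0 factS exprS natrM; congr (_%:E).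
  have k0 : k.+1%:R != 0 :> R by rewrite pnatr_eq0.
  have f0 : k`!%:R != 0 :> R by rewrite pnatr_eq0 -lt0n fact_gt0.
  move: (k.+1%:R) k0 (k`!%:R) f0 => c c0 e f0.
  by field; rewrite c0 f0.
rewrite (eq_eseriesr (fun k _ => termS k)) nneseriesZl; last first.
  by move=> k _; rewrite lee_fin poisson_pmf_ge0.
have := @probability_setT _ _ _ (poisson_prob r 0%N); rewrite /= /poisson_prob r0.
rewrite -nneseries_esumT => [->|k]; first by rewrite mule1.
by rewrite lee_fin poisson_pmf_ge0.
Qed.

End poisson_mean.

Section stabilizable.
Variables (R : realType) (d : nat) (gamma : R).
Hypothesis gamma_gt0 : 0 < gamma.
Variables (phi : site d -> R).
Hypotheses (phi_gt0 : forall x, 0 < phi x).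
Hypothesis phi_bounded : exists M, forall x, phi x <= M.
Context (dT : measure_display) (T : measurableType dT) (P : probability T R).
Variable N : site d -> R -> T -> nat.
Hypothesis N_poisson : independent_poisson_processes P phi N.
Implicit Types (x y z : site d).

Local Notation h := (height_bound d gamma).

Lemma ae_all_sites (Q : site d -> T -> Prop) : (forall x, {ae P, forall w, Q x w}) ->
  {ae P, forall w, forall x, Q x w}.
Proof.
move=> aeQ.
pose Q' k w := if choice.unpickle k is Some x then Q x w else True.
have : {ae P, forall w, forall k, Q' k w}.
  apply: ae_foralln => k; rewrite /Q'; case: (choice.unpickle k) => [x|]; first exact: aeQ.
  by apply: aeW.
apply: filterS => w Qw x; have := Qw (choice.pickle x).
by rewrite /Q' choice.pickleK.
Qed.

Lemma ae_paths : {ae P, forall w, forall x, N x 0 w = 0%N /\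
  forall s t, 0 <= s -> s <= t -> (N x s w <= N x t w)%N}.
Proof.
apply: ae_all_sites => x; have := poisson_paths (N_poisson.1 x).
by apply: filterS => w [].
Qed.

Lemma measurable_N x t : 0 <= t -> measurable_fun setT (N x t).
Proof. exact: (poisson_measurable (N_poisson.1 x)). Qed.

Lemma measurable_N_level x t k : 0 <= t -> measurable [set w | N x t w = k].
Proof. move=> t0; rewrite (_ : mkset _ = N x t @^-1` [set k]) //.
by rewrite -[X in measurable X]setTI; exact: measurable_N. Qed.

Lemma N_mean x t : 0 < t -> (\int[P]_w (N x t w)%:R%:E = (phi x * t)%:E)%E.
Proof.
move=> t0; apply: poisson_mean => [||k]; first by rewrite mulr_gt0.
  by apply: measurable_N; exact: ltW.
have := poisson_increments (N_poisson.1 x) k (lexx 0) t0; rewrite subr0 => <-.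
have mN0 := measurable_N x (lexx 0); have mNt := measurable_N x (ltW t0).
apply: ae_measure_eq.
- exact: measurable_N_level (ltW t0).
- apply: measurable_eq_nat => //.
  exact: measurable_fun_addn mN0 (measurable_cst k).
- by apply: filterS ae_paths => w /(_ x) [e _] /=; rewrite e add0n.
Qed.

Section horizon.
Variable t : R.
Hypothesis t0 : 0 < t.

(** The source contains h in place of the initial configuration, so that the exceptional null set
    does not depend on the latter. *)
Let V k x w : R := neumann gamma (fun y => h + (N y t w)%:R) k x.

Let eta0 w x : 0 <= h + (N x t w)%:R.
Proof. by rewrite addr_ge0 // ltW // h_gt0. Qed.

Let measurable_V k x : measurable_fun setT (V k x).
Proof.
elim: k x => [|k IH] x; first exact: measurable_cst.
apply: measurable_funM => //; apply: measurable_funD.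
  apply: measurable_funD => //; apply: measurable_natr; apply: measurable_N; exact: ltW.
exact: measurable_sum.
Qed.

Let V_mean : exists C, forall k x, (\int[P]_w (V k x w)%:E <= C%:E)%E.
Proof.
have [M phiM] := phi_bounded.
have M0 : 0 <= M by apply: le_trans (phiM 0); exact: ltW.
(* C is the solution of h C = h + M t + 2d C. *)
set C := (h + M * t) / gamma; exists C.
have h0 := h_gt0 d gamma_gt0.
have C0 : 0 <= C by rewrite divr_ge0 ?(ltW gamma_gt0) // addr_ge0 ?mulr_ge0 // ltW.
have VE k x w : (V k.+1 x w)%:E =
    ((h%:E + (N x t w)%:R%:E + \sum_(z <- nbr x) (V k z w)%:E) * h^-1%:E)%E.
  by rewrite sumEFin -!EFinD -EFinM.
have V0 k x w : (0 <= (V k x w)%:E)%E by rewrite lee_fin neumann_ge0.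
have mV k x : measurable_fun setT (fun w => (V k x w)%:E) by exact/measurable_EFinP.
have mN x : measurable_fun setT (fun w => (N x t w)%:R%:E : \bar R).
  by apply/measurable_EFinP; apply: measurable_natr; apply: measurable_N; exact: ltW.
have mhN x : measurable_fun setT (fun w => (h%:E + (N x t w)%:R%:E : \bar R)%E).
  exact: emeasurable_funD.
have hN0 x w : (0 <= h%:E + (N x t w)%:R%:E :> \bar R)%E by rewrite -EFinD lee_fin.
have S0 k x w : (0 <= \sum_(z <- nbr x) (V k z w)%:E)%E by exact: sume_ge0.
have mS k x : measurable_fun setT (fun w => \sum_(z <- nbr x) (V k z w)%:E)%E.
  exact: emeasurable_sum.
elim=> [|k IH] x.
  by rewrite (eq_integral (cst 0%E)) // integral0 lee_fin.
rewrite (eq_integral _ _ (fun w _ => VE k x w)) ge0_integralZr //; first last.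
- by rewrite lee_fin invr_ge0 ltW.
- by move=> w _; rewrite adde_ge0.
- exact: emeasurable_funD.
rewrite ge0_integralD // ge0_integralD //; last by move=> w _; rewrite lee_fin ltW.
have hE : (\int[P]_w h%:E = h%:E)%E by rewrite integral_cst //= probability_setT mule1.
rewrite ge0_integral_sum // hE N_mean //.
apply: (@le_trans _ _ ((h%:E + (M * t)%:E + \sum_(z <- nbr x) C%:E) * h^-1%:E)%E).
  rewrite lee_wpmul2r ?lee_fin ?invr_ge0 ?(ltW h0) //.
  apply: leeD; last exact: lee_sum.
  by rewrite leeD2l // lee_fin ler_wpM2r // ltW.
rewrite sumEFin -!EFinD -EFinM lee_fin ler_pdivrMr // big_const_seq iter_addr_0 count_predT.
have -> : h + M * t = C * gamma by rewrite divfK // gt_eqF.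
rewrite -mulr_natr -mulrDr ler_wpM2l // addrC; exact: h_ge.
Qed.

Lemma ae_potential : {ae P, forall w, exists v, (forall x, 0 <= v x) /\
  forall x, lap gamma v x = h + (N x t w)%:R}.
Proof.
have [C VC] := V_mean.
have ndV x w : {homo (fun k => (V k x w)%:E) : a b / (a <= b)%N >-> (a <= b)%E}.
  by apply/nondecreasing_seqP => k; rewrite lee_fin neumannS_le.
have V0 k x w : (0 <= (V k x w)%:E)%E by rewrite lee_fin neumann_ge0.
have mV k x : measurable_fun setT (fun w => (V k x w)%:E) by exact/measurable_EFinP.
have lim_fin x : {ae P, forall w, limn (fun k => (V k x w)%:E) \is a fin_num}.
  have mlim : measurable_fun setT (fun w => limn (fun k => (V k x w)%:E)).
    apply: (emeasurable_fun_cvg (fun k w => (V k x w)%:E)) => // w _.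
    exact: ereal_nondecreasing_is_cvgn.
  have int_lim : (\int[P]_w limn (fun k => (V k x w)%:E) <= C%:E)%E.
    rewrite monotone_convergence //.
    apply: lime_le; last by apply: nearW => k; exact: VC.
    apply: ereal_nondecreasing_is_cvgn => i j ij.
    apply: ge0_le_integral => // w _; exact: ndV.
  have ilim : P.-integrable setT (fun w => limn (fun k => (V k x w)%:E)).
    apply/integrableP; split=> //; rewrite (eq_integral (fun w => limn (fun k => (V k x w)%:E))).
      by apply: le_lt_trans int_lim _; rewrite ltry.
    move=> w _; rewrite gee0_abs //; apply: lime_ge; first exact: ereal_nondecreasing_is_cvgn.
    exact: nearW.
  by apply: filterS (integrable_ae measurableT ilim) => w; exact.
apply: filterS (ae_all_sites lim_fin) => w fin.
apply: neumann_potential => // x.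
exists (fine (limn (fun k => (V k x w)%:E))) => k.
rewrite -lee_fin fineK //; apply: lime_ge; first exact: ereal_nondecreasing_is_cvgn.
by exists k => // j /= kj; exact: ndV.
Qed.

End horizon.

Lemma ae_finite_topplings : {ae P, forall w, forall t, 0 <= t ->
  finite_topplings gamma setT (fun y => h + (N y t w)%:R)}.
Proof.
(* Countably many positive horizons suffice: almost surely the counts are nondecreasing in time, so
   the potential at K + 1 serves all earlier t. *)
have potK : {ae P, forall w, forall K : nat, exists v, (forall x, 0 <= v x) /\
    forall x, lap gamma v x = h + (N x K.+1%:R w)%:R}.
  by apply: ae_foralln => K; exact: ae_potential.
apply: filterS2 potK ae_paths => w pot path t t0.
have [K tK] : exists K : nat, t <= K.+1%:R.
  by exists (Num.truncn t); exact: ltW (truncnS_gt t).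
have [v [v0 vE]] := pot K.
apply: (finite_topplings_congr (eta' := fun y => h + (N y K.+1%:R w)%:R) (L' := setT)) => //.
  by move=> x _; rewrite lerD2l ler_nat (path x).2.
by apply: finite_topplings_real v0 _ => // x _; rewrite vE.
Qed.

Lemma ae_stabilizable : {ae P, forall w, forall (eta : config R d) t,
  stable_configs gamma eta -> 0 <= t ->
  finite_topplings gamma setT (add_particles eta (fun x => N x t w))}.
Proof.
apply: filterS ae_finite_topplings => w b eta t st t0.
apply: finite_topplings_congr (b _ t0) => // x _.
by rewrite lerD2r; case/andP: (st x) => _ /ltW.
Qed.

End stabilizable.

(** * Past and future of the Poisson processes *)

Section single_poisson.
Context (dT : measure_display) (T : measurableType dT) (R : realType).
Variable P : probability T R.
Variables (rate : R) (N : R -> T -> nat).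
Hypothesis N_poisson : poisson_process P rate N.
Implicit Types (s t r : R) (p q : R * nat) (l : seq (R * nat)).

Let mN t : 0 <= t -> measurable_fun setT (N t).
Proof. exact: poisson_measurable N_poisson t. Qed.

Let mNk t k : 0 <= t -> measurable [set w | N t w = k].
Proof. by move=> t0; apply: measurable_eq_nat (mN t0) (measurable_cst k). Qed.

Lemma poisson_paths_mono : {ae P, forall w, N 0 w = 0%N /\
  forall s t, 0 <= s -> s <= t -> (N s w <= N t w)%N}.
Proof. by apply: filterS (poisson_paths N_poisson) => w []. Qed.

(** Expressed by the law of N at time t - s rather than by Poisson weights, so as to include s = t,
    where the process starts at 0 almost surely. *)
Lemma poisson_increment_law s t k : 0 <= s -> s <= t ->
  P [set w | N t w = (N s w + k)%N] = P [set w | N (t - s) w = k].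
Proof.
move=> s0; rewrite le_eqVlt => /predU1P[<-|st].
  rewrite subrr; apply: ae_measure_eq.
  - by apply: measurable_eq_nat (mN s0) (measurable_fun_addn (mN s0) (measurable_cst k)).
  - exact: mNk.
  - apply: filterS poisson_paths_mono => w [e _] /=; rewrite e.
    by split=> [|<-]; lia.
have ts0 : 0 < t - s by rewrite subr_gt0.
rewrite (poisson_increments N_poisson) // -[in RHS](subr0 (t - s)).
rewrite subr0 -[t - s]subr0 -(poisson_increments N_poisson) // subr0.
have mts := mN (ltW ts0); apply: ae_measure_eq.
- by apply: measurable_eq_nat mts (measurable_fun_addn (mN (lexx 0)) (measurable_cst k)).
- exact: mNk (ltW ts0).
- by apply: filterS poisson_paths_mono => w [e _] /=; rewrite e add0n.
Qed.

Local Notation p0 := ((0 : R), 0%N).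

Definition step_prob p p' : \bar R :=
  if (p.2 <= p'.2)%N then P [set w | N (p'.1 - p.1) w = (p'.2 - p.2)%N] else 0%E.

Fixpoint path_prob p l : \bar R :=
  if l is p' :: l' then (step_prob p p' * path_prob p' l')%E else 1%E.

Lemma path_prob_cat p l1 l2 :
  path_prob p (l1 ++ l2) = (path_prob p l1 * path_prob (last p l1) l2)%E.
Proof. by elim: l1 p => [|p' l1 IH] p /=; rewrite ?mul1e // IH muleA. Qed.

Definition shift_point q p : R * nat := (q.1 + p.1, (q.2 + p.2)%N).

(** Transition probabilities are invariant under translation of time and value. This turns a path
    continued from (s, k) into one started at (0, 0). *)
Lemma path_prob_shift q p l :
  path_prob (shift_point q p) (map (shift_point q) l) = path_prob p l.
Proof.
elim: l p => //= p' l IH p; rewrite IH; congr (_ * _)%E.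
by rewrite /step_prob /= leq_add2l subnDl opprD addrACA subrr add0r.
Qed.

Lemma path_probE p l : path_prob p l =
  (\prod_(0 <= i < size l) step_prob (nth p0 (p :: l) i) (nth p0 l i))%E.
Proof.
elim: l p => [|p' l IH] p; first by rewrite big_nil.
by rewrite [RHS]big_nat_recl //= IH.
Qed.

Definition time_le p p' := p.1 <= p'.1.

Lemma finite_dim_law l : path time_le p0 l ->
  P [set w | forall p, p \in l -> N p.1 w = p.2] = path_prob p0 l.
Proof.
move=> /(pathP p0) tl; set n := size l in tl *.
(* The path is made infinite by repeating its last point, as independence of increments is given for
   infinite nondecreasing sequences of times. *)
pose a i := nth p0 (p0 :: l) (minn i n).
pose u i := (a i).1; pose k i := (a i).2.
have uS i : u i <= u i.+1.
  rewrite /u /a; have [lt|ge] := ltnP i n.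
    by rewrite (minn_idPl lt); exact: tl.
  by rewrite (minn_idPr (leqW ge)).
have u0 i : 0 <= u i.
  elim: i => [|i IH]; last exact: le_trans IH (uS i).
  by rewrite /u /a min0n.
(* With real differences a prescribed decrease is a null event, in accordance with the value 0 of
   [step_prob]. *)
pose incr i w := (N (u i.+1) w)%:R - (N (u i) w)%:R : R.
pose E i := incr i @^-1` [set (k i.+1)%:R - (k i)%:R].
have mE i : measurable (E i).
  rewrite -[X in measurable X]setTI.
  have : measurable_fun setT (incr i).
    by apply: measurable_funB; apply: measurable_natr; exact: mN.
  by apply.
have EP i w : E i w <-> (N (u i.+1) w + k i)%N = (k i.+1 + N (u i) w)%N.
  rewrite /E /incr /=; split=> [/eqP|/(congr1 (fun m => m%:R : R))]; last first.
    by rewrite !natrD => e; lra.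
  by rewrite subr_eq addrAC eq_sym subr_eq -!natrD eqr_nat => /eqP ->.
have PE i : (i < n)%N -> P (E i) = step_prob (nth p0 (p0 :: l) i) (nth p0 l i).
  move=> lin; have -> : nth p0 (p0 :: l) i = a i by rewrite /a (minn_idPl (ltnW lin)).
  have -> : nth p0 l i = a i.+1 by rewrite /a (minn_idPl lin).
  rewrite /step_prob -/(k i) -/(k i.+1) -/(u i) -/(u i.+1); case: leqP => kk.
    rewrite -poisson_increment_law //; congr (P _); apply/seteqP.
    by split=> w /= => [/EP|e]; [|apply/EP]; lia.
  rewrite -(measure0 P); apply: ae_measure_eq => //.
  apply: filterS poisson_paths_mono => w [_ /(_ _ _ (u0 i) (uS i)) le].
  by split=> // /EP; lia.
pose J := [fset i in iota 0 n]%fset.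
have JP i : (i \in J) = (i < n)%N by rewrite in_fset mem_iota.
have := poisson_independent_increments N_poisson (u0 0%N) uS (E := E) (J := J) _.
have -> : (\prod_(i <- enum_fset J) P (E i) = path_prob p0 l)%E.
  rewrite path_probE (perm_big (index_iota 0 n)) /=.
    by apply: eq_big_nat => i /andP[_ lin]; exact: PE.
  apply: uniq_perm; rewrite ?fset_uniq ?iota_uniq // => i.
  by rewrite mem_index_iota JP.
move=> <-; last first.
  by move=> i _; exists [set (k i.+1)%:R - (k i)%:R] => //; rewrite setTI.
apply: ae_measure_eq.
- rewrite (_ : mkset _ = \bigcap_(p in [set` l]) [set w | N p.1 w = p.2]) //.
  apply: fin_bigcap_measurable => // p /= /(nthP p0)[i li <-].
  apply: mNk; have := u0 i.+1; rewrite /u /a (minn_idPl _) //.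
- by apply: fin_bigcap_measurable => // i _; exact: mE.
apply: filterS poisson_paths_mono => w [N0 _]; split=> [lw i /=|Ew].
  rewrite JP => lin; apply/EP.
  have val j : (j <= n)%N -> N (u j) w = k j.
    case: j => [_|j jn]; first by rewrite /u /k /a min0n.
    by rewrite /u /k /a (minn_idPl jn) /=; apply: lw; exact: mem_nth.
  by rewrite !val // 1?ltnW // addnC.
(* The padded path starts at (0, 0), where N vanishes, so prescribed increments determine the values
   one after another. *)
have val j : (j <= n)%N -> N (u j) w = k j.
  elim: j => [_|j IH jn]; first by rewrite /u /k /a min0n.
  have jJ : j \in J by rewrite JP.
  have /EP := Ew j jJ; rewrite IH 1?ltnW // => /eqP.
  by rewrite eqn_add2r => /eqP.
move=> p /(nthP p0)[i lin <-]; have := val i.+1 lin.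
by rewrite /u /k /a (minn_idPl _).
Qed.

(** The past l1 followed by the translate of l2 to its endpoint is one path. Its probability
    factorizes there, and the second factor is translated back. *)
Lemma past_future_points s k l1 l2 :
  path time_le p0 l1 -> path time_le p0 l2 -> last p0 l1 = (s, k) ->
  P ([set w | forall p, p \in l1 -> N p.1 w = p.2] `&`
     [set w | forall p, p \in l2 -> N (s + p.1) w = (k + p.2)%N]) =
  (P [set w | forall p, p \in l1 -> N p.1 w = p.2] *
   P [set w | forall p, p \in l2 -> N p.1 w = p.2])%E.
Proof.
move=> pl1 pl2 last1; rewrite !finite_dim_law //.
have := path_prob_shift (s, k) p0 l2; rewrite {1}/shift_point /= addr0 addn0 => <-.
rewrite -last1 -path_prob_cat.
rewrite -finite_dim_law; last first.
  have := homo_path (f := shift_point (s, k)) _ pl2.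
  rewrite cat_path pl1 last1 {2}/shift_point /= addr0 addn0; apply => p p'.
  by rewrite /time_le /= lerD2l.
congr (P _); apply/seteqP; split=> w /=.
  move=> [w1 w2] p; rewrite mem_cat => /orP[/w1 //|/mapP[p' p'2 ->]].
  by rewrite last1; exact: w2.
move=> w12; split=> [p pl|p pl]; first by apply: w12; rewrite mem_cat pl.
have := w12 (shift_point (s, k) p); rewrite mem_cat last1 map_f ?orbT //.
by apply.
Qed.

End single_poisson.

(** * From prescribed values to prescribed sets of values *)

Section nat_families.
Context (dT : measure_display) (T : measurableType dT) (R : realType).
Implicit Types (I : eqType).

Definition constrained I (f : I -> T -> nat) (s : seq I) (A : I -> set nat) : set T :=
  [set w | forall i, i \in s -> A i (f i w)].

Lemma measurable_constrained I (f : I -> T -> nat) s A :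
  (forall i, i \in s -> measurable_fun setT (f i)) -> measurable (constrained f s A).
Proof.
move=> mf; rewrite (_ : constrained _ _ _ = \bigcap_(i in [set` s]) f i @^-1` A i) //.
apply: fin_bigcap_measurable => // i /= /mf mfi.
by rewrite -[X in measurable X]setTI; exact: mfi.
Qed.

Lemma constrained_cat I (f : I -> T -> nat) s1 s2 A1 A2 :
  constrained f s1 A1 `&` constrained f s2 A2 =
  constrained f (s1 ++ s2) (fun i => [set k | (i \in s1 -> A1 i k) /\ (i \in s2 -> A2 i k)]).
Proof.
apply/seteqP; split=> w /=.
  by move=> [w1 w2] i _; split=> [/w1|/w2].
move=> w12; split=> i ii.
  by apply: (w12 i _).1 => //; rewrite mem_cat ii.
by apply: (w12 i _).2 => //; rewrite mem_cat ii orbT.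
Qed.

Variable P : probability T R.

Lemma level_sum (X : T -> nat) (E : set T) : measurable_fun setT X -> measurable E ->
  P E = (\sum_(k <oo) P (E `&` [set w | X w = k]))%E.
Proof.
move=> mX mE; have mk k : measurable [set w | X w = k].
  by apply: measurable_eq_nat => //; exact: measurable_cst.
have -> : P E = P (\bigcup_k (E `&` [set w | X w = k])).
  congr (P _); apply/seteqP; split=> [w Ew|w [k _ []]//].
  by exists (X w).
rewrite measure_bigcup => [|k _|]; first by apply: eq_eseriesl => k; rewrite in_setT.
  exact: measurableI.
apply/trivIsetP => i j _ _ ij; apply/seteqP; split=> // w [[_ /= ei] [_ /= ej]].
by move: ij; rewrite -ei -ej eqxx.
Qed.

(* Constraints on the values of integer random variables determine constraints by sets:
   sum over the values, one variable at a time. *)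
Lemma constrained_values I (D : I -> Prop) (f g : I -> T -> nat) (F : set T) (c : R) :
  measurable F -> 0 <= c ->
  (forall i, D i -> measurable_fun setT (f i)) -> (forall i, D i -> measurable_fun setT (g i)) ->
  (forall s k, (forall i, i \in s -> D i) ->
    P (F `&` constrained f s (fun i => [set k i])) =
    (c%:E * P (constrained g s (fun i => [set k i])))%E) ->
  forall s A, (forall i, i \in s -> D i) ->
    P (F `&` constrained f s A) = (c%:E * P (constrained g s A))%E.
Proof.
(* In the induction s lists variables fixed to values and s2 those constrained by sets; each step
   moves one variable from s2 to s. *)
move=> mF c0 mf mg fg s2 A Ds2.
pose E h s k s2 := constrained h s (fun i => [set k i]) `&` constrained h s2 A.
suff : forall s k, (forall i, i \in s -> D i) -> P (F `&` E f s k s2) = (c%:E * P (E g s k s2))%E.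
  move=> /(_ [::] (fun=> 0%N)); rewrite /E.
  have T0 h : constrained h [::] (fun i => [set 0%N]) = [set: T] by apply/seteqP; split.
  by rewrite !T0 !setTI; apply.
have mE h s k s' : (forall i, D i -> measurable_fun setT (h i)) -> (forall i, i \in s -> D i) ->
    (forall i, i \in s' -> D i) -> measurable (E h s k s').
  by move=> mh Ds Ds'; apply: measurableI; apply: measurable_constrained => i; [move/Ds/mh|move/Ds'/mh].
elim: s2 Ds2 => [_ s k Ds|j s2 IH Ds2 s k Ds].
  have T0 h : constrained h [::] A = [set: T] by apply/seteqP; split.
  by rewrite /E !T0 !setIT; exact: fg.
have Dj : D j by apply: Ds2; rewrite mem_head.
have {}Ds2' i : i \in s2 -> D i by move=> is2; apply: Ds2; rewrite inE is2 orbT.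
(* If j already occurs in s, its new value m has to agree with the old one, otherwise the event is
   empty. *)
have cut h m : E h s k (j :: s2) `&` [set w | h j w = m] =
    if `[< A j m /\ (j \in s -> k j = m) >]
    then E h (j :: s) (fun i => if i == j then m else k i) s2 else set0.
  case: asboolP => [[Am km]|nA]; apply/seteqP; split=> w //=.
  - move=> [[w1 w2] hm]; split=> i.
      by rewrite inE; have [->|_] /= := eqVneq i j; [|exact: w1].
    by move=> is2; apply: w2; rewrite inE is2 orbT.
  - move=> [w1 w2]; have hm : h j w = m by have := w1 j (mem_head _ _); rewrite /= eqxx.
    split=> //; split=> i.
      move=> is1; have := w1 i; rewrite inE is1 orbT => /(_ isT) /=.
      by have [ij|//] := eqVneq i j; rewrite ij km // -ij.
    by rewrite inE => /predU1P[->|/w2//]; rewrite hm.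
  - move=> [[w1 w2] hm]; apply: nA; rewrite -hm; split; first exact: w2 (mem_head _ _).
    by move=> /w1 /= ->.
rewrite (level_sum (mf _ Dj)); last by apply: measurableI => //; exact: mE.
rewrite [in RHS](level_sum (mg _ Dj)); last exact: mE.
rewrite -nneseriesZl //; apply: eq_eseriesr => m _.
rewrite -setIA !cut; case: asboolP => _; last by rewrite setI0 measure0 mule0.
by apply: IH => // i; rewrite inE => /predU1P[->//|/Ds].
Qed.

End nat_families.

Section past_with_present.
Context (dT : measure_display) (T : measurableType dT) (R : realType).
Variable P : probability T R.
Variables (rate : R) (N : R -> T -> nat).
Hypothesis N_poisson : poisson_process P rate N.
Variables (s : R) (ts us : seq R) (k m : R -> nat).
Hypotheses (ts_past : forall t, t \in ts -> 0 <= t <= s) (s0 : 0 <= s).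
Hypothesis us0 : forall u, u \in us -> 0 <= u.

Let incr u w := (N (u + s) w - N s w)%N.

Let mN t : 0 <= t -> measurable_fun setT (N t).
Proof. exact: poisson_measurable N_poisson t. Qed.

Let mN_past t : t \in ts -> measurable_fun setT (N t).
Proof. by case/ts_past/andP => t0 _; exact: mN. Qed.

Let mN_future u : u \in us -> measurable_fun setT (incr u).
Proof. by move=> /us0 u0; apply: measurable_fun_subn; apply: mN => //; rewrite addr_ge0. Qed.

Let values f l j : set T := constrained f l (fun t : R => [set j t]).

(** As the value at time s is prescribed, prescribing increments after s amounts almost surely to
    prescribing values, and [past_future_points] applies. The truncated subtraction in [incr] is a
    true difference because paths are almost surely monotone. *)
Lemma past_future_values_mem : s \in ts ->
  P (values N ts k `&` values incr us m) = (P (values N ts k) * P (values N us m))%E.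
Proof.
move=> s_ts; pose pt (j : R -> nat) t := (t, j t).
(* The time s is appended although it occurs in [ts], so that the path visibly ends at (s, k s); the
   repetition is a step of length 0. *)
pose l1 := map (pt k) (rcons (sort <=%R ts) s); pose l2 := map (pt m) (sort <=%R us).
have path0 (l : seq R) : (forall t, t \in l -> 0 <= t) -> path <=%R 0 (sort <=%R l).
  move=> l0; rewrite path_min_sorted; first exact: sort_le_sorted.
  by apply/allP => t; rewrite mem_sort; exact: l0.
have pt_path j l : path <=%R 0 l -> path (@time_le R) (0, 0%N) (map (pt j) l).
  move=> pl; have -> : path (@time_le R) (0, 0%N) (map (pt j) l) =
    path (@time_le R) (pt j 0) (map (pt j) l) by case: l {pl}.
  by rewrite path_map.
have p1 : path (@time_le R) (0, 0%N) l1.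
  apply: pt_path; rewrite rcons_path path0 => [|t /ts_past/andP[]//] /=.
  have := mem_last 0 (sort <=%R ts); rewrite inE mem_sort => /predU1P[->//|/ts_past/andP[]//].
have p2 : path (@time_le R) (0, 0%N) l2 by apply: pt_path; exact: path0.
have := past_future_points N_poisson p1 p2 (s := s) (k := k s).
rewrite /l1 map_rcons last_rcons -map_rcons -/l1 => /(_ erefl).
have -> : [set w | forall p, p \in l1 -> N p.1 w = p.2] = values N ts k.
  apply/seteqP; split=> w /= lw => [t tts|p /mapP[t + ->]].
    by apply: (lw (pt k t)); rewrite map_f // mem_rcons inE mem_sort tts orbT.
  rewrite mem_rcons inE mem_sort => /predU1P[->|]; exact: lw.
have -> : [set w | forall p, p \in l2 -> N p.1 w = p.2] = values N us m.
  apply/seteqP; split=> w /= lw => [t tts|p /mapP[t + ->]].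
    by apply: (lw (pt m t)); rewrite map_f // mem_sort.
  by rewrite mem_sort; exact: lw.
move=> <-; apply: ae_measure_eq.
- by apply: measurableI; exact: measurable_constrained.
- apply: measurableI; first exact: measurable_constrained.
  rewrite (_ : mkset _ = \bigcap_(p in [set` l2]) [set w | N (s + p.1) w = (k s + p.2)%N]) //.
  apply: fin_bigcap_measurable => // p /= /mapP[u + ->]; rewrite mem_sort => /us0 u0.
  by apply: measurable_eq_nat; [apply: mN; rewrite addr_ge0|exact: measurable_cst].
apply: filterS (poisson_paths_mono N_poisson) => w [_ mono].
split=> -[w1 w2]; split=> //.
  move=> p /mapP[u + ->]; rewrite mem_sort => uus; have e1 : N s w = k s := w1 _ s_ts.
  have e2 : (N (u + s) w - N s w)%N = m u := w2 _ uus.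
  rewrite /= -e1 -e2 addrC.
  by rewrite subnKC // mono // lerDr us0.
move=> u uus; rewrite /= /incr addrC.
by rewrite (w2 (pt m u)) ?map_f ?mem_sort // (w1 _ s_ts) addKn.
Qed.

End past_with_present.

Section single_poisson_future.
Context (dT : measure_display) (T : measurableType dT) (R : realType).
Variable P : probability T R.
Variables (rate : R) (N : R -> T -> nat).
Hypothesis N_poisson : poisson_process P rate N.

(** If s is not among the prescribed times, sum over the value of N at s to reduce to the case where
    it is. *)
Lemma past_future_values s (ts us : seq R) (k m : R -> nat) : 0 <= s ->
  (forall t, t \in ts -> 0 <= t <= s) -> (forall u, u \in us -> 0 <= u) ->
  P (constrained N ts (fun t => [set k t]) `&`
     constrained (fun (u : R) w => (N (u + s) w - N s w)%N) us (fun u : R => [set m u])) =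
  (P (constrained N ts (fun t => [set k t])) * P (constrained N us (fun u : R => [set m u])))%E.
Proof.
move=> s0 ts_past us0.
have mN t : 0 <= t -> measurable_fun setT (N t) by exact: poisson_measurable N_poisson t.
have [s_ts|s_ts] := boolP (s \in ts).
  exact: (past_future_values_mem N_poisson).
have mF : measurable (constrained N ts (fun t => [set k t])).
  by apply: measurable_constrained => t /ts_past/andP[t0 _]; exact: mN.
have mG : measurable (constrained (fun (u : R) w => (N (u + s) w - N s w)%N) us (fun u : R => [set m u])).
  apply: measurable_constrained => u /us0 u0; apply: measurable_fun_subn; apply: mN => //.
  by rewrite addr_ge0.
rewrite (level_sum P (mN _ s0)); last exact: measurableI.
rewrite [X in (X * _)%E](level_sum P (mN _ s0)) // muleC -[X in (X * _)%E]fineK ?fin_num_measure //; last first.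
  by apply: measurable_constrained => u /us0; exact: mN.
rewrite -nneseriesZl ?fine_ge0 //; apply: eq_eseriesr => j _; rewrite setIAC fineK ?fin_num_measure //; last first.
  by apply: measurable_constrained => u /us0; exact: mN.
rewrite muleC.
have -> : constrained N ts (fun t => [set k t]) `&` [set w | N s w = j] =
    constrained N (s :: ts) (fun t => [set if t == s then j else k t]).
  apply/seteqP; split=> w /=.
    move=> [w1 w2] t; rewrite inE; have [->|_ /w1] //= := eqVneq t s.
  move=> w1; split=> [t tts|]; last by have := w1 s (mem_head _ _); rewrite /= eqxx.
  have := w1 t; rewrite inE tts orbT => /(_ isT) /=.
  by have [ts'|//] := eqVneq t s; rewrite ts' (negbTE s_ts) in tts.
apply: (past_future_values_mem N_poisson) => //; last exact: mem_head.
move=> t; rewrite inE => /predU1P[->|/ts_past//].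
by rewrite s0 lexx.
Qed.

End single_poisson_future.

(** * Independence of past and future over all sites *)

Section lattice_poisson.
Context (dT : measure_display) (T : measurableType dT) (R : realType).
Variables (P : probability T R) (d : nat) (phi : site d -> R).
Variable N : site d -> R -> T -> nat.
Hypothesis N_poisson : independent_poisson_processes P phi N.
Implicit Types (x : site d) (p : site d * R) (ps qs : seq (site d * R)).

Let nonneg_time p := 0 <= p.2.

Let count p w := N p.1 p.2 w.

Let mcount p : nonneg_time p -> measurable_fun setT (count p).
Proof. exact: (measurable_N N_poisson). Qed.

Definition increment s p w := (N p.1 (p.2 + s) w - N p.1 s w)%N.

Lemma measurable_increment s p : 0 <= s -> 0 <= p.2 -> measurable_fun setT (increment s p).
Proof.
move=> s0 p0; apply: measurable_fun_subn; apply: (measurable_N N_poisson) => //.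
by rewrite addr_ge0.
Qed.

Let at_site ps x := [seq p.2 | p <- ps & p.1 == x].

Let mem_at_site ps x t : (t \in at_site ps x) = ((x, t) \in ps).
Proof.
apply/mapP/idP => [[[y u]]|xt].
  by rewrite mem_filter /= => /andP[/eqP -> +] ->.
by exists (x, t); rewrite // mem_filter eqxx.
Qed.

Let constrained_sites (f : site d -> R -> T -> nat) ps A (S : {fset site d}) :
  (forall p, p \in ps -> p.1 \in S) ->
  constrained (fun p => f p.1 p.2) ps A =
  \bigcap_(x in [set` S]) constrained (f x) (at_site ps x) (fun t => A (x, t)).
Proof.
move=> psS; apply/seteqP; split=> w /= fw.
  by move=> x _ t; rewrite mem_at_site => /fw.
move=> [x t] xt; have := fw x (psS _ xt) t; rewrite mem_at_site.
by apply.
Qed.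

Let sigma_count x : set (set T) := sigma_of [set t | 0 <= t] (N x).

Let mcount_site x t : 0 <= t ->
  measurable_fun (setT : set (g_sigma_algebraType
    (\bigcup_(t in [set t | 0 <= t]) preimage_set_system setT (N x t) measurable))) (N x t).
Proof.
move=> t0 _ B mB; apply: sub_sigma_algebra; exists t => //.
by exists B.
Qed.

Let constrained_count x ts A : (forall t, t \in ts -> 0 <= t) ->
  sigma_count x (constrained (N x) ts A).
Proof.
move=> ts0; pose G := \bigcup_(t in [set t | 0 <= t]) preimage_set_system setT (N x t) measurable.
apply: (@measurable_constrained _ (g_sigma_algebraType G)) => t /ts0.
exact: mcount_site.
Qed.

Let constrained_incr x s ts A : 0 <= s -> (forall t, t \in ts -> 0 <= t) ->
  sigma_count x (constrained (fun t => increment s (x, t)) ts A).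
Proof.
move=> s0 ts0; pose G := \bigcup_(t in [set t | 0 <= t]) preimage_set_system setT (N x t) measurable.
apply: (@measurable_constrained _ (g_sigma_algebraType G)) => t /ts0 t0.
by apply: measurable_fun_subn; apply: mcount_site; rewrite //= addr_ge0.
Qed.

Let sigma_countI x A B : sigma_count x A -> sigma_count x B -> sigma_count x (A `&` B).
Proof.
pose G := \bigcup_(t in [set t | 0 <= t]) preimage_set_system setT (N x t) measurable.
exact: (@measurableI _ (g_sigma_algebraType G)).
Qed.

(** Constraints are grouped by site. Independence of the sites turns both sides into products over
    sites, with factors given by the one-site case. *)
Let lattice_values s ps qs (k m : site d * R -> nat) : 0 <= s ->
  (forall p, p \in ps -> 0 <= p.2 <= s) -> (forall p, p \in qs -> nonneg_time p) ->
  P (constrained count ps (fun p => [set k p]) `&`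
     constrained (increment s) qs (fun p => [set m p])) =
  (P (constrained count ps (fun p => [set k p])) *
   P (constrained count qs (fun p => [set m p])))%E.
Proof.
move=> s0 ps_past qs0; pose S := [fset p.1 | p in ps ++ qs]%fset.
have pS p : p \in ps -> p.1 \in S.
  by move=> pps; apply: in_imfset; rewrite /= mem_cat pps.
have qS p : p \in qs -> p.1 \in S.
  by move=> pqs; apply: in_imfset; rewrite /= mem_cat pqs orbT.
rewrite /count (constrained_sites N _ pS) (constrained_sites N _ qS).
rewrite (_ : constrained (increment s) _ _ = constrained
  (fun p w => (fun x t => increment s (x, t)) p.1 p.2 w) qs (fun p => [set m p])) //.
rewrite (constrained_sites (fun x t => increment s (x, t)) _ qS) -bigcapI.
have past0 x t : t \in at_site ps x -> 0 <= t.
  by rewrite mem_at_site => /ps_past/andP[].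
have fut0 x t : t \in at_site qs x -> 0 <= t by rewrite mem_at_site => /qs0.
rewrite !N_poisson.2; last 3 first.
- by move=> x _; exact: constrained_count (fut0 x).
- by move=> x _; exact: constrained_count (past0 x).
- move=> x _; apply: sigma_countI; first exact: constrained_count (past0 x).
  exact: constrained_incr (fut0 x).
rewrite -big_split /=; apply: eq_bigr => x _.
apply: (past_future_values (N_poisson.1 x) (fun t => k (x, t)) (fun t => m (x, t))) => //; last exact: fut0.
by move=> t; rewrite mem_at_site => /ps_past.
Qed.

(** [constrained_values] is applied twice: for the past with the increments held fixed, then for the
    increments with the values of the past held fixed. *)
Lemma past_future_indep s ps qs A B : 0 <= s ->
  (forall p, p \in ps -> 0 <= p.2 <= s) -> (forall p, p \in qs -> 0 <= p.2) ->
  P (constrained (fun p => N p.1 p.2) ps A `&` constrained (increment s) qs B) =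
  (P (constrained (fun p => N p.1 p.2) ps A) * P (constrained (fun p => N p.1 p.2) qs B))%E.
Proof.
move=> s0 ps_past qs0.
have m_count ps' A' : (forall p, p \in ps' -> nonneg_time p) -> measurable (constrained count ps' A').
  by move=> ps0; apply: measurable_constrained => p /ps0; exact: mcount.
have m_incr qs' A' : (forall p, p \in qs' -> nonneg_time p) ->
    measurable (constrained (increment s) qs' A').
  by move=> qs0'; apply: measurable_constrained => p /qs0'; exact: measurable_increment.
have PE E : measurable E -> P E = (fine (P E))%:E by move=> mE; rewrite fineK // fin_num_measure.
rewrite setIC muleC (PE (constrained _ qs B)); last exact: m_count.
apply: (@constrained_values _ _ _ _ _ (fun p => 0 <= p.2 <= s)) => //; first exact: m_incr.
- exact/fine_ge0.
- by move=> p /andP[p0 _]; exact: mcount.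
- by move=> p /andP[p0 _]; exact: mcount.
move=> ps' k ps'_past; rewrite -PE; last exact: m_count.
have mF : measurable (constrained count ps' (fun p => [set k p])).
  by apply: m_count => p /ps'_past/andP[].
rewrite setIC muleC (PE _ mF).
apply: (@constrained_values _ _ _ _ _ nonneg_time) => //.
- exact/fine_ge0.
- by move=> p; exact: measurable_increment.
by move=> qs' m qs'0; rewrite -PE // lattice_values.
Qed.

Variables (gamma : R) (eta0 : {RV P >-> config R d}).
Hypothesis eta0_init : initial_config gamma N eta0.

Lemma initial_past_future_indep s ps qs (C : set (config R d)) A B : measurable C -> 0 <= s ->
  (forall p, p \in ps -> 0 <= p.2 <= s) -> (forall p, p \in qs -> 0 <= p.2) ->
  P (eta0 @^-1` C `&` constrained (fun p => N p.1 p.2) ps A `&` constrained (increment s) qs B) =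
  (P (eta0 @^-1` C `&` constrained (fun p => N p.1 p.2) ps A) *
   P (constrained (fun p => N p.1 p.2) qs B))%E.
Proof.
move=> mC s0 ps_past qs0.
pose G := \bigcup_(p in [set p : site d * R | 0 <= p.2])
  preimage_set_system setT (N p.1 p.2) measurable.
have mN p : 0 <= p.2 -> measurable_fun (setT : set (g_sigma_algebraType G)) (N p.1 p.2).
  by move=> p0 _ E mE; apply: sub_sigma_algebra; exists p => //; exists E.
have past : <<s G >> (constrained (fun p => N p.1 p.2) ps A).
  by apply: (@measurable_constrained _ (g_sigma_algebraType G)) => p /ps_past/andP[p0 _]; exact: mN.
have fut : <<s G >> (constrained (increment s) qs B).
  apply: (@measurable_constrained _ (g_sigma_algebraType G)) => p /qs0 p0.
  by apply: measurable_fun_subn; [exact: (mN (p.1, p.2 + s) (addr_ge0 _ _))|exact: (mN (p.1, s))].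
have ind E : <<s G >> E -> P (eta0 @^-1` C `&` E) = (P (eta0 @^-1` C) * P E)%E.
  by move=> GE; apply: eta0_init.2 => //; exists C => //; rewrite setTI.
rewrite -setIA !ind //; last exact: (@measurableI _ (g_sigma_algebraType G)).
by rewrite past_future_indep // muleA.
Qed.

End lattice_poisson.

Section tuple_law.
Context (dT : measure_display) (T : measurableType dT) (R : realType).
Variables (P : probability T R) (d n : nat).

Local Notation tup := (n.-tuple (config R d)).

Definition coord_box (l : seq ('I_n * site d)) (A : 'I_n * site d -> set R) : set tup :=
  [set t | forall p, p \in l -> A p (tnth t p.1 p.2)].

Let boxes : set (set tup) :=
  [set B | exists l A, (forall p, measurable (A p)) /\ B = coord_box l A].

Lemma measurable_coord_box l A : (forall p, measurable (A p)) -> measurable (coord_box l A).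
Proof.
move=> mA; rewrite (_ : coord_box l A =
  \bigcap_(p in [set` l]) (fun t : tup => tnth t p.1 p.2 : R) @^-1` A p) //.
apply: fin_bigcap_measurable => // p _; rewrite -[X in measurable X]setTI.
have : measurable_fun setT (fun t : tup => tnth t p.1 p.2 : R).
  exact: (measurableT_comp (measurable_coord p.2) (measurable_tnth p.1)).
by apply.
Qed.

Let measurable_boxes : @measurable _ tup = <<s boxes >>.
Proof.
apply/seteqP; split=> B; last first.
  apply: smallest_sub; first exact: sigma_algebra_measurable.
  by move=> _ [l [A [mA ->]]]; exact: measurable_coord_box.
move=> mB; suff mid : measurable_fun setT (fun t : g_sigma_algebraType boxes => t : tup).
  by have := mid measurableT B mB; rewrite setTI.
apply/measurable_fun_tnthP => i; apply: measurable_config => x _ A mA.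
apply: sub_sigma_algebra; exists [:: (i, x)], (fun=> A); split=> //.
apply/seteqP; split=> t /=.
  by move=> [_ At] p; rewrite inE => /eqP ->.
by move=> At; split=> //; have := At (i, x); apply; rewrite mem_head.
Qed.

(** Both sides are finite measures in B that agree on the pi-system of coordinate boxes. The event F
    and the factor c allow a factorization to be extended, and not only an equality of laws. *)
Lemma tuple_law (F : set T) (c : R) (D D0 : T -> tup) : measurable F -> 0 <= c ->
  measurable_fun setT D -> measurable_fun setT D0 ->
  (forall l A, (forall p, measurable (A p)) ->
    P (F `&` D @^-1` coord_box l A) = (c%:E * P (D0 @^-1` coord_box l A))%E) ->
  forall B, measurable B -> P (F `&` D @^-1` B) = (c%:E * P (D0 @^-1` B))%E.
Proof.
move=> mF c0 mD mD0 FD B mB; rewrite setIC.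
change (pushforward (mrestr P mF) D B = pushforward (mscale (NngNum c0) P) D0 B).
apply: (measure_unique boxes (fun=> setT)) => //.
- move=> _ _ [l [A [mA ->]]] [l' [A' [mA' ->]]].
  exists (l ++ l'), (fun p => (if p \in l then A p else setT) `&` (if p \in l' then A' p else setT)).
  split=> [p|].
    by apply: measurableI; case: ifP.
  apply/seteqP; split=> t /=.
    by move=> [tA tA'] p _; split; case: ifP => // pl; [exact: tA|exact: tA'].
  move=> tAA; split=> p pl.
    by have := tAA p; rewrite /= mem_cat pl => /(_ isT)[].
  by have := tAA p; rewrite /= mem_cat pl orbT => /(_ isT)[].
- move=> _; exists [::], (fun=> setT); split=> //.
  by apply/seteqP; split=> // t _ p.
- by rewrite bigcup_const //; exists 0%N.
- by move=> _ [l [A [mA ->]]]; have := FD l A mA; rewrite setIC; exact.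
- move=> _; change (P (D @^-1` setT `&` F) < +oo)%E; rewrite preimage_setT setTI.
  by rewrite (le_lt_trans (probability_le1 _ mF)) // ltry.
Qed.

End tuple_law.

Section past.
Variables (R : realType) (d : nat) (gamma : R).
Context (dT : measure_display) (T : measurableType dT) (P : probability T R).
Variables (phi : site d -> R) (N : site d -> R -> T -> nat).
Hypothesis N_poisson : independent_poisson_processes P phi N.
Variable eta0 : {RV P >-> config R d}.
Hypothesis eta0_init : initial_config gamma N eta0.
Variable s : R.
Hypothesis s0 : 0 <= s.

Local Notation count := (fun p : site d * R => N p.1 p.2).

(** A pi-system generating the sigma-algebra of the initial configuration and of the counts up to
    time s, which contains the past of the sandpile process. *)
Definition past_events : set (set T) :=
  [set E | exists C ps A, [/\ measurable C, forall p, p \in ps -> 0 <= p.2 <= s &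
    E = eta0 @^-1` C `&` constrained count ps A]].

Let past_eventsI : setI_closed past_events.
Proof.
move=> _ _ [C [ps [A [mC psP ->]]]] [C' [ps' [A' [mC' psP' ->]]]].
exists (C `&` C'), (ps ++ ps'); eexists; split.
- exact: measurableI.
- by move=> p; rewrite mem_cat => /orP[/psP|/psP'].
- by rewrite setIACA constrained_cat preimage_setI.
Qed.

Let past_eventsT : past_events setT.
Proof.
exists setT, [::], (fun=> setT); split=> //.
by rewrite preimage_setT setTI; apply/seteqP; split.
Qed.

Let measurable_eta0 C : measurable C -> measurable (eta0 @^-1` C).
Proof. by move=> mC; rewrite -[X in measurable X]setTI; exact: (measurable_funP eta0). Qed.

Let past_events_measurable : past_events `<=` measurable.
Proof.
move=> _ [C [ps [A [mC psP ->]]]]; apply: measurableI; first exact: measurable_eta0.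
apply: measurable_constrained => p /psP/andP[p0 _].
exact: (measurable_N N_poisson).
Qed.

Local Notation past_type := (g_sigma_algebraType past_events).

Lemma measurable_past_eta0 : measurable_fun (setT : set past_type) (eta0 : T -> config R d).
Proof.
move=> _ C mC; apply: sub_sigma_algebra; exists C, [::], (fun=> setT); split=> //.
by rewrite setTI; apply/seteqP; split=> [w Cw|w []//]; split.
Qed.

Lemma measurable_past_count x t : 0 <= t <= s -> measurable_fun (setT : set past_type) (N x t).
Proof.
move=> ts _ A _; apply: sub_sigma_algebra; exists setT, [:: (x, t)], (fun=> A); split=> //.
  by move=> p; rewrite inE => /eqP ->.
rewrite preimage_setT !setTI; apply/seteqP; split=> w /=.
  by move=> Aw p; rewrite inE => /eqP ->.
by move=> /(_ (x, t)); rewrite mem_head; apply.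
Qed.

Lemma past_measurable F : <<s past_events >> F -> measurable F.
Proof. by apply: smallest_sub => //; exact: sigma_algebra_measurable. Qed.

Section future.
Variables (n : nat) (u : 'I_n -> R).
Hypothesis u0 : forall i, 0 <= u i.

Definition future_particles w : n.-tuple (config R d) :=
  [tuple (fun x => (increment N s (x, u i) w)%:R) | i < n].

Definition particles w : n.-tuple (config R d) :=
  [tuple (fun x => (N x (u i) w)%:R) | i < n].

Lemma measurable_future_particles : measurable_fun setT future_particles.
Proof.
apply/measurable_fun_tnthP => i; apply: measurable_config => x.
rewrite (_ : (fun w => _) = fun w => (increment N s (x, u i) w)%:R); last first.
  by apply/funext => w; rewrite /= tnth_mktuple.
by apply: measurable_natr; exact: (measurable_increment N_poisson (p := (x, u i)) s0 (u0 i)).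
Qed.

Lemma measurable_particles : measurable_fun setT particles.
Proof.
apply/measurable_fun_tnthP => i; apply: measurable_config => x.
rewrite (_ : (fun w => _) = fun w => (N x (u i) w)%:R); last first.
  by apply/funext => w; rewrite /= tnth_mktuple.
by apply: measurable_natr; exact: (measurable_N N_poisson _ (u0 i)).
Qed.

(** Several indices i may carry the same time, so the constraint on a pair of site and time collects
    all box conditions that fall on it. *)
Let box_constrained (f : site d * R -> T -> nat) l A :
  (fun w => [tuple (fun x => (f (x, u i) w)%:R) | i < n] : n.-tuple (config R d)) @^-1`
    coord_box l A =
  constrained f [seq (p.2, u p.1) | p <- l]
    (fun q => [set k | forall p, p \in l -> (p.2, u p.1) = q -> A p k%:R]).
Proof.
apply/seteqP; split=> w /= fw.
  move=> q _ p pl <-; have := fw p pl.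
  by rewrite tnth_mktuple.
move=> p pl; rewrite tnth_mktuple; apply: (fw (p.2, u p.1)) => //.
exact: (map_f (fun p : 'I_n * site d => (p.2, u p.1))).
Qed.

(** Two extensions from pi-systems: in B, from boxes, for F a generating past event, then in F. *)
Lemma past_future_law F B : <<s past_events >> F -> measurable B ->
  P (F `&` future_particles @^-1` B) = (P F * P (particles @^-1` B))%E.
Proof.
move=> pF mB.
have PE E : measurable E -> P E = (fine (P E))%:E by move=> mE; rewrite fineK // fin_num_measure.
have mfB : measurable (future_particles @^-1` B).
  by rewrite -[X in measurable X]setTI; exact: measurable_future_particles.
have mpB : measurable (particles @^-1` B).
  by rewrite -[X in measurable X]setTI; exact: measurable_particles.
have c0 : 0 <= fine (P (particles @^-1` B)) by exact: fine_ge0.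
rewrite muleC (PE _ mpB).
change (mrestr P mfB F = mscale (NngNum c0) P F).
apply: (g_sigma_algebra_measure_unique past_events _ (fun=> setT)) => //.
- by rewrite bigcup_const //; exists 0%N.
- move=> E0 pE; have mE := past_events_measurable pE.
  case: pE mE => C [ps [A [mC psP ->]]] mE.
  set E := _ `&` _ in mE *.
  change (P (E `&` future_particles @^-1` B) =
    ((fine (P (particles @^-1` B)))%:E * P E)%E).
  rewrite -PE // muleC (PE _ mE).
  apply: tuple_law => //.
  + exact/fine_ge0.
  + exact: measurable_future_particles.
  + exact: measurable_particles.
  move=> l A' _; rewrite -PE //.
  rewrite (box_constrained (increment N s)) (box_constrained count).
  apply: (initial_past_future_indep N_poisson eta0_init) => // q /mapP[p _ ->] /=.
  exact: u0.
- by move=> _; rewrite /= /mrestr setTI (le_lt_trans (probability_le1 _ mfB)) // ltry.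
Qed.

End future.

End past.

(** * Markov property and stationarity *)

Section freezing.
Context (dT dU dV : measure_display) (T : measurableType dT) (U : measurableType dU)
  (V : measurableType dV) (R : realType).
Variable P : probability T R.
Variables (X : T -> U) (Y Y' : T -> V).
Hypotheses (mX : measurable_fun setT X) (mY : measurable_fun setT Y) (mY' : measurable_fun setT Y').
Hypothesis XY : forall A B, measurable A -> measurable B ->
  P (X @^-1` A `&` Y @^-1` B) = (P (X @^-1` A) * P (Y' @^-1` B))%E.

Let rvX : {RV P >-> U} := HB.pack X (isMeasurableFun.Build _ _ _ _ _ mX).
Let rvY' : {RV P >-> V} := HB.pack Y' (isMeasurableFun.Build _ _ _ _ _ mY').

Let law_section (S : set (U * V)) x :
  P [set w | S (x, Y' w)] = distribution P rvY' (xsection S x).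
Proof.
by congr (P _); apply/seteqP; split=> w; rewrite /= /xsection /= inE.
Qed.

Lemma measurable_frozen (S : set (U * V)) : measurable S ->
  measurable_fun setT (fun x => P [set w | S (x, Y' w)]).
Proof.
move=> mS; under eq_fun do rewrite law_section.
exact: (measurable_fun_xsection (distribution P rvY') mS).
Qed.

(** By [XY] the joint law of X and Y is the product of the laws of X and Y'; Fubini then integrates
    Y' first. Y' may differ from Y, since the particles after time s are to be replaced by those
    after time 0. *)
Lemma freezing (S : set (U * V)) : measurable S ->
  P [set w | S (X w, Y w)] = (\int[P]_w P [set w' | S (X w, Y' w')])%E.
Proof.
move=> mS; have mXY : measurable_fun setT (fun w => (X w, Y w)) by exact: measurable_fun_pair.
transitivity ((distribution P rvX \x distribution P rvY')%E S).
  apply/esym; change ((distribution P rvX \x distribution P rvY')%E S =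
    pushforward P (fun w => (X w, Y w)) S).
  exact: (product_measure_unique (m' := pushforward P (fun w => (X w, Y w)))).
rewrite /product_measure1 ge0_integral_distribution //.
  by apply: eq_integral => w _; rewrite /= law_section.
exact: (measurable_fun_xsection (distribution P rvY') mS).
Qed.

End freezing.

Section process.
Variables (R : realType) (d : nat) (gamma : R).
Hypothesis gamma_gt0 : 0 < gamma.

Lemma measurable_add_particles dT (T : measurableType dT) (f : T -> config R d)
    (n : site d -> T -> nat) :
  measurable_fun setT f -> (forall x, measurable_fun setT (n x)) ->
  measurable_fun setT (fun w => add_particles (f w) (n ^~ w) : config R d).
Proof.
move=> mf mn; apply: measurable_config => x; apply: measurable_funD.
  exact: (measurableT_comp (measurable_coord x) mf).
exact: measurable_natr.
Qed.

Lemma measurable_stabilization :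
  measurable_fun setT (stabilization gamma : config R d -> config R d).
Proof.
rewrite (_ : stabilization gamma = stab gamma setT); first exact: measurable_stab.
by apply/funext => eta; rewrite stabilizationE.
Qed.

Variable phi : site d -> R.
Hypothesis phi_gt0 : forall x, 0 < phi x.
Hypothesis phi_bounded : exists M, forall x, phi x <= M.
Context (dT : measure_display) (T : measurableType dT) (P : probability T R).
Variable N : site d -> R -> T -> nat.
Hypothesis N_poisson : independent_poisson_processes P phi N.
Variable eta0 : {RV P >-> config R d}.
Hypothesis eta0_init : initial_config gamma N eta0.

Local Notation X := (sandpile_process gamma N eta0).

Lemma measurable_process t : 0 <= t -> measurable_fun setT (X t).
Proof.
move=> t0; apply: (measurableT_comp measurable_stabilization).
by apply: measurable_add_particles => // x; exact: (measurable_N N_poisson).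
Qed.

Definition update n (z : config R d * n.-tuple (config R d)) : n.-tuple (config R d) :=
  [tuple stab gamma setT (fun x => z.1 x + tnth z.2 i x) | i < n].

Lemma measurable_update n : measurable_fun setT (@update n).
Proof.
apply/measurable_fun_tnthP => i.
rewrite (_ : _ \o _ = fun z => stab gamma setT (fun x => z.1 x + tnth z.2 i x)); last first.
  by apply/funext => z; rewrite /= tnth_mktuple.
apply: (measurableT_comp (measurable_stab gamma _)); apply: measurable_configD => //.
exact: (measurableT_comp (measurable_tnth i) measurable_snd).
Qed.

Section time.
Variables (s : R) (s0 : 0 <= s) (n : nat) (u : 'I_n -> R).
Hypothesis u0 : forall i, 0 <= u i.

Local Notation D := (future_particles N s u).

Lemma process_update :
  {ae P, forall w, [tuple X (u i + s) w | i < n] = update (X s w, D w)}.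
Proof.
apply: filterS2 (ae_stabilizable gamma_gt0 phi_gt0 phi_bounded N_poisson) (ae_paths N_poisson).
move=> w b path; apply: eq_mktuple => i; rewrite tnth_mktuple /sandpile_process !(stabilizationE gamma_gt0) /=.
have us0 : 0 <= u i + s by rewrite addr_ge0.
have := b (eta0 w) _ (eta0_init.1 w) us0.
have -> : add_particles (eta0 w) (fun x => N x (u i + s) w) =
    (fun x => add_particles (eta0 w) (fun x => N x s w) x + (increment N s (x, u i) w)%:R).
  apply/funext => x; rewrite /add_particles /increment /= -addrA -natrD subnKC //.
  by apply: (path x).2; rewrite // lerDr.
by move=> b'; rewrite stab_abelian.
Qed.

Lemma measurable_process_past t : 0 <= t <= s ->
  measurable_fun (setT : set (g_sigma_algebraType (past_events N eta0 s))) (X t).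
Proof.
move=> ts; apply: (measurableT_comp measurable_stabilization).
apply: measurable_add_particles => [|x]; first exact: measurable_past_eta0.
exact: measurable_past_count.
Qed.

Lemma future_freezing F B : <<s past_events N eta0 s >> F -> measurable B ->
  P (F `&` [set w | B [tuple X (u i + s) w | i < n]]) =
  (\int[P]_(w in F) P [set w' | B (update (X s w, particles N u w'))])%E.
Proof.
move=> pF mB; pose past_type := g_sigma_algebraType (past_events N eta0 s).
have mF := past_measurable N_poisson pF.
(* Freezing is applied to the identity map into T with the past sigma-algebra, so that the event F
   and the configuration at time s are frozen together. *)
have mid : measurable_fun setT (fun w : T => w : past_type).
  by move=> _ A pA; rewrite setTI; exact: (past_measurable N_poisson pA).
have mD := measurable_future_particles N_poisson s0 u0.
have mp := measurable_particles N_poisson u0.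
pose S : set (past_type * n.-tuple (config R d)) := [set z | F z.1 /\ B (update (X s z.1, z.2))].
have mS : measurable S.
  rewrite (_ : S = (fst @^-1` F) `&` (fun z => update (X s z.1, z.2)) @^-1` B) //.
  apply: measurableI; rewrite -[X in measurable X]setTI; first exact: measurable_fst.
  have : measurable_fun (setT : set (past_type * n.-tuple (config R d))) (fun z => update (X s z.1, z.2)).
    apply: (measurableT_comp (@measurable_update n)); apply: measurable_fun_pair => //.
    apply: (measurableT_comp (measurable_process_past _)) => //.
    by rewrite s0 lexx.
  by apply.
have -> : P (F `&` [set w | B [tuple X (u i + s) w | i < n]]) = P [set w | S (w, D w)].
  apply: ae_measure_eq.
  - apply: measurableI => //; rewrite -[X in measurable X]setTI.
    have : measurable_fun setT (fun w => [tuple X (u i + s) w | i < n]).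
      apply/measurable_fun_tnthP => i.
      rewrite (_ : _ \o _ = X (u i + s)); last by apply/funext => w; rewrite /= tnth_mktuple.
      by apply: measurable_process; rewrite addr_ge0.
    by apply.
  - rewrite -[X in measurable X]setTI.
    by apply: (measurable_fun_pair mid mD).
  - by apply: filterS process_update => w e; rewrite /S /= e.
rewrite (freezing mid mD mp) //; last first.
  by move=> A C mA mC; exact: (past_future_law N_poisson eta0_init s0 u0).
rewrite [RHS]integral_mkcond; apply: eq_integral => w _; rewrite patchE.
case: ifPn => [/set_mem Fw|/negP nFw].
  by congr (P _); apply/seteqP; split=> w' //= [].
by rewrite -[RHS](measure0 P); congr (P _); apply/seteqP; split=> w' //= [/mem_set].
Qed.

End time.

Lemma process_markov : is_markov P X.
Proof.
split=> [|s t s0 st A mA]; first exact: measurable_process.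
have t0 : 0 <= t := le_trans s0 st.
pose u (i : 'I_1) := t - s; have u0 i : 0 <= u i by rewrite subr_ge0.
pose B : set (1.-tuple (config R d)) := [set v | A (tnth v ord0)].
have mB : measurable B.
  rewrite -[X in measurable X]setTI.
  exact: (measurable_tnth (ord0 : 'I_1)).
pose Phi z := P [set w' | B (update (z, particles N u w'))].
have mPhi : measurable_fun setT Phi.
  have mS : measurable [set z : config R d * 1.-tuple (config R d) | B (update z)].
    by rewrite -[X in measurable X]setTI; exact: measurable_update.
  have := measurable_frozen P (measurable_particles N_poisson u0) mS.
  exact.
(* A function of X at time s alone which has the right integral over every past event; it is
   therefore a version for both sigma-algebras. *)
pose g w := fine (Phi (X s w)).
have mg : measurable_fun setT (fun z => fine (Phi z)) by exact: measurableT_comp mPhi.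
have mXs := measurable_process s0.
have mset z : measurable [set w' | B (update (z, particles N u w'))].
  rewrite -[X in measurable X]setTI.
  have : measurable_fun setT (fun w' => update (z, particles N u w')).
    apply: (measurableT_comp (@measurable_update 1)); apply: measurable_fun_pair => //.
    exact: (measurable_particles N_poisson u0).
  by apply.
have Phi1 z : (Phi z <= 1)%E by exact: probability_le1.
have gE w : (g w)%:E = Phi (X s w) by rewrite fineK // fin_num_measure.
have mgX : measurable_fun setT g by exact: (measurableT_comp mg mXs).
have ig : P.-integrable setT (EFin \o g).
  apply/integrableP; split; first exact/measurable_EFinP.
  apply: (@le_lt_trans _ _ (\int[P]_w (cst 1%E w))%E).
    apply: ge0_le_integral => //.
      by apply/measurable_EFinP; exact: measurableT_comp mgX.
    move=> w _; rewrite /comp gE gee0_abs // measure_ge0.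
  by rewrite integral_cst //= probability_setT mule1 ltry.
have past_cond F : <<s past_events N eta0 s >> F ->
    (\int[P]_(w in F) (g w)%:E = P (X t @^-1` A `&` F))%E.
  move=> pF; rewrite (eq_integral (fun w => Phi (X s w))) => [|w _]; last exact: gE.
  rewrite -(future_freezing s0 u0 pF mB) setIC; congr (P (_ `&` _)).
  by apply/seteqP; split=> w; rewrite /B /= tnth_mktuple /u subrK.
have X_past r C : 0 <= r <= s -> measurable C -> <<s past_events N eta0 s >> (X r @^-1` C).
  move=> rs mC; rewrite -[X in <<s _ >> X]setTI.
  exact: (measurable_process_past rs).
exists g; split; split=> //.
- move=> C mC; apply: sub_sigma_algebra; exists s; first by rewrite /= s0 lexx.
  exists ((fun z => fine (Phi z)) @^-1` C); last by rewrite setTI.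
  by rewrite -[X in measurable X]setTI; exact: mg.
- move=> F sF; apply: past_cond; move: F sF; apply: smallest_sub.
    exact: smallest_sigma_algebra.
  by move=> _ [r rs [C mC <-]]; rewrite setTI; exact: X_past.
- move=> C mC; exists ((fun z => fine (Phi z)) @^-1` C); last by rewrite setTI.
  by rewrite -[X in measurable X]setTI; exact: mg.
- move=> _ [C mC <-]; apply: past_cond; rewrite setTI; apply: X_past => //.
  by rewrite s0 lexx.
Qed.

Section stationary.
Hypothesis d_gt0 : (0 < d)%N.
Variable m : probability (config R d) R.
Hypothesis m_lim : is_sandpile_measure gamma m.
Hypothesis eta0_law : forall A, measurable A -> P (eta0 @^-1` A) = m A.

(** The particles are frozen and the initial configuration is averaged; for almost every outcome of
    the particles, [particles_invariant] applies. *)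
Lemma process_law t A : 0 <= t -> measurable A -> P (X t @^-1` A) = m A.
Proof.
move=> t0 mA; pose u (i : 'I_1) := t; have u0 i : 0 <= u i by [].
(* Taking the past at time 0 makes [past_future_law] the independence of the initial configuration
   and the particles; almost surely D is the count at time t. *)
pose D := future_particles N 0 u.
have mD : measurable_fun setT D by exact: (measurable_future_particles N_poisson).
pose S : set (1.-tuple (config R d) * config R d) :=
  [set z | A (tnth (update (z.2, z.1)) ord0)].
have mS : measurable S.
  rewrite -[X in measurable X]setTI.
  have : measurable_fun setT (fun z : 1.-tuple (config R d) * config R d => tnth (update (z.2, z.1)) ord0).
    apply: (measurableT_comp (measurable_tnth ord0)); apply: (measurableT_comp (@measurable_update 1)).
    exact: measurable_fun_pair.
  by apply.
have ND : {ae P, forall w, forall x, tnth (D w) ord0 x = (N x t w)%:R}.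
  apply: filterS (ae_paths N_poisson) => w path x; rewrite tnth_mktuple /increment /= /u addr0.
  by rewrite (path x).1 subn0.
have meta : measurable_fun setT eta0 by exact: measurable_funP.
have -> : P (X t @^-1` A) = P [set w | S (D w, eta0 w)].
  apply: ae_measure_eq.
  - by rewrite -[X in measurable X]setTI; exact: measurable_process.
  - by rewrite -[X in measurable X]setTI; exact: (measurable_fun_pair mD meta).
  - apply: filterS ND => w e; rewrite /S /= tnth_mktuple /sandpile_process (stabilizationE gamma_gt0) /=.
    rewrite (_ : add_particles _ _ = (fun x => eta0 w x + tnth (D w) ord0 x)) //.
    by apply/funext => x; rewrite e.
rewrite (freezing mD meta meta) //; last first.
  move=> B C mB mC.
  have past_law E : <<s past_events N eta0 0 >> E -> P (E `&` D @^-1` B) = (P E * P (particles N u @^-1` B))%E.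
    by move=> pE; exact: (past_future_law N_poisson eta0_init (lexx 0) u0).
  have pT := past_law setT (@measurableT _ (g_sigma_algebraType (past_events N eta0 0))).
  rewrite setTI probability_setT mul1e in pT.
  rewrite setIC past_law -?pT 1?muleC // -[X in <<s _ >> X]setTI.
  have mp := @measurable_past_eta0 _ _ _ _ P N eta0 0.
  exact: mp.
rewrite (ae_eq_integral (cst (m A))) //=.
- by rewrite integral_cst //= probability_setT mule1.
- exact: measurableT_comp (measurable_frozen P meta mS) mD.
apply: filterS2 ND (ae_finite_topplings gamma_gt0 phi_gt0 phi_bounded N_poisson) => w e b _.
rewrite /S /= -(particles_invariant gamma_gt0 m_lim d_gt0 (b _ t0) mA) -eta0_law; last first.
  rewrite -[X in measurable X]setTI.
  apply: (measurableT_comp (measurable_stab gamma setT) (measurable_add_particles _ _)) => //.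
congr (P _); apply/seteqP; split=> w' /=; rewrite tnth_mktuple /=;
  rewrite (_ : add_particles _ _ = (fun x => eta0 w' x + tnth (D w) ord0 x)) //;
  by apply/funext => x; rewrite e.
Qed.

Lemma process_stationary : is_stationary P X.
Proof.
split=> [|n u s u0 s0 B mB]; first exact: measurable_process.
pose Phi z := P [set w | B (update (z, particles N u w))].
have mPhi : measurable_fun setT Phi.
  have mS : measurable [set z : config R d * n.-tuple (config R d) | B (update z)].
    by rewrite -[X in measurable X]setTI; exact: measurable_update.
  have := measurable_frozen P (measurable_particles N_poisson u0) mS.
  exact.
(* The joint law after a shift by r is an integral of Phi against the law at time r, which is m for
   every r. *)
have law (v : 'I_n -> R) r : v = (fun i => u i + r) -> 0 <= r ->
    P [set w | B [tuple X (v i) w | i < n]] = (\int[m]_z Phi z)%E.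
  move=> -> r0.
  have -> : P [set w | B [tuple X (u i + r) w | i < n]] = (\int[P]_w Phi (X r w))%E.
    rewrite -(future_freezing r0 u0 _ mB) ?setTI //.
    exact: (@measurableT _ (g_sigma_algebraType (past_events N eta0 r))).
  have mX := measurable_process r0.
  transitivity (\int[pushforward P (X r)]_z Phi z)%E.
    by rewrite ge0_integral_pushforward.
  by apply: eq_measure_integral => A mA _; exact: process_law.
have u_shift0 : u = (fun i => u i + 0) by apply/funext => i; rewrite addr0.
exact: etrans (law (fun i => u i + s) s erefl s0) (esym (law u 0 u_shift0 (lexx 0))).
Qed.

End stationary.

End process.

Theorem theorem5p1 (R : realType) (d : nat) (d_gt0 : (0 < d)%N)
    (gamma : R) (gamma_gt0 : 0 < gamma)
    (phi : site d -> R) (phi_gt0 : forall x, 0 < phi x)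
    (phi_bounded : exists M, forall x, phi x <= M)
    (dT : measure_display) (T : measurableType dT) (P : probability T R)
    (N : site d -> R -> T -> nat)
    (N_poisson : independent_poisson_processes P phi N) :
  [/\ {ae P, forall w, forall (eta0 : config R d) (t : R),
        stable_configs gamma eta0 -> 0 <= t ->
        stabilizable gamma (add_particles eta0 (fun x => N x t w))},
      forall eta0 : {RV P >-> config R d}, initial_config gamma N eta0 ->
        is_markov P (sandpile_process gamma N eta0),
      {ae P, forall w, forall (eta0 : config R d) (t : R),
        stable_configs gamma eta0 -> 0 <= t ->
        addition_ops gamma V (fun x => N x t w) eta0
          @[V --> @finite_sets_up (site d)] -->
          sandpile_process gamma N (fun=> eta0) t w} &
      forall (m : probability (config R d) R) (eta0 : {RV P >-> config R d}),
        is_sandpile_measure gamma m ->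
        initial_config gamma N eta0 ->
        (forall A, measurable A -> P (eta0 @^-1` A) = m A) ->
        is_stationary P (sandpile_process gamma N eta0)].
Proof.
have stabilizes := ae_stabilizable gamma_gt0 phi_gt0 phi_bounded N_poisson.
split.
- apply: filterS stabilizes => w b eta t st t0.
  by apply/(stabilizableP gamma_gt0); exact: b.
- by move=> eta0 eta0_init; exact: (process_markov gamma_gt0 phi_gt0 phi_bounded N_poisson).
- apply: filterS stabilizes => w b eta t st t0.
  rewrite /sandpile_process (stabilizationE gamma_gt0).
  by apply: addition_ops_cvg => //; exact: b.
- move=> m eta0 m_lim eta0_init eta0_law.
  exact: (process_stationary gamma_gt0 phi_gt0 phi_bounded N_poisson eta0_init d_gt0 m_lim).
Qed.
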